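(* Let $N\ge 2$ be an integer, $0<s<1$ and $1<p<\infty$. (a) If $ps\neq N$, then for every $\beta\in\left(-\tfrac{N}{p-1},\tfrac{ps}{p-1}\right)$ the function $v_\beta(x)=|x|^{\beta}$ is a weak solution of $$(-\Delta_p)^s v_\beta(x)=\mathcal{C}(\beta)|x|^{\beta(p-1)-sp}\quad\text{in }\mathbb{R}^N\setminus\{0\},$$ where $$\mathcal{C}(\beta)=4\pi\alpha_N\int_{0}^{1}\left|1-\rho^{\beta}\right|^{p-2}\left(1-\rho^{\beta}\right)\left[\rho^{N-1}-\rho^{ps-\beta(p-1)-1}\right]G(\rho^{2})\,d\rho,$$ with $$\alpha_N=\frac{\pi^{\frac{N-3}{2}}}{\Gamma\left(\frac{N-1}{2}\right)},\qquad G(t)=B\left(\tfrac{N-1}{2},\tfrac12\right)F\left(\tfrac{N+ps}{2},\tfrac{ps+2}{2};\tfrac{N}{2};t\right),$$ and $\Gamma$, $B$, $F$ denote the gamma function, the beta function and the Gauss hypergeometric function ${}_2F_1$, respectively. Additionally, for $\beta$ in this range, $$\mathcal{C}(\beta)\begin{cases}=0&\text{if }\beta=0\text{ or }\beta=\tfrac{ps-N}{p-1},\\ >0&\text{if }\min\{\tfrac{ps-N}{p-1},0\}<\beta<\max\{\tfrac{ps-N}{p-1},0\},\\ <0&\text{otherwise.}\end{cases}$$ (b) If $ps=N$, then $v(x)=\log(|x|)$ is a weak solution of $$(-\Delta_p)^s v(x)=0\quad\text{in }\mathbb{R}^N\setminus\{0\}.$$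
   Context: Write $\Psi_p(t)=|t|^{p-2}t$ (with $\Psi_p(0)=0$). The fractional $p$-Laplacian, with its normalization constant omitted, is $$(-\Delta_p)^su(x)=2\lim_{\varepsilon\to0^+}\int_{\mathbb{R}^N\setminus B_\varepsilon(x)}\frac{\Psi_p(u(x)-u(y))}{|x-y|^{N+sp}}\,dy.$$ For an open set $U\subseteq\mathbb{R}^N$, $W^{s,p}(U)$ is the set of $u\in L^p(U)$ with $\int_{U}\int_U\frac{|u(x)-u(y)|^p}{|x-y|^{N+sp}}\,dx\,dy<\infty$, and $W^{s,p}_{loc}(U)$ is the corresponding local space. Also $$L^{p-1}_s(\mathbb{R}^N)=\left\{u\in L^{p-1}_{loc}(\mathbb{R}^N):\int_{\mathbb{R}^N}\frac{|u(x)|^{p-1}}{(1+|x|)^{N+sp}}\,dx<\infty\right\}.$$ Weak solutions: let $\Omega\subseteq\mathbb{R}^N$ be open and $f:\Omega\times\mathbb{R}\to\mathbb{R}$ continuous. A function $u\in L_s^{p-1}(\mathbb{R}^N)$ is a weak super-solution (respectively sub-solution) of $(-\Delta_p)^su=f(x,u)$ in $\Omega$ if for every bounded open $U\subseteq\Omega$ one has $u\in W^{s,p}_{loc}(U)$ and $$\int_{\mathbb{R}^{2N}}\frac{\Psi_p(u(x)-u(y))(\varphi(x)-\varphi(y))}{|x-y|^{N+sp}}\,dx\,dy\ \ge\ (\text{respectively }\le)\ \int_{\mathbb{R}^N}f(x,u)\varphi(x)\,dx$$ for every non-negative $\varphi\in C_c^\infty(U)$. It is a weak solution if it is both a weak super-solution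 and a weak sub-solution. *)

(* Defs.v *)
From HB Require Import structures.
From mathcomp Require Import all_boot all_order all_algebra.
From mathcomp Require Import all_classical all_reals all_analysis.

Set Implicit Arguments.
Unset Strict Implicit.
Unset Printing Implicit Defensive.

Import Order.TTheory GRing.Theory Num.Theory.
Import numFieldNormedType.Exports.

Local Open Scope classical_set_scope.
Local Open Scope ring_scope.

Section rV_measurable.
Context {R : realType}.
Variable n : nat.

Definition rV_coord (i : 'I_n) (x : 'rV[R]_n) : R := x ord0 i.

Let rV_set0 : g_sigma_preimage rV_coord set0.
Proof. exact: sigma_algebra0. Qed.

Let rV_setC A : g_sigma_preimage rV_coord A -> g_sigma_preimage rV_coord (~` A).
Proof. exact: sigma_algebraC. Qed.

Let rV_bigcup (F : _^nat) : (forall i, g_sigma_preimage rV_coord (F i)) ->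
  g_sigma_preimage rV_coord (\bigcup_i (F i)).
Proof. exact: sigma_algebra_bigcup. Qed.

(* The sigma-algebra generated by the coordinates is the Borel one. *)
HB.instance Definition _ := @isMeasurable.Build default_measure_display
  'rV[R]_n (g_sigma_preimage rV_coord) rV_set0 rV_setC rV_bigcup.

Lemma measurable_rV_coord i : measurable_fun [set: 'rV[R]_n] (rV_coord i).
Proof.
move=> _ Y mY; rewrite setTI; apply: sub_sigma_algebra => /=.
rewrite -bigcup_seq/=; exists i => /=; first by rewrite mem_index_enum.
by exists Y => //; rewrite setTI.
Qed.

End rV_measurable.

Lemma measurable_fun_rVP {R : realType} n d (T : measurableType d)
    (f : T -> 'rV[R]_n) :
  (forall i, measurable_fun [set: T] (rV_coord i \o f)) ->
  measurable_fun [set: T] f.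
Proof.
move=> mf.
suff H : g_sigma_preimage (fun i => rV_coord i \o f) `<=` measurable.
  move: H; rewrite g_sigma_preimage_comp => H _ A mA.
  by apply: H; exists A.
apply: smallest_sub; first exact: sigma_algebra_measurable.
case: n f mf => [|m] f mf; first by rewrite big_ord0.
rewrite -bigcup_mkord_ord; apply: bigcup_sub => i Ii.
by move=> A [B mB <-]; exact: mf.
Qed.

Section rV_cons.
Context {R : realType} {n : nat}.

Definition rV_cons (p : measurableTypeR R * 'rV[R]_n) : 'rV[R]_n.+1 :=
  row_mx (p.1%:M : 'rV[R]_1) p.2.

Definition rV_uncons (x : 'rV[R]_n.+1) : measurableTypeR R * 'rV[R]_n :=
  (x ord0 ord0, @rsubmx R 1 1 n x).

Lemma rV_consK : cancel rV_cons rV_uncons.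
Proof.
move=> [a x]; rewrite /rV_uncons /rV_cons /=; congr pair; last exact: row_mxKr.
rewrite (_ : @ord0 n = lshift n (@ord0 0)); last exact: val_inj.
by apply: etrans (row_mxEl _ _ _ _) _; rewrite mxE eqxx mulr1n.
Qed.

Lemma rV_unconsK : cancel rV_uncons rV_cons.
Proof.
move=> x; apply: etrans (@hsubmxK R 1 1 n x); rewrite /rV_cons /=.
apply: (congr1 (fun u => @row_mx R 1 1 n u _)).
apply/rowP => i; rewrite !ord1 !mxE eqxx mulr1n.
by congr (x _ _); exact: val_inj.
Qed.

Lemma rV_cons0 p : rV_cons p ord0 ord0 = p.1.
Proof. by rewrite -{2}(rV_consK p). Qed.

Lemma rV_consS p (i : 'I_n) : rV_cons p ord0 (lift ord0 i) = p.2 ord0 i.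
Proof.
rewrite -[in RHS](rV_consK p) /rV_uncons/= [RHS]mxE.
by apply: (congr1 (fun j => rV_cons p ord0 j)); exact: val_inj.
Qed.

Lemma measurable_rV_cons : measurable_fun setT rV_cons.
Proof.
apply: measurable_fun_rVP => i; have [->|i0] := eqVneq i ord0.
  rewrite (_ : _ \o _ = fst); first exact: measurable_fst.
  by apply/funext => p; exact: rV_cons0.
have [j ->] : exists j, i = lift ord0 j.
  by case: (unliftP ord0 i) i0 => [j ->|->]; [exists j|rewrite eqxx].
rewrite (_ : _ \o _ = rV_coord j \o snd).
  by apply: measurableT_comp; [exact: measurable_rV_coord|exact: measurable_snd].
by apply/funext => p; exact: rV_consS.
Qed.

Lemma measurable_rV_uncons : measurable_fun setT rV_uncons.
Proof.
apply/measurable_fun_pairP; split.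
  rewrite (_ : _ \o _ = rV_coord ord0); last by apply/funext.
  exact: measurable_rV_coord.
apply: measurable_fun_rVP => j.
rewrite (_ : _ \o _ = rV_coord (rshift 1 j)); first exact: measurable_rV_coord.
by apply/funext => x /=; rewrite /rV_coord mxE.
Qed.

Variable m : {sigma_finite_measure set 'rV[R]_n -> \bar R}.

Definition lebesgue_cons : set 'rV[R]_n.+1 -> \bar R :=
  pushforward (lebesgue_measure \x m)%E rV_cons.


Let lebesgue_cons0 : lebesgue_cons set0 = 0%E.
Proof. by rewrite /lebesgue_cons /pushforward preimage_set0 measure0. Qed.

Let lebesgue_cons_ge0 A : (0 <= lebesgue_cons A)%E.
Proof. exact: (measure_ge0 (lebesgue_measure \x m)%E). Qed.

Let lebesgue_cons_sigma_additive : semi_sigma_additive lebesgue_cons.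
Proof.
move=> F mF tF mUF; rewrite /lebesgue_cons /pushforward preimage_bigcup.
apply: measure_semi_sigma_additive.
- by move=> k; rewrite -[X in measurable X]setTI; exact: measurable_rV_cons.
- apply/trivIsetP => /= i j _ _ ij; rewrite -preimage_setI.
  by move/trivIsetP : tF => /(_ _ _ _ _ ij) ->//; rewrite preimage_set0.
- rewrite -preimage_bigcup -[X in measurable X]setTI.
  exact: measurable_rV_cons.
Qed.

HB.instance Definition _ := isMeasure.Build _ _ _ lebesgue_cons
  lebesgue_cons0 lebesgue_cons_ge0 lebesgue_cons_sigma_additive.

Let lebesgue_cons_sigma_finite : sigma_finite setT lebesgue_cons.
Proof.
have /sigma_finiteP[F [FT ndF Foo]] := sigma_finiteT (@lebesgue_measure R).
have /sigma_finiteP[G [GT ndG Goo]] := sigma_finiteT m.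
exists (fun k => rV_uncons @^-1` (F k `*` G k)).
  rewrite -preimage_bigcup -[LHS](preimage_setT rV_uncons); congr (_ @^-1` _).
  rewrite -setXTT FT GT predeqE => -[x y]; split.
    move=> [/= [i _ Fix] [j _ Gjy]]; exists (maxn i j) => //; split.
    - by move: x Fix; exact/subsetPset/ndF/leq_maxl.
    - by move: y Gjy; exact/subsetPset/ndG/leq_maxr.
  by move=> [i _ []/= ? ?]; split; exists i.
move=> k; have [mF Fk] := Foo k; have [mG Gk] := Goo k; split.
  rewrite -[X in measurable X]setTI; apply: measurable_rV_uncons => //.
  exact: measurableX.
rewrite /lebesgue_cons /pushforward -comp_preimage.
rewrite (_ : rV_uncons \o rV_cons = id) ?preimage_id; last first.
  by apply/funext => p; exact: rV_consK.
by rewrite product_measure1E// lte_mul_pinfty// ge0_fin_numE.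
Qed.

HB.instance Definition _ := Measure_isSigmaFinite.Build _ _ _ lebesgue_cons
  lebesgue_cons_sigma_finite.

End rV_cons.

Fixpoint lebesgue_rV {R : realType} (n : nat) :
    {sigma_finite_measure set 'rV[R]_n -> \bar R} :=
  match n with
  | 0%N => [the {sigma_finite_measure set 'rV[R]_0 -> \bar R} of
             @dirac _ 'rV[R]_0 0 R]
  | n'.+1 => [the {sigma_finite_measure set 'rV[R]_n'.+1 -> \bar R} of
             lebesgue_cons (lebesgue_rV n')]
  end.

Lemma lebesgue_rV_box {R : realType} n (a b : 'rV[R]_n) :
  (forall i, a ord0 i <= b ord0 i) ->
  lebesgue_rV n [set x | forall i, a ord0 i <= x ord0 i <= b ord0 i] =
  (\prod_(i < n) (b ord0 i - a ord0 i))%:E.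
Proof.
elim: n a b => [|n IH] a b ab.
  by rewrite big_ord0 /= diracE mem_set// => -[].
pose box k (u v : 'rV[R]_k) :=
  [set x : 'rV[R]_k | forall i, u ord0 i <= x ord0 i <= v ord0 i].
have mbox k (u v : 'rV[R]_k) : measurable (box k u v).
  rewrite (_ : box _ _ _ = \big[setI/setT]_(i < k)
      ([set: 'rV[R]_k] `&` rV_coord i @^-1` `[u ord0 i, v ord0 i])).
    apply: bigsetI_measurable => i _.
    by apply: measurable_rV_coord => //; exact: measurable_itv.
  apply/seteqP; split => x /=.
    move=> ux; rewrite big_seq; elim/big_ind : _ => //= i _.
    by split => //; rewrite /= in_itv/=; exact: ux.
  move=> + i; rewrite (bigD1 i)//= => -[[_]].
  by rewrite /= in_itv.
pose a' := @rsubmx R 1 1 n a; pose b' := @rsubmx R 1 1 n b.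
have a'E i : a' ord0 i = a ord0 (lift ord0 i).
  by rewrite mxE; congr (a _ _); exact: val_inj.
have b'E i : b' ord0 i = b ord0 (lift ord0 i).
  by rewrite mxE; congr (b _ _); exact: val_inj.
rewrite /= /lebesgue_cons /pushforward.
rewrite (_ : _ @^-1` _ = `[a ord0 ord0, b ord0 ord0]%classic `*` box n a' b').
  rewrite product_measure1E//; last exact: mbox.
  rewrite /box IH; last by move=> i; rewrite a'E b'E.
  rewrite big_ord_recl EFinM; congr (_ * _)%E; last first.
    by congr EFin; apply: eq_bigr => i _; rewrite a'E b'E.
  apply: etrans (lebesgue_measure_itv _) _; rewrite /= lte_fin.
  have := ab ord0; rewrite le_eqVlt => /predU1P[->|->]; last by rewrite EFinB.
  by rewrite ltxx subrr.
apply/seteqP; split => [p /= pab|p /= [p1 p2] i].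
  split; first by rewrite in_itv/=; have := pab ord0; rewrite rV_cons0.
  by move=> i; rewrite a'E b'E -rV_consS; exact: pab.
have [j ->|->] := unliftP ord0 i.
  by rewrite rV_consS -a'E -b'E; exact: p2.
by move: p1; rewrite rV_cons0 in_itv.
Qed.

Section special_functions.
Context {R : realType}.
Implicit Types a b c t z : R.

Definition Gamma_fun z : R :=
  \int[lebesgue_measure]_(t in `]0%R, +oo[) (t `^ (z - 1) * expR (- t)).

Definition Beta_fun a b : R :=
  \int[lebesgue_measure]_(t in `]0%R, 1%R[) (t `^ (a - 1) * (1 - t) `^ (b - 1)).

Definition pochhammer a (k : nat) : R := \prod_(i < k) (a + i%:R).

Definition hypergeom2F1 a b c t : R :=
  limn (series (fun k => pochhammer a k * pochhammer b k / pochhammer c k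
                         * t ^+ k / k`!%:R)).

End special_functions.

Section fractional_p_laplacian.
Context {R : realType} {N : nat}.
Implicit Types (s p : R) (U V Omega : set 'rV[R]_N) (u phi : 'rV[R]_N -> R).

Local Notation mu := (@lebesgue_rV R N).

(* The library norm on 'rV[R]_N is the sup norm. *)
Definition eucl_norm (x : 'rV[R]_N) : R :=
  Num.sqrt (\sum_(i < N) x ord0 i ^+ 2).

Definition Psi p t : R := `|t| `^ (p - 2) * t.

Fixpoint Ck (k : nat) (f : 'rV[R]_N -> R) : Prop :=
  continuous f /\
  if k is k'.+1 then
    forall i : 'I_N, (forall x, derivable f x (delta_mx ord0 i)) /\
                     Ck k' ('D_(delta_mx ord0 i) f)
  else True.

Definition test_function U phi : Prop :=
  [/\ forall k, Ck k phi, compact (closure [set x | phi x != 0])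
     & closure [set x | phi x != 0] `<=` U].

Definition Lp p U u : Prop :=
  measurable_fun U u /\ (\int[mu]_(x in U) (`|u x| `^ p)%:E < +oo)%E.

Definition Wsp s p U u : Prop :=
  Lp p U u /\
  (\int[mu]_(x in U) \int[mu]_(y in U)
     (`|u x - u y| `^ p / eucl_norm (x - y) `^ (N%:R + s * p))%:E < +oo)%E.

Definition Wsp_loc s p U u : Prop :=
  forall V, open V -> compact (closure V) -> closure V `<=` U -> Wsp s p V u.

Definition tail_space s p u : Prop :=
  [/\ measurable_fun setT u,
      forall K, compact K -> (\int[mu]_(x in K) (`|u x| `^ (p - 1))%:E < +oo)%E
    & (\int[mu]_x (`|u x| `^ (p - 1) / (1 + eucl_norm x) `^ (N%:R + s * p))%:E
        < +oo)%E].

Definition weak_integrand s p u phi (z : 'rV[R]_N * 'rV[R]_N) : \bar R :=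
  (Psi p (u z.1 - u z.2) * (phi z.1 - phi z.2)
     / eucl_norm (z.1 - z.2) `^ (N%:R + s * p))%:E.

(* Values of u at a single point are irrelevant: for |x|^beta and log|x| the
   library conventions at x = 0 (0 `^ a = (a == 0)%:R and ln 0 = 0) only affect
   a null set, and so does division by 0 on the diagonal. *)
(* The function [f] is only relevant on Omega x R, where it is meant to be
   continuous: test functions vanish outside Omega. The two integrability
   conditions say that the integrals being compared are meaningful. *)
Definition weak_formulation (rel : \bar R -> \bar R -> bool) s p Omega
    (f : 'rV[R]_N -> R -> R) u : Prop :=
  tail_space s p u /\
  forall U, open U -> bounded_set U -> U `<=` Omega ->
    Wsp_loc s p U u /\
    forall phi, test_function U phi -> (forall x, 0 <= phi x) ->
      [/\ (mu \x mu)%E.-integrable setT (weak_integrand s p u phi),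
          mu.-integrable setT (fun x => (f x (u x) * phi x)%:E)
        & rel (\int[mu \x mu]_z weak_integrand s p u phi z)%E
              (\int[mu]_x (f x (u x) * phi x)%:E)%E].

Definition weak_supersolution := weak_formulation (fun lhs rhs => rhs <= lhs)%E.

Definition weak_subsolution := weak_formulation (fun lhs rhs => lhs <= rhs)%E.

Definition weak_solution s p Omega f u : Prop :=
  weak_supersolution s p Omega f u /\ weak_subsolution s p Omega f u.

End fractional_p_laplacian.

Section constant.
Context {R : realType}.
Variables (N : nat) (s p : R).

Definition alpha_N : R :=
  pi `^ ((N%:R - 3) / 2) / Gamma_fun ((N%:R - 1) / 2 : R).

Definition G_hyp (t : R) : R :=
  Beta_fun ((N%:R - 1) / 2) (1 / 2)
  * hypergeom2F1 ((N%:R + p * s) / 2) ((p * s + 2) / 2) (N%:R / 2) t.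

Definition Cbeta (beta : R) : R :=
  4 * pi * alpha_N *
  \int[lebesgue_measure]_(rho in `]0%R, 1%R[)
    (`|1 - rho `^ beta| `^ (p - 2) * (1 - rho `^ beta)
     * (rho `^ (N%:R - 1) - rho `^ (p * s - beta * (p - 1) - 1))
     * G_hyp (rho ^+ 2)).

End constant.

(* Main.v *)
(* For a radial u = U(|x|) the weak form is computed through the ratio
   rho = |y| / |x|. The mean of |x - y|^-(N + ps) over the sphere |y| = rho |x|
   is |x|^-(N + ps) F((N + ps) / 2, (ps + 2) / 2; N / 2; rho^2): after
   symmetrizing in y -> -y expand in even powers of the scalar product x.y,
   integrate each power over shells via Gaussian moments, and sum with a
   quadratic transformation of F, which follows from uniqueness of the regular
   solution of the hypergeometric equation. Homogeneity of the increments of U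
   separates the variables on the scale-invariant region |y| <= theta |x|, where
   the phi(x) and phi(y) parts are separately integrable and the second is
   brought back to the first by rho -> 1 / rho. Then theta -> 1, by dominated
   convergence in the weak form and by monotone convergence in the constant,
   since rho^(N - 1) - rho^(ps - beta (p - 1) - 1) has constant sign on (0, 1);
   C(beta) is finite because a bump test function gives a finite weak form. Its
   sign is that of 1 - rho^beta times this bracket. *)

From HB Require Import structures.
Require Import Defs.
From mathcomp Require Import all_boot all_order all_algebra.
From mathcomp Require Import all_classical all_reals all_analysis.
From mathcomp Require Import measurable_realfun ring lra.

Import Order.TTheory GRing.Theory Num.Theory.
Import numFieldNormedType.Exports.

Local Open Scope classical_set_scope.
Local Open Scope ring_scope.

(** The obstacle is the diagonal. Only the product of the increments, [Psi p] of that of u times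
    that of phi, is integrable against |x - y|^-(N + ps). The phi(x) and phi(y) parts taken alone
    can diverge there, namely when s p >= p - 1, and separating the variables needs them alone.
    Cutting by a ratio rather than by a distance keeps every piece homogeneous, so each inner
    integral is a power of |x| or |y| times a number. No surface measure is involved: a measure on
    (0, +oo) is determined by its values on the intervals ]0, b]; dilations give these up to one
    constant, which the Gaussian supplies. Symmetrizing makes all terms of the expansion
    nonnegative, so sums and integrals are exchanged before any convergence is known. For the same
    reason Gamma, Beta and the masses are extended real numbers at first. The regions |y| < |x| and
    |x| < |y| contribute equally, whence the factor 2 in 4 pi alpha_N B((N - 1)/2, 1/2) = 2
    |S^(N-1)|. *)

Section derivative_rules.
Context {R : realType}.
Implicit Types f g : R -> R.

(** * One-variable differential calculus *)

Lemma is_deriveM1 f g (x a b : R) : is_derive x 1 f a -> is_derive x 1 g b ->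
  is_derive x 1 (fun y => f y * g y) (a * g x + f x * b).
Proof.
move=> fa gb; have := is_deriveM fa gb.
by rewrite /GRing.scale /= addrC [g x * a]mulrC.
Qed.

Lemma is_deriveD1 f g (x a b : R) : is_derive x 1 f a -> is_derive x 1 g b ->
  is_derive x 1 (fun y => f y + g y) (a + b).
Proof. by move=> fa gb; exact: is_deriveD. Qed.

Lemma is_deriveB1 f g (x a b : R) : is_derive x 1 f a -> is_derive x 1 g b ->
  is_derive x 1 (fun y => f y - g y) (a - b).
Proof. by move=> fa gb; exact: is_deriveB. Qed.

Lemma is_deriveZ1 (k : R) f (x a : R) : is_derive x 1 f a ->
  is_derive x 1 (fun y => k * f y) (k * a).
Proof. by move=> fa; exact: is_deriveZ. Qed.

Lemma is_derive_comp1 f g (x a b : R) : is_derive (g x) 1 f a ->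
  is_derive x 1 g b -> is_derive x 1 (fun y => f (g y)) (a * b).
Proof. exact: is_derive1_comp. Qed.

Lemma is_deriveX1 f n (x a : R) : is_derive x 1 f a ->
  is_derive x 1 (fun y => f y ^+ n) (n%:R * f x ^+ n.-1 * a).
Proof.
move=> fa; elim: n => [|n IH].
  by rewrite !mul0r; exact: is_derive_cst.
have -> : (fun y => f y ^+ n.+1) = (fun y => f y * f y ^+ n).
  by apply/funext => y; rewrite exprS.
apply: (is_derive_eq (is_deriveM1 _ _ _ _ _ fa IH)); rewrite /= -nat1r.
by case: n {IH} => [|n]; rewrite /= ?exprS; ring.
Qed.

Lemma is_derive_continuous f (x a : R) :
  is_derive x 1 f a -> {for x, continuous f}.
Proof. by move=> [fx _]; apply/differentiable_continuous/derivable1_diffP. Qed.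

Lemma is_derive0_eq (f : R -> R) (a b : R) : a < b ->
  (forall x, a <= x <= b -> {for x, continuous f}) ->
  (forall x, a < x < b -> is_derive x 1 f 0) -> f a = f b.
Proof.
move=> ab cf f0.
have df x : x \in `]a, b[ -> is_derive x 1 f 0 by rewrite in_itv; exact: f0.
have cwf : {within `[a, b], continuous f}.
  by apply: continuous_in_subspaceT => x; rewrite inE/= in_itv/=; exact: cf.
have [c _ /eqP] := MVT ab df cwf.
by rewrite mul0r subr_eq0 => /eqP.
Qed.

End derivative_rules.

(** * Power series and their termwise differentiation *)

Section power_series.
Context {R : realType}.
Implicit Types (a u : nat -> R).

Lemma is_cvg_series_ratio u (q : R) (n0 : nat) : 0 < q < 1 ->
  (forall n, (n0 <= n)%N -> `|u n.+1| <= q * `|u n|) -> cvgn (series u).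
Proof.
move=> /andP[q0 q1] uq.
(* Each of the first [n0.+1] terms is at most [M * q ^+ i], so the geometric bound holds from index
   0 on and not only past [n0]. *)
pose M := \sum_(i < n0.+1) `|u i| / q ^+ i.
have uM n : `|u n| <= M * q ^+ n.
  have small k : (k <= n0)%N -> `|u k| <= M * q ^+ k.
    move=> kn0; rewrite -ler_pdivrMr ?exprn_gt0// /M.
    rewrite (bigD1 (Ordinal (kn0 : (k < n0.+1)%N)))//= lerDl.
    by apply: sumr_ge0 => i _; rewrite divr_ge0// exprn_ge0// ltW.
  elim: n => [|n IH]; first exact: small.
  have [/small//|] := leqP n.+1 n0; rewrite ltnS => n0n.
  apply: (le_trans (uq _ n0n)); rewrite exprS mulrCA ler_wpM2l// ltW//.
apply: normed_cvg; apply: (@series_le_cvg _ _ (geometric M q)) => //=.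
- move=> n; apply: le_trans (uM n); exact: normr_ge0.
by apply: is_cvg_geometric_series; rewrite gtr0_norm.
Qed.

Definition psum a (x : R) : R := limn (pseries a x).

(** Plays the part of a radius of convergence. It is stable under termwise differentiation, so
    derivatives of every order are available on the same disc. *)
Definition cvg_on (r : R) a := forall x, `|x| < r -> cvgn (pseries a x).

Lemma cvg_onD r a b : cvg_on r a -> cvg_on r b -> cvg_on r (fun n => a n + b n).
Proof.
move=> ca cb x xr; have := is_cvg_seriesD (ca x xr) (cb x xr).
by congr (cvgn _); apply/funext => n; apply: eq_bigr => i _; rewrite /= mulrDl.
Qed.

Lemma cvg_onZ r k a : cvg_on r a -> cvg_on r (fun n => k * a n).
Proof.
move=> ca x xr; have := @is_cvg_seriesZ _ _ k (ca x xr).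
by congr (cvgn _); apply/funext => n; apply: eq_bigr => i _; rewrite /= -mulrA.
Qed.

Lemma psumD r a b x : cvg_on r a -> cvg_on r b -> `|x| < r ->
  psum (fun n => a n + b n) x = psum a x + psum b x.
Proof.
move=> ca cb xr; rewrite /psum -lim_seriesD; [|exact: ca|exact: cb].
by congr (limn _); apply/funext => n; apply: eq_bigr => i _; rewrite /= mulrDl.
Qed.

Lemma psumZ r k a x : cvg_on r a -> `|x| < r ->
  psum (fun n => k * a n) x = k * psum a x.
Proof.
move=> ca xr; rewrite /psum -[RHS](@lim_seriesZ _ _ k (ca x xr)).
by congr (limn _); apply/funext => n; apply: eq_bigr => i _; rewrite /= -mulrA.
Qed.

(** For |x| < y < r the terms a_n y^n are bounded, so the differentiated series is dominated by a
    multiple of (n + 1) (|x| / y)^n, which passes the ratio test. *)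
Lemma cvg_on_diffs r a : cvg_on r a -> cvg_on r (pseries_diffs a).
Proof.
move=> ca x xr; have r0 : 0 < r by apply: le_lt_trans xr.
pose y := (`|x| + r) / 2.
have xy : `|x| < y by rewrite /y; lra.
have yr : `|y| < r by rewrite ger0_norm /y; [lra|have := normr_ge0 x; lra].
have y0 : 0 < y by apply: le_lt_trans xy.
have [M [Mr aM]] := cvg_series_bounded (ca y yr).
have {}aM n : `|a n| <= `|M + 1| / y ^+ n.
  rewrite ler_pdivlMr ?exprn_gt0// -[X in _ * X]ger0_norm ?exprn_ge0// ?(ltW y0)//.
  rewrite -normrM; apply: aM => //.
  by rewrite (lt_le_trans _ (ler_norm _))// ltrDl.
apply: normed_cvg.
apply: (@series_le_cvg _ _ (fun n => n.+1%:R * (`|M + 1| / y * (`|x| / y) ^+ n))) => //.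
- by move=> n /=.
- by move=> n; rewrite mulr_ge0// mulr_ge0 ?exprn_ge0// divr_ge0// ltW.
- move=> n /=; rewrite /pseries_diffs normrM normrM normr_nat -mulrA ler_wpM2l//.
  rewrite normrX expr_div_n mulrCA.
  rewrite [leRHS](_ : _ = `|x| ^+ n * (`|M + 1| / y ^+ n.+1)); last first.
    by rewrite exprS; field; rewrite expf_neq0 gt_eqF.
  by rewrite mulrC ler_wpM2l// exprn_ge0.
pose q := `|x| / y; have q0 : 0 <= q by rewrite divr_ge0// ltW.
have q1 : q < 1 by rewrite ltr_pdivrMr// mul1r.
(* As soon as n + 1 >= 1 / e, the ratio (n + 2) q / (n + 1) is at most q + e, the midpoint of q and
   1. *)
pose e := (1 - q) / 2; have e0 : 0 < e by rewrite /e; lra.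
pose n0 := (Num.truncn e^-1).+1.
have n0e : e^-1 < n0%:R by exact: truncnS_gt.
apply: (@is_cvg_series_ratio _ (q + e) n0) => [|n n0n]; first by rewrite /e; lra.
set K := `|M + 1| / y; have K0 : 0 <= K by rewrite divr_ge0// ltW.
rewrite -/q !ger0_norm ?mulr_ge0 ?exprn_ge0 ?invr_ge0 ?(ltW y0)//.
rewrite exprS [leLHS](_ : _ = n.+2%:R * q * (K * q ^+ n)); last by ring.
rewrite [leRHS]mulrA; apply: ler_wpM2r; first by rewrite mulr_ge0// exprn_ge0.
have : 1 <= e * n.+1%:R.
  rewrite mulrC -ler_pdivrMr// mul1r (le_trans (ltW n0e))// ler_nat.
  exact: leqW.
by rewrite -(natr1 n.+1); nra.
Qed.

Lemma is_derive_psum r a (x : R) : cvg_on r a -> `|x| < r ->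
  is_derive x 1 (psum a) (psum (pseries_diffs a) x).
Proof.
move=> ca xr; have r0 : 0 < r by apply: le_lt_trans xr.
have yr : `|(`|x| + r) / 2| < r by rewrite ger0_norm; [lra|have := normr_ge0 x; lra].
apply: (@pseries_snd_diffs _ a ((`|x| + r) / 2)).
- exact: ca.
- exact: (cvg_on_diffs _ _ ca).
- exact: (cvg_on_diffs _ _ (cvg_on_diffs _ _ ca)).
- by rewrite [ltRHS]ger0_norm; [lra|have := normr_ge0 x; lra].
Qed.

(** Multiplying the coefficients by n is the Euler operator x d/dx; through it, recurrences between
    coefficients become differential equations. *)
Lemma psum_shift r a x : cvg_on r a -> `|x| < r ->
  cvgn (pseries (fun n => n%:R * a n) x) /\
  psum (fun n => n%:R * a n) x = x * psum (pseries_diffs a) x.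
Proof.
move=> ca xr; have cd := cvg_on_diffs _ _ ca x xr.
suff H : pseries (fun n => n%:R * a n) x @ \oo --> x * psum (pseries_diffs a) x.
  by split; [apply/cvg_ex; eexists; exact: H|exact: (cvg_lim _ H)].
rewrite -cvg_shiftS /=.
rewrite [X in X @ _ --> _](_ : _ = fun n => x * pseries (pseries_diffs a) x n).
  exact: cvgMr.
apply/funext => n; rewrite /pseries/= /series/= big_nat_recl//= mul0r mul0r add0r.
by rewrite mulr_sumr; apply: eq_bigr => i _; rewrite /pseries_diffs exprS; ring.
Qed.

Lemma cvg_on_shift r a : cvg_on r a -> cvg_on r (fun n => n%:R * a n).
Proof. by move=> ca x xr; have [] := psum_shift _ _ _ ca xr. Qed.

Lemma psum0 a : psum a 0 = a 0%N.
Proof.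
apply: (@cvg_lim R^o); first exact: Rhausdorff.
rewrite -cvg_shiftS; apply: cvg_near_cst; apply: nearW => n /=.
rewrite /pseries /series/= big_nat_recl//= expr0 mulr1 big1 ?addr0// => i _.
by rewrite exprS mul0r mulr0.
Qed.

End power_series.

(** * The hypergeometric series: equation, binomial case, uniqueness, quadratic transformation *)

Section hypergeometric.
Context {R : realType}.
Implicit Types a b c t : R.

Lemma pochhammer0 a : pochhammer a 0 = 1.
Proof. by rewrite /pochhammer big_ord0. Qed.

Lemma pochhammerS a k : pochhammer a k.+1 = pochhammer a k * (a + k%:R).
Proof. by rewrite /pochhammer big_ord_recr. Qed.

Lemma pochhammer_gt0 a k : 0 < a -> 0 < pochhammer a k.
Proof. by move=> a0; apply: prodr_gt0 => i _; rewrite ltr_pwDl. Qed.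

Lemma pochhammer1 k : pochhammer 1 k = k`!%:R :> R.
Proof.
elim: k => [|k IH]; first by rewrite pochhammer0.
by rewrite pochhammerS IH factS natrM mulrC nat1r.
Qed.

(** The duplication formula. It later turns the even-indexed binomial coefficients into a
    hypergeometric sequence with halved parameters. *)
Lemma pochhammerM2 a k :
  pochhammer a k.*2 = 4 ^+ k * pochhammer (a / 2) k * pochhammer ((a + 1) / 2) k.
Proof.
elim: k => [|k IH]; first by rewrite !pochhammer0 expr0 !mul1r.
by rewrite doubleS !pochhammerS IH exprS -natr1 -muln2 natrM; field.
Qed.

Lemma fact_double k : (k.*2)`!%:R = 4 ^+ k * k`!%:R * pochhammer (1 / 2) k :> R.
Proof.
rewrite -pochhammer1 pochhammerM2 (_ : (1 + 1) / 2 = 1 :> R) ?pochhammer1; last first.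
  by field.
by ring.
Qed.

Definition hyp_coef a b c (k : nat) : R :=
  pochhammer a k * pochhammer b k / pochhammer c k / k`!%:R.

Lemma hyp_coef0 a b c : hyp_coef a b c 0 = 1.
Proof. by rewrite /hyp_coef !pochhammer0 fact0 !divr1 mulr1. Qed.

Lemma hyp_coef_gt0 a b c k : 0 < a -> 0 < b -> 0 < c -> 0 < hyp_coef a b c k.
Proof.
move=> a0 b0 c0; rewrite /hyp_coef !divr_gt0 ?mulr_gt0 ?pochhammer_gt0//.
Qed.

Lemma hypergeom2F1E a b c t : hypergeom2F1 a b c t = psum (hyp_coef a b c) t.
Proof.
rewrite /hypergeom2F1 /psum /pseries; congr (limn (series _)); apply/funext => k.
by rewrite /hyp_coef mulrAC.
Qed.

Lemma hyp_coefS a b c k : 0 < c ->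
  (k%:R + 1) * (c + k%:R) * hyp_coef a b c k.+1 =
  (a + k%:R) * (b + k%:R) * hyp_coef a b c k.
Proof.
move=> c0; rewrite /hyp_coef !pochhammerS factS natrM -natr1; field.
have k0 : 0 <= k%:R :> R by [].
rewrite !gt_eqF ?pochhammer_gt0 ?ltr0n ?fact_gt0//; lra.
Qed.

Lemma cvg_on_hyp a b c : 0 < a -> 0 < b -> 0 < c -> cvg_on 1 (hyp_coef a b c).
Proof.
move=> a0 b0 c0 t t1.
(* A third of the gap keeps (1 + e)^2 |t| + e^2 below 1. The summand e^2 makes the ratio positive
   even at t = 0, as the ratio test demands. *)
pose e := (1 - `|t|) / 3; have e0 : 0 < e by rewrite /e; lra.
have t0 := normr_ge0 t.
pose n0 := (Num.truncn ((a + b) / e)).+1.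
have n0e : (a + b) / e < n0%:R by exact: truncnS_gt.
apply: (@is_cvg_series_ratio _ _ ((1 + e) ^+ 2 * `|t| + e * e) n0) => [|n n0n].
  by rewrite /e; nra.
have nn0 : 0 <= n%:R :> R by [].
have Dab : a + b <= e * n%:R.
  rewrite mulrC -ler_pdivrMr// (le_trans (ltW n0e))// ler_nat//.
rewrite /= exprS !(normrM (hyp_coef _ _ _ _)) (normrM t) !(gtr0_norm (hyp_coef_gt0 _ _ _ _ a0 b0 c0)).
have hn := hyp_coef_gt0 a b c n a0 b0 c0.
have -> : hyp_coef a b c n.+1 =
    (a + n%:R) * (b + n%:R) / ((n%:R + 1) * (c + n%:R)) * hyp_coef a b c n.
  rewrite mulrAC -hyp_coefS//; field; rewrite !gt_eqF//; lra.
set D := _ / _; suff Dle : D <= (1 + e) ^+ 2.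
  rewrite [leLHS](_ : _ = D * `|t| * (hyp_coef a b c n * `|t ^+ n|)); last by ring.
  apply: ler_wpM2r; first by apply: mulr_ge0 => //; exact: ltW.
  by apply: (@le_trans _ _ ((1 + e) ^+ 2 * `|t|)); [rewrite ler_wpM2r|rewrite lerDl; nra].
have cn : 0 < c + n%:R by lra.
rewrite ler_pdivrMr; last by nra.
have A1 : a + n%:R <= (1 + e) * (n%:R + 1) by nra.
have B1 : b + n%:R <= (1 + e) * (c + n%:R) by nra.
rewrite expr2 mulrACA ler_pM//; lra.
Qed.

(** This is the recurrence [hyp_coefS] multiplied by t^k and summed: with the Euler operator, its
    two sides become combinations of [f0], [f1] and [f2]. *)
Lemma hyp_ode a b c t : 0 < a -> 0 < b -> 0 < c -> `|t| < 1 ->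
  let f0 := psum (hyp_coef a b c) t in
  let f1 := psum (pseries_diffs (hyp_coef a b c)) t in
  let f2 := psum (pseries_diffs (pseries_diffs (hyp_coef a b c))) t in
  t * (1 - t) * f2 + (c - (a + b + 1) * t) * f1 - a * b * f0 = 0.
Proof.
move=> a0 b0 c0 t1 f0 f1 f2.
pose h := hyp_coef a b c.
have ch : cvg_on 1 h by exact: cvg_on_hyp.
have cd := cvg_on_diffs _ _ ch; have cdd := cvg_on_diffs _ _ cd.
have cs := cvg_on_shift _ _ ch; have css := cvg_on_shift _ _ cs.
have csd := cvg_on_shift _ _ cd; have cds := cvg_on_diffs _ _ cs.
have E1 : psum (fun n => n%:R * h n) t = t * f1.
  by have [] := psum_shift _ _ _ ch t1.
have E2 : psum (fun n => n%:R * pseries_diffs h n) t = t * f2.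
  by have [] := psum_shift _ _ _ cd t1.
have E3 : psum (fun n => n%:R * (n%:R * h n)) t = t * (f1 + t * f2).
  have [_ ->] := psum_shift _ _ _ cs t1; congr (_ * _).
  rewrite -E2 -(psumD _ _ _ _ cd csd t1); congr (psum _ _).
  by apply/funext => n; rewrite /pseries_diffs -natr1; ring.
have L : psum (fun n => n%:R * pseries_diffs h n + c * pseries_diffs h n) t =
         t * f2 + c * f1.
  by rewrite (psumD _ _ _ _ csd (cvg_onZ _ c _ cd) t1) E2 (psumZ _ _ _ _ cd t1).
have Rr : psum (fun n => (n%:R * (n%:R * h n) + (a + b) * (n%:R * h n)) + a * b * h n) t
   = t * (f1 + t * f2) + (a + b) * (t * f1) + a * b * f0.
  rewrite (psumD _ _ _ _ (cvg_onD _ _ _ css (cvg_onZ _ (a + b) _ cs)) (cvg_onZ _ (a * b) _ ch) t1).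
  rewrite (psumD _ _ _ _ css (cvg_onZ _ (a + b) _ cs) t1) E3.
  by rewrite (psumZ _ _ _ _ cs t1) E1 (psumZ _ _ _ _ ch t1).
have LR : t * f2 + c * f1 = t * (f1 + t * f2) + (a + b) * (t * f1) + a * b * f0.
  rewrite -L -Rr; congr (psum _ _); apply/funext => n.
  rewrite /pseries_diffs -natr1.
  have := hyp_coefS a b c n c0; rewrite -/h => E.
  transitivity ((n%:R + 1) * (c + n%:R) * h n.+1); first by ring.
  by rewrite E; ring.
move: LR => /eqP; rewrite -subr_eq0 => /eqP <-; ring.
Qed.

(** With the last two parameters equal to 1 the coefficients are (a)_k / k!. By the recurrence the
    product of the sum with (1 - t)^a has zero derivative, and it is 1 at 0. *)
Lemma binomial_series a t : 0 < a -> `|t| < 1 ->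
  psum (hyp_coef a 1 1) t = (1 - t) `^ (- a).
Proof.
move=> a0 t1; pose h := hyp_coef a 1 1; have lt01 : 0 < 1 :> R by [].
have ch : cvg_on 1 h by exact: cvg_on_hyp.
have cd := cvg_on_diffs _ _ ch; have cs := cvg_on_shift _ _ ch.
have E (y : R) : `|y| < 1 -> (1 - y) * psum (pseries_diffs h) y = a * psum h y.
  move=> y1; have [_ E1] := psum_shift _ _ _ ch y1.
  rewrite mulrBl mul1r -E1 -(psumZ _ _ _ _ ch y1).
  apply/eqP; rewrite subr_eq -(psumD _ _ _ _ (cvg_onZ _ a _ ch) cs y1); apply/eqP.
  congr (psum _ _); apply/funext => n; rewrite /pseries_diffs -natr1.
  have := hyp_coefS a 1 1 n lt01; rewrite -/h => E2.
  have n0 : 1 + n%:R != 0 :> R by rewrite addrC natr1.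
  by apply: (mulfI n0); transitivity ((n%:R + 1) * (1 + n%:R) * h n.+1); [ring|rewrite E2; ring].
pose f y := psum h y * (1 - y) `^ a.
have y1lt (y : R) : `|y| < 1 -> 0 < 1 - y by rewrite ltr_norml; lra.
have df (y : R) : `|y| < 1 -> is_derive y 1 f 0.
  move=> y1; have y0 := y1lt _ y1.
  have d1 := is_derive_psum _ _ _ ch y1.
  have d2 : is_derive y 1 (fun z => 1 - z) (0 - 1).
    by apply: is_deriveB1.
  have d3 := is_derive_comp1 (fun z => z `^ a) (fun z : R => 1 - z) _ _ _ (is_derive1_powR a y0) d2.
  apply: (is_derive_eq (is_deriveM1 _ _ _ _ _ d1 d3)).
  have -> : (1 - y) `^ a = (1 - y) * (1 - y) `^ (a - 1).
    by rewrite -[X in X * _]powRr1 ?(ltW y0)// -powRD ?subrKC// gt_eqF// implybT.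
  transitivity ((1 - y) * psum (pseries_diffs h) y * (1 - y) `^ (a - 1)
       - a * psum h y * (1 - y) `^ (a - 1)); first by ring.
  by rewrite E// subrr.
have f0t : f 0 = f t.
  have ft0 : forall u v : R, `|u| < 1 -> `|v| < 1 -> u < v -> f u = f v.
    move=> u v; rewrite !ltr_norml => /andP[u1 u2] /andP[v1 v2] uv.
    apply: is_derive0_eq => // x /andP[xu xv]; last by apply: df; rewrite ltr_norml; lra.
    by apply: is_derive_continuous; apply: df; rewrite ltr_norml; lra.
  have [t0|t0|->//] := ltrgt0P t; last by apply/esym/ft0 => //; rewrite normr0.
  by apply: ft0 => //; rewrite normr0.
move: f0t; rewrite /f psum0 /h hyp_coef0 subr0 powR1 mul1r => f1.
have nz : (1 - t) `^ a != 0 by rewrite gt_eqF// powR_gt0// y1lt.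
by apply: (mulIf nz); rewrite powRN mulVf// -f1.
Qed.

Lemma is_derive_shift_powR a (k x : R) : 0 < k + x ->
  is_derive x 1 (fun y => (k + y) `^ a) (a * (k + x) `^ (a - 1)).
Proof.
move=> kx.
have d2 : is_derive x 1 (fun z : R => k + z) (0 + 1) by apply: is_deriveD1.
have := is_derive_comp1 (fun z => z `^ a) (fun z : R => k + z) _ _ _ (is_derive1_powR a kx) d2.
by move=> d; apply: (is_derive_eq d); rewrite add0r mulr1.
Qed.

Lemma powRB1 a (x : R) : 0 < x -> x `^ (a - 1) = x `^ a / x.
Proof.
by move=> x0; rewrite powRB ?powRr1 ?(ltW x0)// (gt_eqF x0) implybT.
Qed.

(* The derivative of [t^c (1-t)^e (f' q - f q')] vanishes by the equation, so
   that Wronskian vanishes identically since it does so at [0]. *)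
Lemma hyp_ode_unique a b c (f q f1 q1 f2 q2 : R -> R) : 0 < c ->
  (forall t, 0 <= t < 1 -> is_derive t 1 f (f1 t)) ->
  (forall t, 0 <= t < 1 -> is_derive t 1 f1 (f2 t)) ->
  (forall t, 0 <= t < 1 -> is_derive t 1 q (q1 t)) ->
  (forall t, 0 <= t < 1 -> is_derive t 1 q1 (q2 t)) ->
  (forall t, 0 < t < 1 ->
    t * (1 - t) * f2 t + (c - (a + b + 1) * t) * f1 t - a * b * f t = 0) ->
  (forall t, 0 < t < 1 ->
    t * (1 - t) * q2 t + (c - (a + b + 1) * t) * q1 t - a * b * q t = 0) ->
  (forall t, 0 <= t < 1 -> q t != 0) ->
  f 0 = q 0 -> forall t, 0 <= t < 1 -> f t = q t.
Proof.
move=> c0 ff1 f1f2 qq1 q1q2 fode qode q0 fq0 t /andP[t0 t1].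
pose e := a + b + 1 - c.
pose D y := f1 y * q y - f y * q1 y.
pose W y := (y `^ c * (1 - y) `^ e) * D y.
have dD (y : R) : 0 <= y < 1 -> is_derive y 1 D (f2 y * q y - f y * q2 y).
  move=> y01; have h1 := is_deriveM1 _ _ _ _ _ (f1f2 y y01) (qq1 y y01).
  have h2 := is_deriveM1 _ _ _ _ _ (ff1 y y01) (q1q2 y y01).
  by apply: (is_derive_eq (is_deriveB1 _ _ _ _ _ h1 h2)); ring.
have dE (y : R) : y < 1 -> is_derive y 1 (fun y => (1 - y) `^ e) (- (e * (1 - y) `^ (e - 1))).
  move=> y1; have y1' : 0 < 1 - y by lra.
  have d2 : is_derive y 1 (fun z : R => 1 - z) (0 - 1) by apply: is_deriveB1.
  have d3 := is_derive_comp1 (fun z => z `^ e) (fun z : R => 1 - z) _ _ _ (is_derive1_powR e y1') d2.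
  by apply: (is_derive_eq d3); ring.
have dW (y : R) : 0 < y < 1 -> is_derive y 1 W 0.
  move=> /andP[y0 y1]; have y01 : 0 <= y < 1 by rewrite ltW.
  have := is_deriveM1 _ _ _ _ _ (is_deriveM1 _ _ _ _ _ (is_derive1_powR c y0) (dE y y1)) (dD y y01).
  move=> d; apply: (is_derive_eq d); rewrite !powRB1 ?subr_gt0// /D.
  have y1' : 1 - y != 0 by rewrite gt_eqF ?subr_gt0.
  have yy : 0 < y < 1 by rewrite y0.
  apply: (mulfI (lt0r_neq0 y0)); apply: (mulfI y1'); rewrite !mulr0.
  have /eqP := fode y yy; rewrite subr_eq0 => /eqP fo.
  have /eqP := qode y yy; rewrite subr_eq0 => /eqP qo.
  have Ef : y * (1 - y) * f2 y = a * b * f y - (c - (a + b + 1) * y) * f1 y by rewrite -fo; ring.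
  have Eq : y * (1 - y) * q2 y = a * b * q y - (c - (a + b + 1) * y) * q1 y by rewrite -qo; ring.
  transitivity (y `^ c * (1 - y) `^ e * ((c * (1 - y) - e * y) * (f1 y * q y - f y * q1 y)
     + (y * (1 - y) * f2 y * q y - f y * (y * (1 - y) * q2 y)))).
    by field; rewrite y1' lt0r_neq0.
  by rewrite Ef Eq /e; ring.
have W0 : forall y : R, 0 < y < 1 -> W y = 0.
  move=> y /andP[y0 y1].
  have Wc (x : R) : 0 < x < 1 -> W x = W y.
    move=> /andP[x0 x1].
    have H (u v : R) : 0 < u -> u < v -> v < 1 -> W u = W v.
      move=> u0 uv v1; apply: is_derive0_eq => // z /andP[zu zv]; last by apply: dW; lra.
      by apply: is_derive_continuous; apply: dW; lra.
    by have [xy|xy|->//] := ltgtP x y; [exact: H|apply/esym/H].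
  have c1 : (fun x : R => x `^ c) x @[x --> 0^'+] --> 0 by exact: powR_cvg0.
  have z01 : 0 <= (0 : R) < 1 by rewrite lexx /=.
  have cD : D x @[x --> 0^'+] --> D 0.
    by apply: cvg_at_right_filter; exact: is_derive_continuous (dD _ z01).
  have cE : (fun y => (1 - y) `^ e) x @[x --> 0^'+] --> (1 - 0) `^ e.
    by apply: cvg_at_right_filter; exact: is_derive_continuous (dE 0 ltr01).
  have cW0 : W x @[x --> 0^'+] --> 0 * (1 - 0) `^ e * D 0 by exact: cvgM (cvgM c1 cE) cD.
  rewrite !mul0r in cW0.
  have cWy : W x @[x --> 0^'+] --> W y.
    apply: cvg_near_cst; near=> x; apply: Wc; apply/andP; split.
      by near: x; exact: nbhs_right_gt.
    by near: x; exact: nbhs_right_lt.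
  exact: (cvg_unique (@Rhausdorff R) cWy cW0).
(* Zero Wronskian makes the quotient of the two solutions constant, and that constant is 1 by the
   common value at 0. *)
have dR (y : R) : 0 < y < 1 -> is_derive y 1 (fun y => f y / q y) 0.
  move=> /andP[y0 y1]; have y01 : 0 <= y < 1 by rewrite ltW.
  have qy := q0 _ y01.
  have dV : is_derive y 1 (fun y => (q y)^-1) (- (q y) ^- 2 * q1 y).
    by have [dq eq] := qq1 y y01; split; [exact: derivableV|rewrite deriveV// eq].
  apply: (is_derive_eq (is_deriveM1 _ _ _ _ _ (ff1 y y01) dV)).
  have yy : 0 < y < 1 by rewrite y0.
  have y1' : 0 < 1 - y by rewrite subr_gt0.
  have nz : y `^ c * (1 - y) `^ e != 0 by rewrite gt_eqF// mulr_gt0// powR_gt0.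
  have E : D y = 0 by apply: (mulfI nz); rewrite mulr0; exact: W0.
  transitivity ((f1 y * q y - f y * q1 y) / (q y) ^+ 2).
    by field.
  by rewrite -/(D y) E mul0r.
have [t00|] := eqVneq t 0; first by rewrite t00.
move=> tn0; have tp : 0 < t by rewrite lt_neqAle eq_sym tn0.
have := @is_derive0_eq R (fun y => f y / q y) 0 t tp.
have z01 : 0 <= (0 : R) < 1 by rewrite lexx /=.
rewrite fq0 divff ?q0// => H; have {}H : 1 = f t / q t.
  apply: H => x /andP[x0 x1]; last by apply: dR; lra.
  have x01 : 0 <= x < 1 by lra.
  have cf := is_derive_continuous _ _ _ (ff1 x x01).
  have cq := is_derive_continuous _ _ _ (qq1 x x01).
  by apply: cvgM => //; apply: cvgV => //; exact: q0.
by rewrite -[RHS]mul1r H divfK// q0// t0.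
Unshelve. all: by end_near. Qed.

(** Both sides solve the equation with parameters a, a + 1 - c, c and equal 1 at 0, so
    [hyp_ode_unique] applies. The right-hand side does not vanish because its coefficients are
    positive. *)
Lemma hyp_quadratic a c t : 0 < a -> 0 < c -> 0 < a + 1 - c -> 0 <= t < 1 ->
  psum (hyp_coef a (a + 1 - c) c) t =
  (1 + t) `^ (- a) * psum (hyp_coef (a / 2) ((a + 1) / 2) c) (4 * t / (1 + t) ^+ 2).
Proof.
move=> a0 c0 b0 t01.
pose h := hyp_coef a (a + 1 - c) c.
pose g := hyp_coef (a / 2) ((a + 1) / 2) c.
have ch : cvg_on 1 h by exact: cvg_on_hyp.
have cg : cvg_on 1 g by apply: cvg_on_hyp => //; lra.
have t1 (y : R) : 0 <= y < 1 -> `|y| < 1 by move=> y01; rewrite ger0_norm; lra.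
pose z (y : R) := 4 * y / (1 + y) ^+ 2.
pose z1 (y : R) := 4 * (1 - y) / (1 + y) ^+ 3.
pose z2 (y : R) := 4 * (2 * y - 4) / (1 + y) ^+ 4.
pose E (y : R) := (1 + y) `^ (- a).
have iV (y : R) (n : nat) : 0 <= y < 1 ->
    is_derive y 1 (fun y : R => ((1 + y) ^+ n)^-1) (- n%:R / (1 + y) ^+ n.+1).
  move=> y01; have y1 : 0 < 1 + y by lra.
  have d : is_derive y 1 (fun y : R => (1 + y) ^+ n) (n%:R * (1 + y) ^+ n.-1 * (0 + 1)).
    have d1 : is_derive y 1 (fun y : R => 1 + y) (0 + 1) by apply: is_deriveD1.
    exact: is_deriveX1 d1.
  have dn : (1 + y) ^+ n != 0 by rewrite expf_neq0// gt_eqF.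
  have dV : is_derive y 1 (fun y => ((1 + y) ^+ n)^-1)
     (- ((1 + y) ^+ n) ^- 2 * (n%:R * (1 + y) ^+ n.-1 * (0 + 1))).
    by have [dq eq] := d; split; [exact: derivableV|rewrite deriveV// eq].
  apply: (is_derive_eq dV); case: n {d dV} dn => [|n] dn; first by rewrite !mul0r mulr0 oppr0 mul0r.
  rewrite /= !exprS; field.
  by move: dn; rewrite exprS mulf_eq0 negb_or => /andP[-> ->].
have dz (y : R) : 0 <= y < 1 -> is_derive y 1 z (z1 y).
  move=> y01; have y1 : 0 < 1 + y by lra.
  have d1 : is_derive y 1 (fun y : R => 4 * y) (4 * 1) by apply: is_deriveZ1.
  apply: (is_derive_eq (is_deriveM1 _ _ _ _ _ d1 (iV y 2%N y01))).
  by rewrite /z1; field; rewrite gt_eqF.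
have dz1 (y : R) : 0 <= y < 1 -> is_derive y 1 z1 (z2 y).
  move=> y01; have y1 : 0 < 1 + y by lra.
  have d0 : is_derive y 1 (fun y : R => 1 - y) (0 - 1) by apply: is_deriveB1.
  have d1 : is_derive y 1 (fun y : R => 4 * (1 - y)) (4 * (0 - 1)) by apply: is_deriveZ1.
  apply: (is_derive_eq (is_deriveM1 _ _ _ _ _ d1 (iV y 3%N y01))).
  by rewrite /z2; field; rewrite gt_eqF.
have dE (y : R) : 0 <= y < 1 -> is_derive y 1 E (- a * E y / (1 + y)).
  move=> y01; have y1 : 0 < 1 + y by lra.
  apply: (is_derive_eq (is_derive_shift_powR (- a) _ _ y1)).
  by rewrite powRB1// mulrA.
have zlt (y : R) : 0 <= y < 1 -> `|z y| < 1.
  move=> y01; have y1 : 0 < (1 + y) ^+ 2 by rewrite exprn_gt0; lra.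
  rewrite ger0_norm /z ?divr_ge0//; [|lra|exact: ltW].
  by rewrite ltr_pdivrMr//; nra.
pose P y := psum g (z y).
pose P1 y := psum (pseries_diffs g) (z y).
pose P2 y := psum (pseries_diffs (pseries_diffs g)) (z y).
have dP (y : R) : 0 <= y < 1 -> is_derive y 1 P (P1 y * z1 y).
  move=> y01; exact: is_derive_comp1 (is_derive_psum _ _ _ cg (zlt _ y01)) (dz _ y01).
have dP1 (y : R) : 0 <= y < 1 -> is_derive y 1 P1 (P2 y * z1 y).
  move=> y01; apply: is_derive_comp1 (dz _ y01).
  exact: is_derive_psum (cvg_on_diffs _ _ cg) (zlt _ y01).
pose q y := E y * P y.
pose q1 y := E y * (- a * P y * ((1 + y) ^+ 1)^-1 + P1 y * z1 y).
pose q2 y := E y * (a * (a + 1) / (1 + y) ^+ 2 * P y - 2 * a / (1 + y) * z1 y * P1 y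
               + z1 y ^+ 2 * P2 y + z2 y * P1 y).
have dq (y : R) : 0 <= y < 1 -> is_derive y 1 q (q1 y).
  move=> y01; have y1 : 0 < 1 + y by lra.
  apply: (is_derive_eq (is_deriveM1 _ _ _ _ _ (dE y y01) (dP y y01))).
  by rewrite /q1; field; rewrite gt_eqF.
have dq1 (y : R) : 0 <= y < 1 -> is_derive y 1 q1 (q2 y).
  move=> y01; have y1 : 0 < 1 + y by lra.
  have i1 := is_deriveM1 _ _ _ _ _ (is_deriveZ1 (- a) _ _ _ (dP y y01)) (iV y 1%N y01).
  have i2 := is_deriveM1 _ _ _ _ _ (dP1 y y01) (dz1 y y01).
  apply: (is_derive_eq (is_deriveM1 _ _ _ _ _ (dE y y01) (is_deriveD1 _ _ _ _ _ i1 i2))).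
  by rewrite /q2; field; rewrite gt_eqF.
have := @hyp_ode_unique a (a + 1 - c) c (psum h) q (psum (pseries_diffs h)) q1
  (psum (pseries_diffs (pseries_diffs h))) q2 c0.
have z01 : 0 <= (0 : R) < 1 by rewrite lexx /=.
apply => //.
- by move=> y /t1; exact: is_derive_psum.
- by move=> y /t1; apply: is_derive_psum; exact: cvg_on_diffs.
- by move=> y /andP[y0 y1]; apply: hyp_ode => //; apply: t1; rewrite ltW.
- move=> y /andP[y0 y1]; have y01 : 0 <= y < 1 by rewrite ltW.
  have yp : 1 + y != 0 by rewrite gt_eqF//; lra.
  have a20 : 0 < a / 2 by lra.
  have a120 : 0 < (a + 1) / 2 by lra.
  have ode := hyp_ode (a / 2) ((a + 1) / 2) c (z y) a20 a120 c0 (zlt _ y01).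
  rewrite /= -/g -/(P y) -/(P1 y) -/(P2 y) in ode.
  (* The equation for [q] at y is the equation of the inner series at [z y], multiplied by this
     factor. *)
  transitivity (E y * (4 * (1 - y) / (1 + y) ^+ 2) * 0); last by rewrite mulr0.
  by rewrite -ode /q2 /q1 /q /z /z1 /z2; field.
- move=> y y01; have y1 : 0 < 1 + y by lra.
  have zy := zlt _ y01.
  have z0 : 0 <= z y by rewrite /z divr_ge0 ?exprn_ge0//; lra.
  rewrite gt_eqF// mulr_gt0 ?powR_gt0//.
  have g0 k : 0 < g k by apply: hyp_coef_gt0 => //; lra.
  apply: (lt_le_trans (g0 0%N)).
  have := nondecreasing_cvgn_le (_ : nondecreasing_seq (pseries g (z y))) (cg _ zy) 1%N.
  rewrite [X in X <= _](_ : _ = g 0%N).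
    apply; apply/nondecreasing_seqP => n; rewrite /pseries /series/= big_nat_recr//= lerDl.
    by rewrite mulr_ge0 ?exprn_ge0// ltW.
  by rewrite /pseries /series/= big_nat1 expr0 mulr1.
- by rewrite /q /P /E /z mulr0 mul0r !psum0 /h /g !hyp_coef0 addr0 powR1 mul1r.
Qed.

End hypergeometric.

Lemma measurable_funEFin d (T : measurableType d) (R : realType) (D : set T)
    (f : T -> R) : measurable_fun D f -> measurable_fun D (fun x => (f x)%:E).
Proof. by move=> mf; exact/measurable_EFinP. Qed.

(** * Images of measures with a density *)

Section image_density.
Import HBNNSimple.
Local Open Scope ereal_scope.
Context d1 d2 (X : measurableType d1) (Y : measurableType d2) (R : realType).
Variables (mu : {measure set X -> \bar R}) (phi : X -> Y) (w : X -> R).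
Hypotheses (mphi : measurable_fun setT phi) (mw : measurable_fun setT w).
Hypothesis w0 : forall x, (0 <= w x)%R.

Let m (A : set Y) := \int[mu]_(x in phi @^-1` A) (w x)%:E.

Let mpre A : measurable A -> measurable (phi @^-1` A).
Proof. by move=> mA; rewrite -[X in measurable X]setTI; exact: mphi. Qed.

Let m0 : m set0 = 0.
Proof. by rewrite /m preimage_set0 integral_set0. Qed.

Let m_ge0 A : 0 <= m A.
Proof. by apply: integral_ge0 => x _; rewrite lee_fin. Qed.

Let mwD (D : set X) : measurable_fun D (fun x => (w x)%:E).
Proof. by apply: measurable_funEFin; exact: measurable_funTS. Qed.

Let m_sigma : semi_sigma_additive m.
Proof.
move=> F mF tF mUF; rewrite /m preimage_bigcup.
rewrite ge0_integral_bigcup//=; last 2 first.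
- by move=> x _; rewrite lee_fin.
- apply/trivIsetP => /= i j _ _ ij; rewrite -preimage_setI.
  by move/trivIsetP : tF => /(_ _ _ _ _ ij) ->//; rewrite preimage_set0.
- by apply: is_cvg_ereal_nneg_natsum_cond => n _ _; exact: m_ge0.
- by move=> k; exact: mpre.
Qed.

(** The image under [phi] of the measure with density [w]. With it, a change of variables is checked
    on measurable sets only; simple functions and monotone convergence extend it to nonnegative
    functions. *)
Lemma image_densityP : exists nu : {measure set Y -> \bar R},
  (forall A, nu A = \int[mu]_(x in phi @^-1` A) (w x)%:E) /\
  (forall f : Y -> \bar R, measurable_fun setT f -> (forall y, 0 <= f y) ->
     \int[nu]_y f y = \int[mu]_x (f (phi x) * (w x)%:E)).
Proof.
pose mixin := isMeasure.Build _ _ _ m m0 m_ge0 m_sigma.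
pose nu : {measure set Y -> \bar R} := HB.pack m mixin.
exists nu; split=> // f mf f0.
pose f_ := nnsfun_approx measurableT mf.
have fcvg y : (EFin \o (f_ ^~ y)) x @[x --> \oo] --> f y.
  by apply: (cvg_nnsfun_approx measurableT mf).
transitivity (limn (fun n => \int[nu]_y (f_ n y)%:E)).
  rewrite -monotone_convergence//.
  - by apply: eq_integral => y _; apply/esym/cvg_lim => //; exact: fcvg.
  - by move=> n; exact/measurable_EFinP/measurable_funP.
  - by move=> n y _; rewrite lee_fin.
  - by move=> y _ i j ij; rewrite lee_fin; exact/lefP/nd_nnsfun_approx.
have mfphi n : measurable_fun setT (f_ n \o phi).
  exact: measurableT_comp.
transitivity (limn (fun n => \int[mu]_x ((f_ n (phi x))%:E * (w x)%:E))); last first.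
  rewrite -monotone_convergence//.
  - apply: eq_integral => x _; apply/cvg_lim => //.
    by apply: cvgeMr => //; exact: fcvg.
  - by move=> n; apply: emeasurable_funM; apply: measurable_funEFin => //; exact: mfphi.
  - by move=> n x _; rewrite lee_fin mulr_ge0.
  - move=> x _ i j ij; rewrite lee_fin ler_wpM2r//; exact/lefP/nd_nnsfun_approx.
congr (limn _); apply/funext => n.
have mk k : measurable (f_ n @^-1` [set k]) by [].
transitivity (\sum_(k \in range (f_ n)) k%:E * nu (f_ n @^-1` [set k])).
  by rewrite integralT_nnsfun sintegralE.
transitivity (\int[mu]_x (\sum_(k \in range (f_ n)) (k * \1_(f_ n @^-1` [set k]) (phi x) * w x)%:E)).
  rewrite ge0_integral_fsum//; last 2 first.
  - move=> k; apply: measurable_funEFin; apply: measurable_funM => //.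
    by apply: measurable_funM => //; exact: measurableT_comp.
  - move=> k x _; rewrite lee_fin mulr_ge0//.
    by have := nnfun_muleindic_ge0 (f_ n) k (phi x); rewrite -EFinM lee_fin.
  apply: eq_fsbigr => k /[!inE] -[y _ <-]; set k' := f_ n y.
  rewrite /nu/= /m integral_mkcond -ge0_integralZl//; last 3 first.
  - apply/(measurable_restrictT _ _).1 => //; exact: mpre.
  - by move=> x _; rewrite patchE; case: ifP => // _; rewrite lee_fin.
  - by rewrite lee_fin.
  apply: eq_integral => x _; rewrite patchE indicE.
  have -> : (x \in phi @^-1` (f_ n @^-1` [set k'])) = (phi x \in f_ n @^-1` [set k']).
    by apply/idP/idP; rewrite !inE.
  by case: (_ \in _); rewrite ?mulr1 ?mulr0 ?mul0r ?mule0// EFinM.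
apply: eq_integral => x _; rewrite fsumEFin// -EFinM; congr EFin.
by rewrite [in RHS]fimfunE mulr_fsuml//.
Qed.

End image_density.

(** * Measures on the half-line determined by the intervals ]0, b] *)

Section measures_on_the_half_line.
Local Open Scope ereal_scope.
Context {R : realType}.
Implicit Types m : {measure set (measurableTypeR R) -> \bar R}.

(** The intervals ]a, b] generate the Borel sets. Each reduces to intervals ]0, b]: by subtraction
    if a > 0, which uses finiteness, and through the null half-line if a <= 0. *)
Lemma measure_unique_pos m1 m2 :
  m1 `]-oo, 0%R]%classic = 0 -> m2 `]-oo, 0%R]%classic = 0 ->
  (forall b : R, (0 < b)%R -> m1 `]0%R, b]%classic < +oo) ->
  (forall b : R, (0 < b)%R -> m1 `]0%R, b]%classic = m2 `]0%R, b]%classic) ->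
  forall A, measurable A -> m1 A = m2 A.
Proof.
move=> m10 m20 m1oo m12.
have neg m (A : set (measurableTypeR R)) : m `]-oo, 0%R]%classic = 0 -> measurable A ->
    A `<=` `]-oo, 0%R]%classic -> m A = 0.
  move=> m0 mA A0; apply/eqP; rewrite -measure_le0 -m0.
  by apply: le_measure; rewrite ?inE//; exact: measurable_itv.
have m12' (b : R) : (0 <= b)%R -> m1 `]0%R, b]%classic = m2 `]0%R, b]%classic.
  by rewrite le_eqVlt => /predU1P[<-|/m12//]; rewrite set_itv_ge ?measure0// -leNgt bnd_simp.
have m1oo' (b : R) : (0 <= b)%R -> m1 `]0%R, b]%classic < +oo.
  by rewrite le_eqVlt => /predU1P[<-|/m1oo//]; rewrite set_itv_ge ?measure0// -leNgt bnd_simp.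
have pos m (a b : R) : (0 <= a <= b)%R -> m `]0%R, b]%classic = m `]0%R, a]%classic + m `]a, b]%classic.
  move=> /andP[a0 ab]; rewrite -measureU.
  - by congr (m _); rewrite -itv_bndbnd_setU// bnd_simp.
  - exact: measurable_itv.
  - exact: measurable_itv.
  - rewrite -subset0 => x [] /=; rewrite !in_itv/= => /andP[_ xa] /andP[ax _].
    by move: (lt_le_trans ax xa); rewrite ltxx.
have straddle m (a b : R) : m `]-oo, 0%R]%classic = 0 -> (a <= 0 <= b)%R -> m `]a, b]%classic = m `]0%R, b]%classic.
  move=> m0 /andP[a0 b0].
  have -> : m `]a, b]%classic = m (`]a, 0%R]%classic `|` `]0%R, b]%classic).
    by congr (m _); rewrite -itv_bndbnd_setU// bnd_simp.
  transitivity (m `]a, 0%R]%classic + m `]0%R, b]%classic).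
    apply: measureU => //; rewrite -subset0 => x [] /=.
    rewrite !in_itv/= => /andP[_ x0] /andP[x1 _].
    by move: (lt_le_trans x1 x0); rewrite ltxx.
  have -> : m `]a, 0%R]%classic = 0; last by rewrite add0e.
  by apply: neg => // x /=; rewrite !in_itv/= => /andP[].
have E (a b : R) : m1 `]a, b]%classic = m2 `]a, b]%classic.
  have [ba|ab] := leP b a.
    by rewrite set_itv_ge ?measure0// -leNgt bnd_simp.
  have [a0|a0] := leP a 0%R; last first.
    have ab' : (0 <= a <= b)%R by rewrite !ltW.
    have := m12' b (le_trans (ltW a0) (ltW ab)); rewrite !(pos _ _ _ ab').
    have fa : m1 `]0%R, a]%classic \is a fin_num by rewrite ge0_fin_numE// m1oo'// ltW.
    rewrite -(m12' a (ltW a0)) => /(congr1 (fun z => z - m1 `]0%R, a]%classic)).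
    by rewrite addeAC subee// add0e addeAC subee// add0e.
  have [b0|b0] := leP b 0%R; last first.
    by rewrite !straddle ?a0 ?ltW// m12'// ltW.
  have sub : (`]a, b] `<=` `]-oo, 0%R])%classic.
    by move=> x /=; rewrite !in_itv/= => /andP[_ xb]; exact: le_trans b0.
  by rewrite (neg m1 _ m10 _ sub)// (neg m2 _ m20 _ sub).
pose g (n : nat) : set (measurableTypeR R) := `](- n%:R)%R, n%:R]%classic.
have cover : \bigcup_k g k = [set: R].
  rewrite -subTset => x _; exists (Num.truncn `|x|%R).+1 => //.
  rewrite /g/= in_itv/=; have := truncnS_gt `|x|%R => h.
  have := ler_norm x; have := ler_norm (- x)%R; rewrite normrN => h1 h2.
  by apply/andP; split; [rewrite ltrNl (le_lt_trans h1)|rewrite ltW// (le_lt_trans h2)].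
move=> A mA.
apply: (@g_sigma_algebra_measure_unique _ R (measurableTypeR R) (@ocitv R) _ g) => //.
- by move=> _ [[a b]] _ <-; exact: measurable_itv.
- by move=> n; exists ((- n%:R)%R, n%:R).
- by move=> B C; exact: measurableI.
- by move=> _ [[a b]] _ <-; exact: E.
- move=> n; rewrite straddle//; first exact: m1oo'.
  by rewrite oppr_le0 !ler0n.
Qed.

(** The common source of the substitutions on the line and of the passage from space to the radius:
    for two possibly different spaces, agreement on the intervals ]0, b] gives agreement for every
    nonnegative [h]. *)
Lemma ge0_integral_unique_pos d1 d2 (X1 : measurableType d1) (X2 : measurableType d2)
    (mu1 : {measure set X1 -> \bar R}) (mu2 : {measure set X2 -> \bar R})
    (phi1 : X1 -> R) (phi2 : X2 -> R) (w1 : X1 -> R) (w2 : X2 -> R) :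
  measurable_fun setT phi1 -> measurable_fun setT phi2 ->
  measurable_fun setT w1 -> measurable_fun setT w2 ->
  (forall x, 0 <= w1 x)%R -> (forall x, 0 <= w2 x)%R ->
  \int[mu1]_(x in phi1 @^-1` `]-oo, 0%R]) (w1 x)%:E = 0 ->
  \int[mu2]_(x in phi2 @^-1` `]-oo, 0%R]) (w2 x)%:E = 0 ->
  (forall b : R, (0 < b)%R -> \int[mu1]_(x in phi1 @^-1` `]0%R, b]) (w1 x)%:E < +oo) ->
  (forall b : R, (0 < b)%R -> \int[mu1]_(x in phi1 @^-1` `]0%R, b]) (w1 x)%:E =
    \int[mu2]_(x in phi2 @^-1` `]0%R, b]) (w2 x)%:E) ->
  forall h : R -> \bar R, measurable_fun setT h -> (forall r, 0 <= h r) ->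
  \int[mu1]_x (h (phi1 x) * (w1 x)%:E) = \int[mu2]_x (h (phi2 x) * (w2 x)%:E).
Proof.
move=> mp1 mp2 mw1 mw2 w10 w20 n1 n2 oo E h mh h0.
have [m1 [m1E m1I]] := @image_densityP _ _ _ (measurableTypeR R) R mu1 phi1 w1 mp1 mw1 w10.
have [m2 [m2E m2I]] := @image_densityP _ _ _ (measurableTypeR R) R mu2 phi2 w2 mp2 mw2 w20.
rewrite -m1I// -m2I//; apply: eq_measure_integral => A mA _.
apply: measure_unique_pos => //.
- by rewrite m1E.
- by rewrite m2E.
- by move=> b b0; rewrite m1E; exact: oo.
- by move=> b b0; rewrite m1E m2E; exact: E.
Qed.

End measures_on_the_half_line.

(** * Substitutions and power integrals on the line *)

Section integrals_on_the_line.
Local Open Scope ereal_scope.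
Context {R : realType}.
Local Notation leb := (@lebesgue_measure R).
Implicit Types (h : R -> \bar R).

(** The image of Lebesgue measure with density |c| under t -> c t + v gives ]a, b] its length, so it
    is Lebesgue measure. *)
Lemma ge0_integral_affine h (c v : R) : (c != 0)%R -> measurable_fun setT h ->
  (forall t, 0 <= h t) ->
  \int[leb]_t h (c * t + v)%R = (`|c|^-1)%:E * \int[leb]_t h t.
Proof.
move=> c0 mh h0.
have maff : measurable_fun setT (fun t : R => c * t + v)%R.
  by apply: measurable_funD => //; exact: measurable_funM.
have [nu [nuE nuI]] := @image_densityP _ _ (measurableTypeR R) (measurableTypeR R) R
  leb (fun t : R => c * t + v)%R (fun=> `|c|%R) maff (measurable_cst _) (fun=> normr_ge0 c).
have c1 : (`|c|^-1 * `|c| = 1)%R by rewrite mulVf// normr_eq0.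
have -> : \int[leb]_t h t = \int[nu]_t h t.
  apply: eq_measure_integral => A mA _; apply: lebesgue_measure_unique => // _ [[a b]] _ <-.
  rewrite nuE integral_cst; last first.
    by rewrite -[X in measurable X]setTI; exact: maff.
  have E : leb ((fun t : R => c * t + v)%R @^-1` `]a, b]) = `|c|^-1%:E * leb `]a, b].
    (* A negative slope reverses the interval, so the preimage is closed on the other side. *)
    have [cp|cn] : (0 < c)%R \/ (c < 0)%R by apply/orP; rewrite orbC -neq_lt.
      have -> : (fun t : R => c * t + v)%R @^-1` `]a, b] = `]((a - v) / c)%R, ((b - v) / c)%R]%classic.
        by apply/seteqP; split => t /=; rewrite !in_itv/= ltr_pdivrMr// ler_pdivlMr//
          ltrBlDr lerBrDr [(t * c)%R]mulrC.
      rewrite !lebesgue_measure_itv/= !lte_fin ltr_pM2r ?invr_gt0// ltrD2r.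
      case: ifPn => _; last by rewrite mule0.
      by rewrite -!EFinB -EFinM gtr0_norm//; congr EFin; ring.
    have -> : (fun t : R => c * t + v)%R @^-1` `]a, b] = `[((b - v) / c)%R, ((a - v) / c)%R[%classic.
      apply/seteqP; split => t /=; rewrite !in_itv/= ltr_ndivlMr// ler_ndivrMr//
          ltrBlDr lerBrDr [(t * c)%R]mulrC; by rewrite andbC.
    rewrite !lebesgue_measure_itv/= !lte_fin ltr_nM2r ?invr_lt0// ltrD2r.
    case: ifPn => _; last by rewrite mule0.
    by rewrite -!EFinB -EFinM ltr0_norm//; congr EFin; field.
  by rewrite /= E muleA -EFinM mulfV ?normr_eq0// mul1e.
rewrite nuI// -ge0_integralZl//.
- by apply: eq_integral => t _; rewrite muleCA -EFinM c1 mule1.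
- by apply: emeasurable_funM => //; exact: measurableT_comp.
- by move=> t _; rewrite mule_ge0// lee_fin.
Qed.

(** No monotonicity or differentiability of [phi] is asked for: the identity on the intervals ]0, b]
    carries all the information. *)
Lemma ge0_integral_subst_pos (D E : set R) (phi w : R -> R) :
  measurable D -> measurable E -> measurable_fun setT phi -> measurable_fun setT w ->
  (forall x, D x -> 0 <= w x)%R ->
  (forall x, D x -> 0 < phi x)%R -> (forall x, E x -> 0 < x)%R ->
  (forall b : R, (0 < b)%R ->
    \int[leb]_(x in D `&` phi @^-1` `]0%R, b]) (w x)%:E = leb (E `&` `]0%R, b])) ->
  forall h, measurable_fun setT h -> (forall r, 0 <= h r) ->
  \int[leb]_(x in E) h x = \int[leb]_(x in D) (h (phi x) * (w x)%:E).
Proof.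
move=> mD mE mphi mw w0 phi0 E0 Eb h mh h0.
pose wD (x : R) : R := (\1_D x * w x)%R.
pose wE (x : R) : R := \1_E x.
have mwD : measurable_fun setT wD by exact: measurable_funM.
have mwE : measurable_fun setT wE by exact: measurable_indic.
have wD0 x : (0 <= wD x)%R.
  rewrite /wD indicE; case: (boolP (x \in D)); rewrite ?mul1r ?mul0r// inE; exact: w0.
have wE0 x : (0 <= wE x)%R by [].
have ID (A : set R) : measurable A -> \int[leb]_(x in A) (wD x)%:E = \int[leb]_(x in D `&` A) (w x)%:E.
  move=> mA; rewrite [LHS]integral_mkcond [RHS]integral_mkcond; apply: eq_integral => x _.
  rewrite !patchE in_setI /wD indicE; case: (x \in D); case: (x \in A) => //=.
    by rewrite mul1r.
  by rewrite mul0r.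
have IE (A : set R) : measurable A -> \int[leb]_(x in A) (wE x)%:E = leb (E `&` A).
  by move=> mA; rewrite -integral_indic// setIC.
have -> : \int[leb]_(x in E) h x = \int[leb]_x (h x * (wE x)%:E).
  rewrite integral_mkcond; apply: eq_integral => x _; rewrite patchE /wE indicE.
  by case: (x \in E); rewrite ?mule1 ?mule0.
have -> : \int[leb]_(x in D) (h (phi x) * (w x)%:E) = \int[leb]_x (h (phi x) * (wD x)%:E).
  rewrite integral_mkcond; apply: eq_integral => x _; rewrite patchE /wD indicE.
  by case: (x \in D); rewrite ?mul1r ?mul0r ?mule0.
have mpre (A : set R) : measurable A -> measurable (phi @^-1` A).
  by move=> mA; rewrite -[X in measurable X]setTI; exact: mphi.
apply: (@ge0_integral_unique_pos R _ _ (measurableTypeR R) (measurableTypeR R) leb leb id phi) => //.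
- rewrite IE; last exact: measurable_itv.
  rewrite (_ : _ `&` _ = set0) ?measure0// -subset0 => x [/E0 x0 /=].
  by rewrite in_itv/= leNgt x0.
- rewrite ID; last by apply: mpre; exact: measurable_itv.
  rewrite (_ : _ `&` _ = set0) ?integral_set0// -subset0 => x [/phi0 x0 /=].
  by rewrite in_itv/= leNgt x0.
- move=> b b0; rewrite IE; last exact: measurable_itv.
  apply: (@le_lt_trans _ _ (leb `]0%R, b])); first apply: le_measure; rewrite ?inE//.
    by apply: measurableI => //; exact: measurable_itv.
  by rewrite lebesgue_measure_itv/= lte_fin b0 -EFinB ltry.
- move=> b b0; rewrite IE; last exact: measurable_itv.
  by rewrite ID ?Eb//; apply: mpre; exact: measurable_itv.
Qed.

Lemma integral_exprn (m : nat) (b : R) : (0 <= b)%R ->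
  \int[leb]_(r in `]0%R, b]) (m.+1%:R * r ^+ m)%:E = (b ^+ m.+1)%:E.
Proof.
rewrite le_eqVlt => /predU1P[<-|b0].
  by rewrite set_itv_ge ?integral_set0 ?expr0n// -leNgt bnd_simp.
have cX k : continuous (fun r : R => r ^+ k)%R by move=> x; exact: exprn_continuous.
rewrite integral_itv_obnd_cbnd; last first.
  by apply: measurable_funEFin; apply: measurable_funM => //; exact: measurable_funX.
rewrite (@continuous_FTC2 _ _ (fun r => r ^+ m.+1)%R)//.
- by rewrite expr0n/= sube0.
- by apply: continuous_subspaceT => x; apply: cvgM; [exact: cvg_cst|exact: cX].
- split => [x _||].
  + exact: exprn_derivable.
  + by apply: cvg_at_right_filter; exact: cX.
  + by apply: cvg_at_left_filter; exact: cX.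
- by move=> x _; rewrite derive1E exp_derive// /GRing.scale/= mulr1.
Qed.

Lemma ge0_integral_sqr h : measurable_fun setT h -> (forall r, 0 <= h r) ->
  \int[leb]_(t in `]0%R, +oo[) h t =
  \int[leb]_(r in `]0%R, +oo[) (h (r ^+ 2)%R * (2 * r)%:E).
Proof.
apply: ge0_integral_subst_pos => //.
- by move=> x /=; rewrite in_itv/= andbT => x0; rewrite mulr_ge0// ltW.
- by move=> x /=; rewrite in_itv/= andbT => x0; rewrite exprn_gt0.
- by move=> x /=; rewrite in_itv/= andbT.
move=> b b0; rewrite (_ : `]0%R, +oo[ `&` `]0%R, b] = `]0%R, b]%classic); last first.
  apply/seteqP; split => x /=; rewrite !in_itv/= ?andbT; first by case.
  by move=> /andP[-> ->].
rewrite lebesgue_measure_itv/= lte_fin b0 sube0.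
rewrite (_ : _ `&` _ = `]0%R, Num.sqrt b]%classic); last first.
  apply/seteqP; split => x /=; rewrite !in_itv/= ?andbT.
    move=> [x0 /andP[_ xb]]; rewrite x0/= -[x]ger0_norm ?(ltW x0)// -sqrtr_sqr.
    by rewrite ler_sqrt// ltW.
  move=> /andP[x0 xb]; rewrite x0 exprn_gt0//=; split=> //.
  by rewrite -(sqr_sqrtr (ltW b0)) lerXn2r// nnegrE ?sqrtr_ge0// ltW.
rewrite -[in RHS](sqr_sqrtr (ltW b0)) -(integral_exprn 1)// ?sqrtr_ge0//.
Qed.

Lemma ge0_integral_inv h : measurable_fun setT h -> (forall r, 0 <= h r) ->
  \int[leb]_(t in `]1%R, +oo[) h t =
  \int[leb]_(r in `]0%R, 1%R[) (h (r^-1)%R * (r `^ (- 2))%:E).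
Proof.
(* The inverse is written as a power, so that measurability and the primitive are those of
   powers. *)
move=> mh h0; transitivity (\int[leb]_(r in `]0%R, 1%R[) (h (r `^ (- 1))%R * (r `^ (- 2))%:E)); last first.
  apply: eq_integral => r; rewrite inE/= in_itv/= => /andP[r0 _].
  by rewrite powR_inv1// ltW.
move: h mh h0; apply: ge0_integral_subst_pos => //.
- by move=> x _; exact: powR_ge0.
- by move=> x /=; rewrite in_itv/= => /andP[x0 _]; exact: powR_gt0.
- by move=> x /=; rewrite in_itv/= andbT; exact: lt_trans.
move=> b b0; have [b1|b1] := leP b 1%R.
  rewrite (_ : _ `&` _ = set0); last first.
    rewrite -subset0 => x [/=]; rewrite !in_itv/= => /andP[x0 x1] /andP[_].
    rewrite powR_inv1 ?(ltW x0)// => xb; have := le_trans xb b1.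
    by rewrite invf_le1// leNgt x1.
  rewrite (_ : _ `&` _ = set0) ?measure0 ?integral_set0//.
  rewrite -subset0 => x [/=]; rewrite !in_itv/= andbT => x1 /andP[_ xb].
  by have := le_lt_trans (le_trans xb b1) x1; rewrite ltxx.
rewrite (_ : `]1%R, +oo[ `&` _ = `]1%R, b]%classic); last first.
  apply/seteqP; split => x /=; rewrite !in_itv/= ?andbT; first by case=> -> /andP[].
  by move=> /andP[x1 ->]; rewrite x1 (lt_trans _ x1).
rewrite lebesgue_measure_itv/= lte_fin b1.
have bi0 : (0 < b^-1)%R by rewrite invr_gt0.
rewrite (_ : _ `&` _ = `[b^-1%R, 1%R[%classic); last first.
  apply/seteqP; split => x /=; rewrite !in_itv/=.
    move=> [/andP[x0 ->] /andP[_]]; rewrite powR_inv1 ?(ltW x0)// => xb.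
    by rewrite andbT -[x]invrK lef_pV2// posrE invr_gt0.
  move=> /andP[bx ->]; have x0 : (0 < x)%R by apply: lt_le_trans bx.
  rewrite x0/= powR_gt0//= powR_inv1 ?(ltW x0)//; split=> //.
  by rewrite -[b]invrK lef_pV2// posrE.
rewrite integral_itv_bndo_bndc; last first.
  by apply: measurable_funEFin; apply: measurable_funTS; exact: measurable_powR.
have dP (x : R) : (0 < x)%R -> is_derive x (1%R : R) (fun x => - x `^ (- 1))%R (x `^ (- 2))%R.
  move=> x0; have := is_deriveN (is_derive1_powR (- 1) x0).
  rewrite mulN1r opprK (_ : (-1 - 1) = - 2 :> R)%R//; lra.
have cP a (x : R) : (0 < x)%R -> {for x, continuous (fun x => x `^ a)%R}.
  by move=> x0; apply: is_derive_continuous (is_derive1_powR a x0).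
rewrite (@continuous_FTC2 _ _ (fun r => - r `^ (- 1))%R).
- by rewrite powR1 powR_inv1 ?(ltW bi0)// invrK -!EFinB; congr EFin; ring.
- by rewrite invf_lt1.
- apply: continuous_in_subspaceT => x; rewrite inE/= in_itv/= => /andP[bx _].
  by apply: cP; exact: lt_le_trans bx.
- split => [x||].
  + rewrite in_itv/= => /andP[bx _]; have x0 := lt_trans bi0 bx.
    by have [] := dP x x0.
  + by apply: cvg_at_right_filter; apply: is_derive_continuous (dP _ bi0).
  + by apply: cvg_at_left_filter; apply: is_derive_continuous (dP _ ltr01).
- move=> x; rewrite in_itv/= => /andP[bx _]; have x0 := lt_trans bi0 bx.
  by rewrite derive1E; have [_ ->] := dP x x0.
Qed.

Lemma powRN_cvgy (d : R) : (0 < d)%R -> (x `^ (- d))%R @[x --> +oo%R] --> (0%R : R).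
Proof.
move=> d0; apply/cvgrPdist_le => e e0.
pose M := (e `^ (- d^-1))%R; have M0 : (0 < M)%R by exact: powR_gt0.
near=> x; rewrite sub0r normrN ger0_norm ?powR_ge0// powRN.
have Mx : (M <= x)%R by near: x; apply: nbhs_pinfty_ge; exact: num_real.
rewrite -[leRHS]invrK lef_pV2 ?posrE ?invr_gt0 ?powR_gt0// ?(lt_le_trans M0)//.
have -> : (e^-1 = M `^ d)%R.
  by rewrite /M -powRrM mulNr mulVf ?gt_eqF// powR_inv1// ltW.
by apply: ge0_ler_powR => //; rewrite ?nnegrE ?ltW// (lt_le_trans M0).
Unshelve. all: by end_near. Qed.

Lemma integral_powRy (d : R) : (0 < d)%R ->
  \int[leb]_(x in `]1%R, +oo[) (x `^ (- d - 1))%:E = (d^-1)%:E.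
Proof.
move=> d0; rewrite integral_itv_obnd_cbnd; last first.
  by apply: measurable_funEFin; apply: measurable_funTS; exact: measurable_powR.
have dP (x : R) : (0 < x)%R ->
    is_derive x (1%R : R) (fun x => - d^-1 * x `^ (- d))%R (x `^ (- d - 1))%R.
  move=> x0; have := is_deriveZ1 (- d^-1)%R _ _ _ (is_derive1_powR (- d) x0).
  by move=> D; apply: (is_derive_eq D); rewrite mulrA mulNr mulrN opprK mulVf ?mul1r// gt_eqF.
rewrite (@ge0_continuous_FTC2y _ _ (fun x => - d^-1 * x `^ (- d))%R _ (- d^-1 * 0)%R).
- by rewrite powR1 -EFinB; congr EFin; ring.
- by move=> x _; exact: powR_ge0.
- apply: continuous_in_subspaceT => x; rewrite inE/= in_itv/= andbT => x1.
  by apply: is_derive_continuous (is_derive1_powR _ (lt_le_trans ltr01 x1)).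
- by apply: cvgMr; exact: powRN_cvgy.
- by move=> x x1; have [] := dP x (lt_trans ltr01 x1).
- by apply: cvg_at_right_filter; apply: is_derive_continuous (dP _ ltr01).
- move=> x; rewrite in_itv/= andbT => x1; rewrite derive1E.
  by have [_ ->] := dP x (lt_trans ltr01 x1).
Qed.

Lemma integral_powR0 (d : R) : (0 < d)%R ->
  \int[leb]_(x in `]0%R, 1%R[) (x `^ (d - 1))%:E = (d^-1)%:E.
Proof.
move=> d0; rewrite -(integral_powRy _ d0) ge0_integral_inv//; last 2 first.
- by apply: measurable_funEFin; exact: measurable_powR.
- by move=> r; rewrite lee_fin powR_ge0.
apply: eq_integral => x; rewrite inE/= in_itv/= => /andP[x0 _].
rewrite -EFinM -powR_inv1 ?(ltW x0)// -powRrM -powRD ?(gt_eqF x0) ?implybT//.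
by congr (_%:E); congr (_ `^ _)%R; ring.
Qed.

End integrals_on_the_line.

(** * Borel sets of R^n *)

Section measurability_in_space.
Context {R : realType}.

(** The sigma-algebra being generated by coordinates, an open set has to be a countable union of
    boxes: those with rational centre and radius 1 / (k + 1) that it contains. *)
Lemma open_measurable_rV n (U : set 'rV[R]_n) : open U -> measurable U.
Proof.
move=> oU.
pose c (q : 'rV[rat]_n) : 'rV[R]_n := map_mx ratr q.
pose B (q : 'rV[rat]_n) (k : nat) : set 'rV[R]_n :=
  [set x | forall i, `|x ord0 i - c q ord0 i| < k.+1%:R^-1].
have mB q k : measurable (B q k).
  rewrite (_ : B q k = \big[setI/setT]_(i < n)
      ([set: 'rV[R]_n] `&` rV_coord i @^-1` ball (c q ord0 i) k.+1%:R^-1)).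
    apply: bigsetI_measurable => i _.
    by apply: measurable_rV_coord => //; exact: measurable_ball.
  apply/seteqP; split => x /=.
    move=> Bx; rewrite big_seq; elim/big_ind : _ => //= i _.
    by split => //; rewrite /= /ball/= distrC; exact: Bx.
  move=> + i; rewrite (bigD1 i)//= => -[[_]].
  by rewrite /= /ball/= distrC.
pose T := ('rV[rat]_n * nat)%type.
have -> : U = \bigcup_(t in [set t : T | B t.1 t.2 `<=` U]) B t.1 t.2.
  apply/seteqP; split => [x Ux|x [t /= BU Bx]]; last exact: BU.
  have /nbhs_ballP[e /= e0 xeU] : nbhs x U by exact: open_nbhs_nbhs.
  (* Twice the radius, because the box contains [x] without being centred at it. *)
  pose k := Num.truncn (2 / e).
  have ke : 2 / k.+1%:R < e.
    by rewrite ltr_pdivrMr// mulrC -ltr_pdivrMr// truncnS_gt.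
  have k0 : 0 < k.+1%:R^-1 :> R by rewrite invr_gt0.
  have qP i : exists q : rat, `|x ord0 i - ratr q| < k.+1%:R^-1.
    move: k0; set h := k.+1%:R^-1; set z := x ord0 i => h0.
    have : z - h < z + h by lra.
    move=> /rat_in_itvoo[q]; rewrite in_itv/= => /andP[q1 q2]; exists q.
    by rewrite ltr_norml; apply/andP; split; lra.
  have [q qx] := choice qP.
  exists (\row_i q i, k) => /=; last by move=> i; rewrite /c !mxE; exact: qx.
  move=> y Bxy; apply: xeU; rewrite -ball_normE /=; apply: (le_lt_trans _ ke).
  rewrite /Num.norm/= mx_normrE; apply/bigmax_leP; split; first by rewrite divr_ge0.
  move=> [i j] _ /=; rewrite !ord1.
  have := Bxy j; rewrite /c !mxE => Bj; have qj := qx j.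
  rewrite (le_trans (ler_distD (ratr (q j)) _ _))//.
  by rewrite [X in _ + X]distrC (_ : 2 / k.+1%:R = k.+1%:R^-1 + k.+1%:R^-1) ?lerD ?ltW//; field.
rewrite bigcup_mkcond; apply: countable_bigcupT_measurable.
  exact: countableP.
by move=> t; case: ifP.
Qed.

Lemma continuous_measurable_rV n (f : 'rV[R]_n -> R) : continuous f ->
  measurable_fun setT f.
Proof.
move=> cf; apply: (measurability _ (RGenOpens.measurableE R)).
move=> _ [_ [a [b ->] <-]]; rewrite setTI; apply: open_measurable_rV.
by apply: open_comp => [+ _|]; [exact: cf|exact: interval_open].
Qed.

End measurability_in_space.

(** * Iterated integrals and affine changes of variable in R^n *)

Section integration_in_space.
Local Open Scope ereal_scope.
Context {R : realType}.
Local Notation leb := (@lebesgue_measure R).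
Local Notation mu n := (@lebesgue_rV R n).

Lemma measurable_rV_cons2 n (a : R) :
  measurable_fun setT (fun y : 'rV[R]_n => rV_cons (a : measurableTypeR R, y)).
Proof. by apply: measurableT_comp => //; exact: measurable_rV_cons. Qed.

Lemma measurable_rV_affine n (c : R) (v : 'rV[R]_n) :
  measurable_fun setT (fun x : 'rV[R]_n => c *: x + v)%R.
Proof.
apply: measurable_fun_rVP => i.
rewrite (_ : _ \o _ = (fun x => c * rV_coord i x + v ord0 i)%R); last first.
  by apply/funext => x; rewrite /rV_coord /= !mxE.
by apply: measurable_funD => //; apply: measurable_funM => //; exact: measurable_rV_coord.
Qed.

Lemma ge0_integral_rV0 (f : 'rV[R]_0 -> \bar R) : measurable_fun setT f ->
  \int[mu 0]_x f x = f 0%R.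
Proof. by move=> mf; rewrite /= integral_dirac// diracT mul1e. Qed.

Section one_more_coordinate.
Variables (n : nat) (f : 'rV[R]_n.+1 -> \bar R).
Hypotheses (mf : measurable_fun setT f) (f0 : forall x, 0 <= f x).

Let mfc : measurable_fun setT (fun p : measurableTypeR R * 'rV[R]_n => f (rV_cons p)).
Proof. by apply: measurableT_comp => //; exact: measurable_rV_cons. Qed.

Lemma ge0_integral_rVS :
  \int[mu n.+1]_x f x = \int[leb]_a \int[mu n]_y f (rV_cons (a, y)).
Proof.
transitivity (\int[pushforward (leb \x mu n) rV_cons]_x f x) => //.
rewrite (ge0_integral_pushforward measurable_rV_cons)//.
rewrite preimage_setT.
exact: (fubini_tonelli1 (fun p : measurableTypeR R * 'rV[R]_n => f (rV_cons p)) mfc (fun p => f0 _)).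
Qed.

Lemma ge0_integral_rVS' :
  \int[mu n.+1]_x f x = \int[mu n]_y \int[leb]_a f (rV_cons (a, y)).
Proof.
rewrite ge0_integral_rVS.
exact: (fubini_tonelli (fun p : measurableTypeR R * 'rV[R]_n => f (rV_cons p))).
Qed.

Lemma measurable_integral_rVS :
  measurable_fun setT (fun a : measurableTypeR R => \int[mu n]_y f (rV_cons (a, y))).
Proof.
exact: (measurable_fun_fubini_tonelli_F (fun p : measurableTypeR R * 'rV[R]_n => f (rV_cons p))).
Qed.

End one_more_coordinate.

Lemma rV_cons_affine n (c : R) (v : 'rV[R]_n.+1) a (y : 'rV[R]_n) :
  (c *: rV_cons (a, y) + v = rV_cons ((c * a + (rV_uncons v).1)%R, c *: y + (rV_uncons v).2))%R.
Proof.
apply/rowP => i; have [j ->|->] := unliftP ord0 i.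
  rewrite rV_consS [LHS]mxE [X in (X + _)%R]mxE rV_consS /= ![in RHS]mxE.
  by congr (_ + v _ _)%R; exact: val_inj.
by rewrite rV_cons0 [LHS]mxE [X in (X + _)%R]mxE rV_cons0.
Qed.

Lemma ge0_integral_rV_affine n (f : 'rV[R]_n -> \bar R) (c : R) (v : 'rV[R]_n) :
  (c != 0)%R -> measurable_fun setT f -> (forall x, 0 <= f x) ->
  \int[mu n]_x f (c *: x + v)%R = ((`|c|^-1) ^+ n)%:E * \int[mu n]_x f x.
Proof.
move=> c0; elim: n f v => [|n IH] f v mf f0.
  rewrite !ge0_integral_rV0//; last by apply: measurableT_comp => //; exact: measurable_rV_affine.
  by rewrite expr0 mul1e; congr f; apply/rowP => -[].
rewrite ge0_integral_rVS//; last by apply: measurableT_comp => //; exact: measurable_rV_affine.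
rewrite [in RHS]ge0_integral_rVS//.
have mfa a : measurable_fun setT (fun y : 'rV[R]_n => f (rV_cons (a : measurableTypeR R, y))).
  by apply: measurableT_comp => //; exact: measurable_rV_cons2.
pose g (a : R) := \int[mu n]_y f (rV_cons (a, y)).
have g0 a : 0 <= g a by exact: integral_ge0.
have mg : measurable_fun setT g by exact: measurable_integral_rVS.
transitivity (\int[leb]_a (((`|c|^-1) ^+ n)%:E * g (c * a + (rV_uncons v).1)%R)).
  apply: eq_integral => a _; rewrite /g -(IH _ (rV_uncons v).2)//.
  by apply: eq_integral => y _; rewrite rV_cons_affine.
pose G (a : R) := g (c * a + (rV_uncons v).1)%R.
have mG : measurable_fun setT G.
  by apply: (measurableT_comp mg); apply: measurable_funD => //; exact: measurable_funM.
have k0 : 0 <= ((`|c|^-1) ^+ n)%:E by rewrite lee_fin exprn_ge0// invr_ge0.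
transitivity (((`|c|^-1) ^+ n)%:E * \int[leb]_a G a).
  exact: (ge0_integralZl leb measurableT mG (fun a _ => g0 _) k0).
by rewrite /G ge0_integral_affine// muleA -EFinM exprSr.
Qed.

Lemma ge0_integral_rVN n (f : 'rV[R]_n -> \bar R) :
  measurable_fun setT f -> (forall x, 0 <= f x) ->
  \int[mu n]_x f (- x)%R = \int[mu n]_x f x.
Proof.
move=> mf f0; transitivity (\int[mu n]_x f (-1 *: x + 0)%R).
  by apply: eq_integral => x _; rewrite scaleN1r addr0.
have N1 : (-1 : R)%R != 0%R by rewrite oppr_eq0.
by rewrite ge0_integral_rV_affine// normrN1 invr1 expr1n mul1e.
Qed.

Lemma ge0_integral_rVshift n (f : 'rV[R]_n -> \bar R) (v : 'rV[R]_n) :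
  measurable_fun setT f -> (forall x, 0 <= f x) ->
  \int[mu n]_x f (x + v)%R = \int[mu n]_x f x.
Proof.
move=> mf f0; transitivity (\int[mu n]_x f (1 *: x + v)%R).
  by apply: eq_integral => x _; rewrite scale1r.
by rewrite ge0_integral_rV_affine// normr1 invr1 expr1n mul1e.
Qed.

End integration_in_space.

(** * Scalar product and Euclidean norm *)

Section euclidean.
Context {R : realType} {n : nat}.
Implicit Types (x y z : 'rV[R]_n) (c : R).

Definition dotv x y : R := \sum_(i < n) x ord0 i * y ord0 i.

Lemma dotvC x y : dotv x y = dotv y x.
Proof. by apply: eq_bigr => i _; rewrite mulrC. Qed.

Lemma dotvDr x y z : dotv x (y + z) = dotv x y + dotv x z.
Proof. by rewrite /dotv -big_split; apply: eq_bigr => i _; rewrite mxE mulrDr. Qed.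

Lemma dotvZr c x y : dotv x (c *: y) = c * dotv x y.
Proof. by rewrite /dotv mulr_sumr; apply: eq_bigr => i _; rewrite mxE mulrCA. Qed.

Lemma dotvNr x y : dotv x (- y) = - dotv x y.
Proof. by rewrite -scaleN1r dotvZr mulN1r. Qed.

Lemma eucl_norm_ge0 x : 0 <= eucl_norm x.
Proof. exact: sqrtr_ge0. Qed.

Lemma dotvv_ge0 x : 0 <= dotv x x.
Proof. by apply: sumr_ge0 => i _; rewrite -expr2 sqr_ge0. Qed.

Lemma sqr_eucl_norm x : eucl_norm x ^+ 2 = dotv x x.
Proof.
rewrite /eucl_norm sqr_sqrtr; first by apply: eq_bigr => i _; rewrite expr2.
by apply: sumr_ge0 => i _; rewrite sqr_ge0.
Qed.

Lemma eucl_norm_dot x : eucl_norm x = Num.sqrt (dotv x x).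
Proof. by rewrite /eucl_norm; congr Num.sqrt; apply: eq_bigr => i _; rewrite expr2. Qed.

Lemma eucl_normN x : eucl_norm (- x) = eucl_norm x.
Proof. by rewrite !eucl_norm_dot dotvNr dotvC dotvNr opprK. Qed.

Lemma eucl_normZ c x : eucl_norm (c *: x) = `|c| * eucl_norm x.
Proof. by rewrite !eucl_norm_dot dotvZr dotvC dotvZr mulrA -expr2 sqrtrM ?sqr_ge0// sqrtr_sqr. Qed.

Lemma eucl_norm_distC x y : eucl_norm (x - y) = eucl_norm (y - x).
Proof. by rewrite -eucl_normN opprB. Qed.

Lemma eucl_norm0 : eucl_norm (0 : 'rV[R]_n) = 0.
Proof. by rewrite -(scale0r 0) eucl_normZ normr0 mul0r. Qed.

Lemma coord_le_eucl_norm x i : `|x ord0 i| <= eucl_norm x.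
Proof.
rewrite -sqrtr_sqr; apply: ler_wsqrtr; rewrite (bigD1 i)//= lerDl.
by apply: sumr_ge0 => j _; exact: sqr_ge0.
Qed.

Lemma eucl_norm_eq0 x : (eucl_norm x == 0) = (x == 0).
Proof.
apply/eqP/eqP => [x0|->]; last exact: eucl_norm0.
apply/rowP => i; rewrite mxE; apply/eqP; rewrite -normr_le0 -x0.
exact: coord_le_eucl_norm.
Qed.

Lemma eucl_norm_gt0 x : (0 < eucl_norm x) = (x != 0).
Proof. by rewrite lt_neqAle eucl_norm_ge0 andbT eq_sym eucl_norm_eq0. Qed.

Lemma sqr_eucl_normB x y :
  eucl_norm (x - y) ^+ 2 = eucl_norm x ^+ 2 + eucl_norm y ^+ 2 - 2 * dotv x y.
Proof.
rewrite !sqr_eucl_norm dotvDr !dotvNr ![dotv (x - y) _]dotvC !dotvDr !dotvNr.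
by rewrite [dotv y x]dotvC; ring.
Qed.

Lemma CauchySchwarz_dotv x y : `|dotv x y| <= eucl_norm x * eucl_norm y.
Proof.
have [->|y0] := eqVneq y 0.
  by rewrite -(scale0r 0) dotvZr mul0r normr0 mulr_ge0// eucl_norm_ge0.
have y2 : 0 < dotv y y by rewrite -sqr_eucl_norm exprn_gt0// eucl_norm_gt0.
rewrite !eucl_norm_dot -sqrtrM ?dotvv_ge0// -sqrtr_sqr; apply: ler_wsqrtr.
pose t := dotv x y / dotv y y.
have := dotvv_ge0 (x - t *: y); rewrite -sqr_eucl_norm sqr_eucl_normB !sqr_eucl_norm.
rewrite dotvZr [dotv (t *: y) _]dotvC !dotvZr => H.
have tE : t * dotv y y = dotv x y by rewrite /t divfK// gt_eqF.
rewrite tE in H.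
have {}H : t * dotv x y <= dotv x x by lra.
by rewrite expr2 -[X in X * _]tE mulrAC ler_wpM2r// ltW.
Qed.

Lemma ler_eucl_normD x y : eucl_norm (x + y) <= eucl_norm x + eucl_norm y.
Proof.
have h1 := eucl_norm_ge0 x; have h2 := eucl_norm_ge0 y.
have h3 := eucl_norm_ge0 (x + y).
rewrite -(@ler_pXn2r _ 2)// ?nnegrE ?addr_ge0//.
have := sqr_eucl_normB x (- y); rewrite opprK eucl_normN dotvNr => ->.
have := CauchySchwarz_dotv x y => /(le_trans (ler_norm _)) h4.
by rewrite sqrrD; lra.
Qed.

Lemma ler_eucl_dist x y : `|eucl_norm x - eucl_norm y| <= eucl_norm (x - y).
Proof.
have h1 := ler_eucl_normD (x - y) y; rewrite subrK in h1.
have h2 := ler_eucl_normD (y - x) x; rewrite subrK eucl_norm_distC in h2.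
by rewrite ler_norml; apply/andP; split; lra.
Qed.

Lemma measurable_dotv x : measurable_fun setT (dotv x).
Proof.
rewrite /dotv; apply: measurable_sum => i.
by apply: measurable_funM => //; exact: measurable_rV_coord.
Qed.

Lemma measurable_eucl_norm : measurable_fun setT (@eucl_norm R n).
Proof.
have -> : @eucl_norm R n = (fun x => (\sum_(i < n) x ord0 i ^+ 2) `^ 2^-1).
  apply/funext => x; rewrite /eucl_norm powR12_sqrt//.
  by apply: sumr_ge0 => i _; exact: sqr_ge0.
apply: (measurableT_comp (measurable_powR _)).
apply: measurable_sum => i; apply: measurable_funX; exact: measurable_rV_coord.
Qed.

Lemma measurable_rVB : measurable_fun setT (fun p : 'rV[R]_n * 'rV[R]_n => p.1 - p.2).
Proof.
apply: measurable_fun_rVP => i.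
rewrite (_ : _ \o _ = (fun p => rV_coord i p.1 - rV_coord i p.2)); last first.
  by apply/funext => p; rewrite /rV_coord /= !mxE.
by apply: measurable_funB; apply: measurableT_comp => //; exact: measurable_rV_coord.
Qed.

End euclidean.

(** * Gamma and Beta integrals, Gaussian integrals on the line *)

Section gamma.
Local Open Scope ereal_scope.
Context {R : realType}.
Local Notation leb := (@lebesgue_measure R).
Implicit Types a b z : R.

(** The indicator extends the integrand by 0, so that Tonelli and affine changes of variable on the
    whole line apply. *)
Definition gamma_int z (t : R) : R := (\1_(`]0, +oo[) t * (t `^ (z - 1) * expR (- t)))%R.

Definition beta_int a b (t : R) : R :=
  (\1_(`]0, 1[) t * (t `^ (a - 1) * (1 - t) `^ (b - 1)))%R.

(* Extended-real, so that Tonelli applies before finiteness is known. *)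
Definition eGamma z := \int[leb]_t (gamma_int z t)%:E.

Definition eBeta a b := \int[leb]_t (beta_int a b t)%:E.

Lemma gamma_int_ge0 z t : (0 <= gamma_int z t)%R.
Proof. by rewrite /gamma_int !mulr_ge0 ?powR_ge0 ?expR_ge0. Qed.

Lemma beta_int_ge0 a b t : (0 <= beta_int a b t)%R.
Proof. by rewrite /beta_int !mulr_ge0 ?powR_ge0. Qed.

Lemma measurable_expRN : measurable_fun setT (fun t : R => expR (- t)).
Proof. by apply: measurableT_comp => //; exact: measurable_expR. Qed.

Lemma measurable_gamma_int z : measurable_fun setT (gamma_int z).
Proof.
apply: measurable_funM; first by apply: measurable_indic; exact: measurable_itv.
by apply: measurable_funM; [exact: measurable_powR|exact: measurable_expRN].
Qed.

Lemma measurable_beta_int a b : measurable_fun setT (beta_int a b).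
Proof.
apply: measurable_funM; first by apply: measurable_indic; exact: measurable_itv.
apply: measurable_funM; first exact: measurable_powR.
by apply: (measurableT_comp (measurable_powR _)); apply: measurable_funB.
Qed.

Lemma Gamma_funE z : Gamma_fun z = fine (eGamma z).
Proof.
rewrite /Gamma_fun /eGamma /Rintegral integral_mkcond; congr fine.
apply: eq_integral => t _; rewrite patchE /gamma_int indicE.
by case: (_ \in _); rewrite ?mul1r ?mul0r.
Qed.

Lemma Beta_funE a b : Beta_fun a b = fine (eBeta a b).
Proof.
rewrite /Beta_fun /eBeta /Rintegral integral_mkcond; congr fine.
apply: eq_integral => t _; rewrite patchE /beta_int indicE.
by case: (_ \in _); rewrite ?mul1r ?mul0r.
Qed.

Lemma indic_itvoy a (t : R) : \1_(`]a, +oo[) t = (a < t)%R%:R :> R.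
Proof.
by rewrite indicE; congr (nat_of_bool _)%:R; apply/idP/idP; rewrite inE/= in_itv/= andbT.
Qed.

Lemma indic_itvoo a b (t : R) : \1_(`]a, b[) t = (a < t < b)%R%:R :> R.
Proof.
by rewrite indicE; congr (nat_of_bool _)%:R; apply/idP/idP; rewrite inE/= in_itv/=.
Qed.

Lemma ge0_integral_indic (A : set R) (f : R -> R) :
  \int[leb]_t (\1_A t * f t)%:E = \int[leb]_(t in A) (f t)%:E.
Proof.
rewrite [RHS]integral_mkcond; apply: eq_integral => t _; rewrite patchE indicE.
by case: (_ \in _); rewrite ?mul1r ?mul0r.
Qed.

Lemma integral_expRN (x : R) : \int[leb]_(t in `]x, +oo[) (expR (- t))%:E = (expR (- x))%:E.
Proof.
rewrite integral_itv_obnd_cbnd; last first.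
  by apply: measurable_funEFin; apply: measurable_funTS; exact: measurable_expRN.
have dE (t : R) : is_derive t (1%R : R) (fun t => - expR (- t))%R (expR (- t)).
  have d1 : is_derive t (1%R : R) (fun t : R => - t)%R (-1)%R by exact: is_deriveNid.
  have := is_deriveN (is_derive_comp1 expR (fun t : R => - t)%R _ _ _ (is_derive_expR (- t)%R) d1).
  by rewrite mulrN1 opprK.
have cE : continuous (fun t : R => expR (- t)).
  by move=> t; apply: continuous_comp; [exact: opp_continuous|exact: continuous_expR].
rewrite (@ge0_continuous_FTC2y _ _ (fun t => - expR (- t))%R _ (- 0)%R).
- by rewrite oppr0 -EFinB sub0r opprK.
- by move=> t _; exact: expR_ge0.
- exact: continuous_subspaceT.
- apply: cvgN; apply/cvgrPdist_le => e e0; near=> t.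
  rewrite sub0r normrN ger0_norm ?expR_ge0// expRN.
  rewrite -[leRHS]invrK lef_pV2 ?posrE ?invr_gt0 ?expR_gt0//.
  apply: (@le_trans _ _ (1 + t)%R); last exact: expR_ge1Dx.
  have : (e^-1 <= t)%R by near: t; apply: nbhs_pinfty_ge; exact: num_real.
  lra.
- by move=> t _; have [] := dE t.
- by apply: cvg_at_right_filter; apply: is_derive_continuous (dE _).
- by move=> t _; rewrite derive1E; have [_ ->] := dE t.
Unshelve. all: by end_near. Qed.

Lemma integral_powR_itv z (x : R) : (0 < z)%R -> (0 < x)%R ->
  \int[leb]_s (\1_(`]0%R, x[) s * s `^ (z - 1))%:E = (x `^ z / z)%:E.
Proof.
move=> z0 x0.
have xn0 : x != 0%R by rewrite gt_eqF.
pose h (s : R) := (\1_(`]0%R, x[) s * s `^ (z - 1))%:E.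
have mh : measurable_fun setT h.
  apply: measurable_funEFin; apply: measurable_funM; last exact: measurable_powR.
  by apply: measurable_indic; exact: measurable_itv.
have h0 s : 0 <= h s by rewrite lee_fin mulr_ge0// powR_ge0.
have := @ge0_integral_affine R h x 0%R xn0 mh h0; rewrite gtr0_norm// => E.
have -> : \int[leb]_s h s = x%:E * \int[leb]_t h (x * t + 0)%R.
  by rewrite E muleA -EFinM mulfV// mul1e.
have -> : \int[leb]_t h (x * t + 0)%R =
    \int[leb]_t ((x `^ (z - 1))%:E * (\1_(`]0%R, 1%R[) t * t `^ (z - 1))%:E).
  apply: eq_integral => t _; rewrite addr0 /h -EFinM; congr EFin.
  have -> : \1_(`]0%R, x[) (x * t)%R = \1_(`]0%R, 1%R[) t :> R.
    rewrite !indic_itvoo; congr (nat_of_bool (_ && _))%:R; first by rewrite pmulr_rgt0.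
    by rewrite -[X in (_ < X)%R]mulr1 ltr_pM2l// mulr1.
  rewrite indic_itvoo; case: (boolP (0 < t < 1)%R); rewrite ?mul0r ?mulr0// => /andP[t0 _].
  by rewrite !mul1r powRM// ltW.
rewrite ge0_integralZl//; last 3 first.
- apply: measurable_funEFin; apply: measurable_funM; last exact: measurable_powR.
  by apply: measurable_indic; exact: measurable_itv.
- by move=> t _; rewrite lee_fin mulr_ge0// powR_ge0.
- by rewrite lee_fin powR_ge0.
rewrite ge0_integral_indic integral_powR0// -!EFinM; congr EFin.
by rewrite powRB1//; field; rewrite !gt_eqF.
Qed.

(** Tonelli for s^(z-1) exp(-t) on 0 < s < t: integrating in s first leaves t^z exp(-t) / z, in t
    first s^(z-1) exp(-s). Unlike integration by parts, this needs no finiteness. *)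
Lemma eGammaS z : (0 < z)%R -> eGamma (z + 1) = z%:E * eGamma z.
Proof.
move=> z0.
pose k (p : measurableTypeR R * measurableTypeR R) : R :=
  (\1_(`]0, +oo[) p.2 * (\1_(`]0, +oo[) (p.1 - p.2) * (p.2 `^ (z - 1) * expR (- p.1))))%R.
have mi : measurable_fun setT (\1_(`]0%R, +oo[) : R -> R).
  by apply: measurable_indic; exact: measurable_itv.
have m1 : measurable_fun setT (fun p : measurableTypeR R * measurableTypeR R => p.1 : R) by exact: measurable_fst.
have m2 : measurable_fun setT (fun p : measurableTypeR R * measurableTypeR R => p.2 : R) by exact: measurable_snd.
have mk : measurable_fun setT (fun p => (k p)%:E).
  apply: measurable_funEFin; apply: measurable_funM; first exact: (measurableT_comp mi m2).
  apply: measurable_funM; first exact: (measurableT_comp mi (measurable_funB m1 m2)).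
  apply: measurable_funM; first exact: (measurableT_comp (measurable_powR _) m2).
  exact: (measurableT_comp measurable_expRN m1).
have k0 p : 0 <= (k p)%:E by rewrite lee_fin !mulr_ge0// ?powR_ge0 ?expR_ge0.
have := @fubini_tonelli _ _ _ _ R leb leb _ mk k0.
rewrite (_ : \int[leb]_x _ = (z^-1)%:E * eGamma (z + 1)); last first.
  rewrite /eGamma -ge0_integralZl//; last 3 first.
  - by apply: measurable_funEFin; exact: measurable_gamma_int.
  - by move=> t _; rewrite lee_fin gamma_int_ge0.
  - by rewrite lee_fin invr_ge0 ltW.
  apply: eq_integral => t _.
  rewrite /gamma_int indic_itvoy; case: (boolP (0 < t)%R) => t0.
    rewrite mul1r addrK (_ : (z^-1)%:E * _ = (expR (- t))%:E * (t `^ z / z)%:E); last first.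
      by rewrite -!EFinM; congr EFin; ring.
    rewrite -integral_powR_itv// -ge0_integralZl//; last 2 first.
    - apply: measurable_funEFin; apply: measurable_funM; last exact: measurable_powR.
      by apply: measurable_indic; exact: measurable_itv.
    - by move=> s _; rewrite lee_fin mulr_ge0// powR_ge0.
    apply: eq_integral => s _; rewrite /k /= -EFinM; congr EFin.
    have -> : \1_(`]0%R, t[) s = (\1_(`]0%R, +oo[) s * \1_(`]0%R, +oo[) (t - s)%R)%R :> R.
      by rewrite !indic_itvoy indic_itvoo -natrM mulnb subr_gt0.
    by ring.
  rewrite mul0r mule0; apply: integral0_eq => s _; rewrite /k /=; congr EFin.
  rewrite !indic_itvoy subr_gt0; case: (boolP (0 < s)%R); rewrite ?mul0r// => s0.
  case: (boolP (s < t)%R); rewrite ?mul0r ?mulr0// => st.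
  by rewrite (lt_trans s0 st) in t0.
rewrite (_ : \int[leb]_y _ = eGamma z); last first.
  apply: eq_integral => s _.
  rewrite /gamma_int EFinM EFinM muleA -integral_expRN.
  have E : \int[leb]_(t in `]s, +oo[) (expR (- t))%:E = \int[leb]_t (\1_(`]0%R, +oo[) (t - s) * expR (- t))%:E.
    rewrite -ge0_integral_indic; apply: eq_integral => t _; congr (_ * _)%:E.
    by rewrite !indic_itvoy subr_gt0.
  rewrite E -EFinM -ge0_integralZl//; last 2 first.
  - apply: measurable_funEFin; apply: measurable_funM; last exact: measurable_expRN.
    by apply: (measurableT_comp mi); apply: measurable_funB.
  - by rewrite lee_fin mulr_ge0// powR_ge0.
  by apply: eq_integral => t _; rewrite /k /= -EFinM; congr EFin; ring.
move=> <-; rewrite muleA -EFinM mulfV ?mul1e// gt_eqF//.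
Qed.

Lemma eGamma_ge0 z : 0 <= eGamma z.
Proof. by apply: integral_ge0 => t _; rewrite lee_fin gamma_int_ge0. Qed.

Lemma eBeta_ge0 a b : 0 <= eBeta a b.
Proof. by apply: integral_ge0 => t _; rewrite lee_fin beta_int_ge0. Qed.

Lemma eGamma_shift z k : (0 < z)%R -> eGamma (z + k%:R) = (pochhammer z k)%:E * eGamma z.
Proof.
move=> z0; elim: k => [|k IH]; first by rewrite addr0 pochhammer0 mul1e.
rewrite -natr1 addrA eGammaS; last by rewrite ltr_pwDl.
by rewrite IH muleA -EFinM pochhammerS mulrC.
Qed.

Lemma eGamma1 : eGamma 1 = 1.
Proof.
transitivity (\int[leb]_t (\1_(`]0%R, +oo[) t * expR (- t))%:E).
  by apply: eq_integral => t _; rewrite /gamma_int subrr powRr0 mul1r.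
by rewrite ge0_integral_indic integral_expRN oppr0 expR0.
Qed.

Lemma powR_sqr (x q : R) : (0 <= x)%R -> ((x ^+ 2) `^ q = x `^ (2 * q))%R.
Proof. by move=> x0; rewrite powRrM powR_mulrn. Qed.

(** The substitution t = r^2 in the Gamma integral. *)
Lemma integral_gauss_exprn (m : nat) :
  2%:E * \int[leb]_(r in `]0%R, +oo[) (r ^+ m * expR (- r ^+ 2))%:E = eGamma (m.+1%:R / 2).
Proof.
pose h (t : R) := (t `^ (m.+1%:R / 2 - 1) * expR (- t))%:E.
have mh : measurable_fun setT h.
  apply: measurable_funEFin; apply: measurable_funM; first exact: measurable_powR.
  exact: measurable_expRN.
have -> : eGamma (m.+1%:R / 2) = \int[leb]_(t in `]0%R, +oo[) h t.
  by rewrite /eGamma /gamma_int ge0_integral_indic.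
have h0 t : 0 <= h t by rewrite lee_fin mulr_ge0 ?powR_ge0 ?expR_ge0.
rewrite (ge0_integral_sqr h mh h0).
have me : measurable_fun setT (fun r : R => r ^+ m * expR (- r ^+ 2))%R.
  apply: measurable_funM; first exact: measurable_funX.
  by apply: (measurableT_comp measurable_expRN); exact: measurable_funX.
rewrite -ge0_integralZl//.
- apply: eq_integral => r; rewrite inE/= in_itv/= andbT => r0.
  rewrite /h -!EFinM; congr EFin.
  rewrite powR_sqr ?(ltW r0)//.
  have -> : (2%:R * (m.+1%:R / 2 - 1) = m%:R - 1 :> R)%R.
    by rewrite -[m.+1]addn1 natrD; field.
  by rewrite powRB1// powR_mulrn ?(ltW r0)//; field; rewrite gt_eqF.
- by apply: measurable_funEFin; apply: measurable_funTS.
- move=> r /=; rewrite in_itv/= andbT => r0.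
  by rewrite lee_fin mulr_ge0 ?expR_ge0// exprn_ge0// ltW.
Qed.

Lemma eGamma_half : eGamma (1 / 2) = (Num.sqrt pi)%:E.
Proof.
rewrite -(integral_gauss_exprn 0) -integralT_gauss ge0_symfun_integralT.
- congr (_ * _); rewrite -set_itvcy -integral_itv_obnd_cbnd; last first.
    by apply: measurable_funEFin; apply: measurable_funTS; exact: measurable_gauss_fun.
  by apply: eq_integral => r _; rewrite expr0 mul1r.
- exact: gauss_fun_ge0.
- exact: continuous_gauss_fun.
- by move=> r; rewrite /= /gauss_fun sqrrN.
Qed.

Lemma integralT_gauss_even (j : nat) :
  \int[leb]_r (r ^+ j.*2 * expR (- r ^+ 2))%:E = (pochhammer (1 / 2) j * Num.sqrt pi)%:E.
Proof.
rewrite EFinM -eGamma_half -eGamma_shift; last by lra.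
have -> : (1 / 2 + j%:R = j.*2.+1%:R / 2 :> R)%R.
  by rewrite -[j.*2.+1]addn1 natrD -addnn natrD; field.
rewrite -integral_gauss_exprn ge0_symfun_integralT.
- congr (_ * _); rewrite -set_itvcy integral_itv_obnd_cbnd//.
  apply: measurable_funEFin; apply: measurable_funTS.
  apply: measurable_funM; first exact: measurable_funX.
  by apply: (measurableT_comp measurable_expRN); exact: measurable_funX.
- by move=> r; rewrite mulr_ge0 ?expR_ge0// -mul2n exprM exprn_ge0// sqr_ge0.
- move=> r; apply: cvgM; first exact: exprn_continuous.
  apply: continuous_comp; last exact: continuous_expR.
  apply: continuous_comp; last exact: opp_continuous.
  exact: exprn_continuous.
- by move=> r /=; rewrite sqrrN -mul2n !exprM sqrrN.
Qed.

(** According to the parity of n, the functional equation leads down to the values at 1 or at 1/2.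
    Finiteness of the Gamma integral is only ever used at half-integers. *)
Lemma eGamma_half_nat (n : nat) : (0 < n)%N ->
  exists2 r : R, (0 < r)%R & eGamma (n%:R / 2) = r%:E.
Proof.
case: n => // n _.
have := odd_double_half n; case: (odd n) => /= nE.
  exists (pochhammer 1 n./2); first exact: pochhammer_gt0.
  have -> : (n.+1%:R / 2 = 1 + n./2%:R :> R)%R.
    by rewrite -[in LHS]nE -natr1 natrD -muln2 natrM; field.
  by rewrite eGamma_shift// eGamma1 mule1.
exists (pochhammer (1 / 2) n./2 * Num.sqrt pi)%R.
  by rewrite mulr_gt0 ?pochhammer_gt0 ?sqrtr_gt0 ?pi_gt0//; lra.
have -> : (n.+1%:R / 2 = 1 / 2 + n./2%:R :> R)%R.
  by rewrite -[in LHS]nE -natr1 add0n -muln2 natrM; field.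
by rewrite eGamma_shift ?eGamma_half//; lra.
Qed.

(** Tonelli for t^(a-1) (v - t)^(b-1) exp(-v) on 0 < t < v. Integrating in v first gives the product
    of the two Gamma integrals; in t first, after scaling t by v, the Beta integral times Gamma of a
    + b. *)
Lemma eBetaM a b : eBeta a b * eGamma (a + b) = eGamma a * eGamma b.
Proof.
pose k (p : measurableTypeR R * measurableTypeR R) : R :=
  (\1_(`]0, +oo[) p.1 * (\1_(`]0, +oo[) (p.2 - p.1) *
     (p.1 `^ (a - 1) * (p.2 - p.1) `^ (b - 1) * expR (- p.2))))%R.
have mi : measurable_fun setT (\1_(`]0%R, +oo[) : R -> R).
  by apply: measurable_indic; exact: measurable_itv.
have m1 : measurable_fun setT (fun p : measurableTypeR R * measurableTypeR R => p.1 : R) by exact: measurable_fst.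
have m2 : measurable_fun setT (fun p : measurableTypeR R * measurableTypeR R => p.2 : R) by exact: measurable_snd.
have m21 := measurable_funB m2 m1.
have mk : measurable_fun setT (fun p => (k p)%:E).
  apply: measurable_funEFin; apply: measurable_funM; first exact: (measurableT_comp mi m1).
  apply: measurable_funM; first exact: (measurableT_comp mi m21).
  apply: measurable_funM; last exact: (measurableT_comp measurable_expRN m2).
  apply: measurable_funM; first exact: (measurableT_comp (measurable_powR _) m1).
  exact: (measurableT_comp (measurable_powR _) m21).
have k0 p : 0 <= (k p)%:E by rewrite lee_fin !mulr_ge0// ?powR_ge0 ?expR_ge0.
have mg z : measurable_fun setT (fun t => (gamma_int z t)%:E).
  by apply: measurable_funEFin; exact: measurable_gamma_int.
have g0 z t : 0 <= (gamma_int z t)%:E by rewrite lee_fin gamma_int_ge0.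
have := @fubini_tonelli _ _ _ _ R leb leb _ mk k0.
rewrite (_ : \int[leb]_x _ = eGamma a * eGamma b); last first.
  rewrite {1}/eGamma -(ge0_integralZr leb measurableT (mg a) (fun t _ => g0 a t) (eGamma_ge0 b)).
  apply: eq_integral => t _.
  have -> : eGamma b = \int[leb]_v (gamma_int b (1 * v + (- t))%R)%:E.
    rewrite (ge0_integral_affine (fun v => (gamma_int b v)%:E))//.
    by rewrite normr1 invr1 mul1e.
  have mgs : measurable_fun setT (fun v : R => (gamma_int b (1 * v + - t)%R)%:E).
    apply: (measurableT_comp (mg b)); apply: measurable_funD => //.
  rewrite -(ge0_integralZl leb measurableT mgs (fun t _ => g0 b _) (g0 a t)).
  apply: eq_integral => v _; rewrite /k /gamma_int/= -EFinM mul1r; congr EFin.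
  rewrite (_ : expR (- v) = expR (- t) * expR (- (v - t)))%R; last first.
    by rewrite -expRD; congr expR; ring.
  by ring.
rewrite (_ : \int[leb]_y _ = eBeta a b * eGamma (a + b)) => [->//|].
rewrite {1}/eGamma -(ge0_integralZl leb measurableT (mg _) (fun t _ => g0 _ t) (eBeta_ge0 a b)).
apply: eq_integral => v _; rewrite muleC.
rewrite {1}/gamma_int indic_itvoy; case: (ltP 0%R v) => v0; last first.
  rewrite mul0r mul0e; apply: integral0_eq => t _; rewrite /k/= !indic_itvoy subr_gt0.
  case: (ltP 0%R t) => t0; rewrite ?mul0r//.
  by rewrite ltNge (le_trans v0 (ltW t0)) mul0r mulr0.
have mb : measurable_fun setT (fun t => (beta_int a b t)%:E).
  by apply: measurable_funEFin; exact: measurable_beta_int.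
have mkv : measurable_fun setT (fun t : R => (k (t, v))%:E).
  by apply: (measurableT_comp mk); exact: measurable_pair2.
have vn0 : v != 0%R by rewrite gt_eqF.
have := ge0_integral_affine _ _ 0%R vn0 mkv (fun t => k0 (t, v)); rewrite gtr0_norm// => E.
have -> : \int[leb]_t (k (t, v))%:E = v%:E * \int[leb]_t (k ((v * t + 0)%R, v))%:E.
  by rewrite E muleA -EFinM mulfV// mul1e.
rewrite mul1r /eBeta.
have e0 : 0 <= (v `^ (a + b - 1) * expR (- v))%:E by rewrite lee_fin mulr_ge0 ?powR_ge0 ?expR_ge0.
have b0 t : 0 <= (beta_int a b t)%:E by rewrite lee_fin beta_int_ge0.
rewrite -(ge0_integralZl leb measurableT mb (fun t _ => b0 t) e0).
have mkv' : measurable_fun setT (fun t : R => (k ((v * t + 0)%R, v))%:E).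
  by apply: (measurableT_comp mkv); apply: measurable_funD => //; exact: measurable_funM.
have v00 : 0 <= v%:E by rewrite lee_fin ltW.
rewrite -(ge0_integralZl leb measurableT mkv' (fun t _ => k0 _) v00).
apply: eq_integral => t _; rewrite /k /= addr0 -!EFinM; congr EFin.
rewrite /beta_int !indic_itvoy indic_itvoo pmulr_rgt0//.
have -> : (v - v * t = v * (1 - t))%R by ring.
rewrite pmulr_rgt0// subr_gt0.
case: (ltP 0%R t) => t0; rewrite ?mul0r ?mulr0 ?mul1r//.
case: (ltP t 1%R) => t1; rewrite ?mul0r ?mulr0 ?mul1r//=.
rewrite !powRM ?(ltW v0) ?(ltW t0) ?subr_ge0 ?(ltW t1)//.
have -> : (v `^ (a + b - 1) = v * (v `^ (a - 1) * v `^ (b - 1)))%R.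
  rewrite -powRD ?vn0 ?implybT// -[X in (X * _)%R](powRr1 (ltW v0)) -powRD ?vn0 ?implybT//.
  by congr (_ `^ _)%R; ring.
by ring.
Qed.

End gamma.

(** * Even parts of binomial expansions *)

Section even_binomial_sums.
Context {R : realType}.
Implicit Types u v : R.

Lemma sum_even_ord (F : nat -> R) k : (forall i, odd i -> F i = 0) ->
  \sum_(i < k.*2.+1) F i = \sum_(j < k.+1) F j.*2.
Proof.
move=> F0; elim: k => [|k IH]; first by rewrite !big_ord1.
rewrite doubleS big_ord_recr/= big_ord_recr/= IH [RHS]big_ord_recr/= doubleS.
by rewrite [F k.*2.+1]F0 ?addr0//= odd_double.
Qed.

Lemma even_binomial u v k :
  (u + v) ^+ k.*2 + (- u + v) ^+ k.*2 =
  2 * \sum_(j < k.+1) 'C(k.*2, j.*2)%:R * (u ^+ j.*2 * v ^+ (k - j).*2).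
Proof.
rewrite [u + v]addrC [- u + v]addrC !exprDn -big_split/=.
pose F i := v ^+ (k.*2 - i) * u ^+ i *+ 'C(k.*2, i) + v ^+ (k.*2 - i) * (- u) ^+ i *+ 'C(k.*2, i).
rewrite (sum_even_ord F) => [|i oi]; last first.
  by rewrite /F exprNn -signr_odd oi expr1 mulN1r mulrN mulNrn subrr.
rewrite mulr_sumr; apply: eq_bigr => j _; rewrite /F exprNn -signr_odd odd_double expr0 mul1r.
by rewrite doubleB -mulr_natl; ring.
Qed.

(** Follows from (2m)! = 4^m m! (1/2)_m. It lets the one-dimensional Gaussian moments recombine, by
    the binomial theorem, into a power of |x|^2. *)
Lemma bin_pochhammer_half k j : (j <= k)%N ->
  'C(k.*2, j.*2)%:R * (pochhammer (1 / 2) j * pochhammer (1 / 2) (k - j)) =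
  pochhammer (1 / 2) k * 'C(k, j)%:R :> R.
Proof.
move=> jk; have jk2 : (j.*2 <= k.*2)%N by rewrite leq_double.
have := congr1 (fun m => m%:R : R) (bin_fact jk2); rewrite /= -doubleB !natrM !fact_double.
have := congr1 (fun m => m%:R : R) (bin_fact jk); rewrite /= !natrM => <-.
have f0 i : i`!%:R != 0 :> R by rewrite pnatr_eq0 -lt0n fact_gt0.
have e : 4 ^+ k = 4 ^+ j * 4 ^+ (k - j) :> R by rewrite -exprD subnKC.
rewrite e => E.
have nz : 4 ^+ j * 4 ^+ (k - j) * (j`!%:R * (k - j)`!%:R) != 0 :> R.
  by rewrite !mulf_neq0// expf_neq0// pnatr_eq0.
apply: (mulfI nz); rewrite [RHS](_ : _ = 4 ^+ j * 4 ^+ (k - j) * ('C(k, j)%:R * (j`!%:R * (k - j)`!%:R))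
   * pochhammer (1 / 2) k); last by ring.
by rewrite -E; ring.
Qed.

End even_binomial_sums.

(** * Gaussian moments of the scalar product *)

Section gaussian_moments.
Local Open Scope ereal_scope.
Context {R : realType}.
Local Notation leb := (@lebesgue_measure R).
Local Notation mu n := (@lebesgue_rV R n).

Lemma exprn_even_ge0' (z : R) k : (0 <= z ^+ k.*2)%R.
Proof. by rewrite -mul2n exprM exprn_ge0// sqr_ge0. Qed.

Lemma measurable_gauss_exprn k : measurable_fun setT (fun r : R => (r ^+ k * expR (- r ^+ 2))%R).
Proof.
apply: measurable_funM; first exact: measurable_funX.
by apply: (measurableT_comp measurable_expRN); exact: measurable_funX.
Qed.

Lemma integral_gauss_affine_even (x b : R) k :
  \int[leb]_a ((x * a + b) ^+ k.*2 * expR (- a ^+ 2))%:E =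
  (\sum_(j < k.+1) 'C(k.*2, j.*2)%:R * (x ^+ j.*2 * b ^+ (k - j).*2)
     * (pochhammer (1 / 2) j * Num.sqrt pi))%:E.
Proof.
pose f (a : R) := ((x * a + b) ^+ k.*2 * expR (- a ^+ 2))%:E.
have f0 a : 0 <= f a by rewrite lee_fin mulr_ge0 ?expR_ge0// exprn_even_ge0'.
have mf : measurable_fun setT f.
  apply: measurable_funEFin; apply: measurable_funM.
    by apply: measurable_funX; apply: measurable_funD => //; exact: measurable_funM.
  by apply: (measurableT_comp measurable_expRN); exact: measurable_funX.
have N1 : (-1 : R)%R != 0%R by rewrite oppr_eq0.
have fN : \int[leb]_a f (-1 * a + 0)%R = \int[leb]_a f a.
  by rewrite ge0_integral_affine// normrN1 invr1 mul1e.
have mfN : measurable_fun setT (fun a : R => f (-1 * a + 0)%R).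
  by apply: (measurableT_comp mf); apply: measurable_funD => //; exact: measurable_funM.
(* Averaging with the reflected integrand removes the odd powers; the remaining terms are
   nonnegative and can be integrated one by one. *)
have -> : \int[leb]_a f a = 2^-1%:E * (\int[leb]_a f a + \int[leb]_a f (-1 * a + 0)%R).
  rewrite fN; case: (\int[leb]_a f a) => [r| |].
  - by rewrite -EFinD -EFinM; congr EFin; field.
  - by rewrite addye// gt0_muley// lte_fin invr_gt0.
  - by rewrite addNye gt0_muleNy// lte_fin invr_gt0.
rewrite -ge0_integralD//.
pose cf j := (2 * ('C(k.*2, j.*2)%:R * (x ^+ j.*2 * b ^+ (k - j).*2)))%R : R.
have cf0 j : (0 <= cf j)%R by rewrite /cf !mulr_ge0// exprn_even_ge0'.
have -> : \int[leb]_a (f a + f (-1 * a + 0)%R) =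
    \int[leb]_a \sum_(j < k.+1) ((cf j)%:E * (a ^+ j.*2 * expR (- a ^+ 2))%:E).
  apply: eq_integral => a _; rewrite /f -EFinD addr0 mulN1r sqrrN -mulrDl mulrN even_binomial.
  rewrite sumEFin; congr EFin; rewrite mulr_sumr mulr_suml; apply: eq_bigr => j _.
  by rewrite /cf exprMn; ring.
have mg j : measurable_fun setT (fun a : R => (a ^+ j.*2 * expR (- a ^+ 2))%:E).
  by apply: measurable_funEFin; exact: measurable_gauss_exprn.
have g0 j (a : R) : 0 <= (a ^+ j.*2 * expR (- a ^+ 2))%:E.
  by rewrite lee_fin mulr_ge0 ?expR_ge0// exprn_even_ge0'.
rewrite ge0_integral_sum//; last 2 first.
- by move=> j; apply: emeasurable_funM => //; exact: mg.
- by move=> j a _; rewrite mule_ge0// lee_fin.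
rewrite (eq_bigr (fun j : 'I_k.+1 => (cf j * (pochhammer (1 / 2) j * Num.sqrt pi))%:E)); last first.
  move=> j _; rewrite ge0_integralZl//; [|exact: mg|by rewrite lee_fin].
  by rewrite integralT_gauss_even -EFinM.
rewrite sumEFin -EFinM; congr EFin; rewrite mulr_sumr; apply: eq_bigr => j _.
by rewrite /cf; field.
Qed.

Lemma dotv_cons n (x : 'rV[R]_n.+1) a (y : 'rV[R]_n) :
  dotv x (rV_cons (a, y)) = (x ord0 ord0 * a + dotv (rV_uncons x).2 y)%R.
Proof.
rewrite /dotv big_ord_recl rV_cons0; congr (_ + _)%R; apply: eq_bigr => i _.
rewrite rV_consS !mxE; congr (x _ _ * _)%R; exact: val_inj.
Qed.

Lemma rV_cons_uncons n (x : 'rV[R]_n.+1) : rV_cons (x ord0 ord0, (rV_uncons x).2) = x.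
Proof. exact: rV_unconsK. Qed.

Lemma dotvv_cons n a (y : 'rV[R]_n) :
  dotv (rV_cons (a, y)) (rV_cons (a, y)) = (a ^+ 2 + dotv y y)%R.
Proof. by rewrite dotv_cons rV_cons0 rV_consK expr2. Qed.

Lemma measurable_dotvv n : measurable_fun setT (fun y : 'rV[R]_n => dotv y y).
Proof.
rewrite (_ : (fun y => _) = (fun y : 'rV[R]_n => eucl_norm y ^+ 2)%R).
  by apply: measurable_funX; exact: measurable_eucl_norm.
by apply/funext => y; rewrite sqr_eucl_norm.
Qed.

Lemma measurable_gauss_dotv n (x : 'rV[R]_n) k :
  measurable_fun setT (fun y : 'rV[R]_n => (dotv x y ^+ k.*2 * expR (- dotv y y))%:E).
Proof.
apply: measurable_funEFin; apply: measurable_funM.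
  by apply: measurable_funX; exact: measurable_dotv.
exact: (measurableT_comp measurable_expRN (measurable_dotvv n)).
Qed.

(** Only |x| enters the result, as rotation invariance predicts. No rotation is used: the induction
    splits off one coordinate, and [bin_pochhammer_half] reassembles the power of |x|^2. *)
Lemma integral_gauss_dotv n (x : 'rV[R]_n) k :
  \int[mu n]_y (dotv x y ^+ k.*2 * expR (- dotv y y))%:E =
  (pochhammer (1 / 2) k * Num.sqrt pi ^+ n * dotv x x ^+ k)%:E.
Proof.
elim: n x k => [|n IH] x k.
  rewrite ge0_integral_rV0; last exact: measurable_gauss_dotv.
  rewrite /dotv !big_ord0 oppr0 expR0 expr0 !mulr1 !expr0n double_eq0.
  by case: k => [|k] /=; rewrite ?pochhammer0 ?mulr1 ?mulr0.
have F0 m (z : 'rV[R]_m) j (y : 'rV[R]_m) : 0 <= (dotv z y ^+ j.*2 * expR (- dotv y y))%:E.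
  by rewrite lee_fin mulr_ge0 ?expR_ge0// exprn_even_ge0'.
rewrite ge0_integral_rVS'//; last exact: measurable_gauss_dotv.
set x0 := x ord0 ord0; set x' := (rV_uncons x).2.
pose cf j := ('C(k.*2, j.*2)%:R * x0 ^+ j.*2 * (pochhammer (1 / 2) j * Num.sqrt pi))%R : R.
have cf0 j : (0 <= cf j)%R.
  by rewrite /cf !mulr_ge0// ?exprn_even_ge0' ?sqrtr_ge0// ltW// pochhammer_gt0//; lra.
transitivity (\int[mu n]_y \sum_(j < k.+1) ((cf j)%:E *
    (dotv x' y ^+ (k - j).*2 * expR (- dotv y y))%:E)).
  apply: eq_integral => y _.
  transitivity (\int[leb]_a ((expR (- dotv y y))%:E * ((x0 * a + dotv x' y) ^+ k.*2 * expR (- a ^+ 2))%:E)).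
    apply: eq_integral => a _; rewrite dotv_cons dotvv_cons opprD expRD -EFinM; congr EFin.
    by ring.
  rewrite ge0_integralZl//; last 2 first.
  - apply: measurable_funEFin; apply: measurable_funM.
      by apply: measurable_funX; apply: measurable_funD => //; exact: measurable_funM.
    by apply: (measurableT_comp measurable_expRN); exact: measurable_funX.
  - by move=> a _; rewrite lee_fin mulr_ge0 ?expR_ge0// exprn_even_ge0'.
  rewrite integral_gauss_affine_even -EFinM sumEFin; congr EFin.
  by rewrite mulr_sumr; apply: eq_bigr => j _; rewrite /cf; ring.
rewrite ge0_integral_sum//; last 2 first.
- by move=> j; apply: emeasurable_funM => //; exact: measurable_gauss_dotv.
- by move=> j y _; rewrite mule_ge0// lee_fin.
rewrite (eq_bigr (fun j : 'I_k.+1 => (cf j * (pochhammer (1 / 2) (k - j) * Num.sqrt pi ^+ n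
     * dotv x' x' ^+ (k - j)))%:E)); last first.
  move=> j _; rewrite ge0_integralZl//; [|exact: measurable_gauss_dotv|by rewrite lee_fin].
  by rewrite IH -EFinM.
rewrite sumEFin; congr EFin.
have -> : dotv x x = (dotv x' x' + x0 ^+ 2)%R by have := dotvv_cons _ x0 x'; rewrite rV_cons_uncons addrC.
rewrite exprDn mulr_sumr; apply: eq_bigr => j _; rewrite /cf -[X in (_ = _ * X)%R]mulr_natl.
have jk : (j <= k)%N by rewrite -ltnS.
rewrite (_ : x0 ^+ j.*2 = (x0 ^+ 2) ^+ j)%R; last by rewrite -exprM mul2n.
rewrite [(Num.sqrt pi ^+ n.+1)%R]exprS.
transitivity ('C(k.*2, j.*2)%:R * (pochhammer (1 / 2) j * pochhammer (1 / 2) (k - j))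
   * (Num.sqrt pi * Num.sqrt pi ^+ n * ((x0 ^+ 2) ^+ j * dotv x' x' ^+ (k - j))))%R; first by ring.
by rewrite bin_pochhammer_half//; ring.
Qed.

End gaussian_moments.

(** * Integrals of radial functions against powers of a scalar product *)

Section radial_integrals.
Local Open Scope ereal_scope.
Context {R : realType}.
Local Notation leb := (@lebesgue_measure R).
Local Notation mu n := (@lebesgue_rV R n).

Lemma lebesgue_rV_set0 n : (0 < n)%N -> mu n [set 0%R] = 0.
Proof.
move=> n0; pose o : 'rV[R]_n := 0%R.
have -> : [set 0%R] = [set x : 'rV[R]_n | forall i, (o ord0 i <= x ord0 i <= o ord0 i)%R].
  apply/seteqP; split => x /=; first by move=> -> i; rewrite lexx.
  by move=> xi; apply/rowP => i; apply/esym/le_anti; exact: xi.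
rewrite lebesgue_rV_box//; congr EFin; case: n n0 @o => // n _ o.
by rewrite big_ord_recl subrr mul0r.
Qed.

Lemma eucl_norm_le0_set n : @eucl_norm R n @^-1` `]-oo, 0%R] = [set 0%R].
Proof.
apply/seteqP; split => x /=; rewrite in_itv/=.
  by move=> x0; apply/eqP; rewrite -eucl_norm_eq0 eq_le x0 eucl_norm_ge0.
by move=> ->; rewrite eucl_norm0.
Qed.

Section shell.
Variables (n : nat) (x : 'rV[R]_n) (k : nat).
Hypothesis n0 : (0 < n)%N.

Let w (y : 'rV[R]_n) : R := (dotv x y ^+ k.*2)%R.

Let w_ge0 y : (0 <= w y)%R. Proof. exact: exprn_even_ge0'. Qed.

Let mw : measurable_fun setT w.
Proof. by apply: measurable_funX; exact: measurable_dotv. Qed.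

Let ball0 (b : R) : set 'rV[R]_n := @eucl_norm R n @^-1` `]0%R, b].

Let mball0 b : measurable (ball0 b).
Proof.
by rewrite -[X in measurable X]setTI; apply: measurable_eucl_norm.
Qed.

Let mwB b : measurable_fun (ball0 b) (fun y => (w y)%:E).
Proof. by apply: measurable_funEFin; exact: measurable_funTS. Qed.

Let V b := \int[mu n]_(y in ball0 b) (w y)%:E.

Let V_lty : V 1%R < +oo.
Proof.
(* On the unit ball exp(1 - |y|^2) >= 1, so the Gaussian moment dominates. *)
apply: (@le_lt_trans _ _ ((expR 1)%:E * \int[mu n]_y (dotv x y ^+ k.*2 * expR (- dotv y y))%:E)); last first.
  by rewrite integral_gauss_dotv -EFinM ltry.
rewrite -ge0_integralZl//; last 2 first.
- exact: measurable_gauss_dotv.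
- by move=> y _; rewrite lee_fin mulr_ge0 ?expR_ge0// exprn_even_ge0'.
rewrite /V [leLHS]integral_mkcond; apply: ge0_le_integral => //.
- by move=> y _; rewrite patchE; case: ifP => // _; rewrite lee_fin.
- exact: ((measurable_restrictT _ (mball0 1%R)).1 (mwB 1%R)).
- by apply: emeasurable_funM => //; exact: measurable_gauss_dotv.
move=> y _; rewrite patchE -EFinM; case: ifPn; rewrite ?inE => yb; rewrite lee_fin; last first.
  by rewrite !mulr_ge0 ?expR_ge0// exprn_even_ge0'.
rewrite mulrCA -expRD ler_peMr// ?exprn_even_ge0'// -expR0 ler_expR subr_ge0 -sqr_eucl_norm.
by move: yb; rewrite /ball0/= in_itv/= => /andP[y0 y1]; rewrite expR0 expr_le1// ltW.
Qed.

Let V_scale (b : R) : (0 < b)%R -> V b = (b ^+ (n + k.*2))%:E * V 1%R.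
Proof.
move=> b0; have b0' : b != 0%R by rewrite gt_eqF.
pose f (y : 'rV[R]_n) := ((EFin \o w) \_ (ball0 1%R)) y.
have mf : measurable_fun setT f.
  exact: ((measurable_restrictT _ (mball0 1%R)).1 (mwB 1%R)).
have f0 y : 0 <= f y by rewrite /f patchE; case: ifP => // _; rewrite lee_fin.
have := @ge0_integral_rV_affine R n f b^-1%R 0%R; rewrite invr_eq0 normfV invrK gtr0_norm//.
move=> /(_ b0' mf f0) E.
rewrite exprD EFinM [(b ^+ n)%:E * _]muleC -muleA {2}/V integral_mkcond -/f -E -ge0_integralZl//.
- rewrite /V [LHS]integral_mkcond; apply: eq_integral => y _; rewrite /f !patchE addr0.
  have -> : (b^-1 *: y \in ball0 1%R) = (y \in ball0 b).
    apply/idP/idP; rewrite !inE /ball0/= !in_itv/= eucl_normZ gtr0_norm ?invr_gt0//.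
      by rewrite pmulr_rgt0 ?invr_gt0// => /andP[-> /=]; rewrite mulrC ler_pdivrMr// mul1r.
    by move=> /andP[y0 yb]; rewrite mulr_gt0 ?invr_gt0//= mulrC ler_pdivrMr// mul1r.
  case: ifP => _; last by rewrite mule0.
  by rewrite /= -EFinM /w dotvZr exprMn mulrA -exprMn mulfV// expr1n mul1r.
- by apply: (measurableT_comp mf); exact: measurable_rV_affine.
- by rewrite lee_fin exprn_ge0// ltW.
Qed.

(** By dilation, the integral of (x.y)^(2k) over the ball of radius b is proportional to b^(n + 2k).
    This fixes the radial density up to the factor [V 1], which is read off from h(r) =
    exp(-r^2). *)
Lemma ge0_integral_shell h : measurable_fun setT h -> (forall r : R, 0 <= h r) ->
  \int[mu n]_y (h (eucl_norm y) * (dotv x y ^+ k.*2)%:E) =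
  (2 * pochhammer (1 / 2) k * Num.sqrt pi ^+ n * dotv x x ^+ k / fine (eGamma (n%:R / 2 + k%:R)))%:E
  * \int[leb]_(r in `]0%R, +oo[) (h r * (r ^+ (n + k.*2).-1)%:E).
Proof.
pose m := (n + k.*2).-1.
have mE : (n + k.*2)%N = m.+1 by rewrite /m prednK// addn_gt0 n0.
have V0 : 0 <= V 1%R by apply: integral_ge0 => y _; rewrite lee_fin.
pose v := fine (V 1%R); have vE : V 1%R = v%:E by rewrite fineK// ge0_fin_numE.
have v0 : (0 <= v)%R by rewrite fine_ge0.
pose w2 (r : R) : R := (\1_(`]0%R, +oo[) r * (v * (m.+1%:R * r ^+ m)))%R.
have mw2 : measurable_fun setT w2.
  apply: measurable_funM; first by apply: measurable_indic; exact: measurable_itv.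
  by apply: measurable_funM => //; apply: measurable_funM => //; exact: measurable_funX.
have w20 r : (0 <= w2 r)%R.
  rewrite /w2 indic_itvoy; case: (ltP 0%R r) => r0; last by rewrite mul0r.
  by rewrite mul1r !mulr_ge0// exprn_ge0// ltW.
have Iw2 (b : R) : (0 < b)%R -> \int[leb]_(r in `]0%R, b]) (w2 r)%:E = (v * b ^+ m.+1)%:E.
  move=> b0; rewrite EFinM -integral_exprn ?ltW// -ge0_integralZl//; last 2 first.
  - apply: measurable_funEFin; apply: measurable_funTS.
    by apply: measurable_funM => //; exact: measurable_funX.
  - move=> r /=; rewrite in_itv/= => /andP[r0 _].
    by rewrite lee_fin mulr_ge0// exprn_ge0// ltW.
  apply: eq_integral => r; rewrite inE/= in_itv/= => /andP[r0 _].
  by rewrite /w2 indic_itvoy r0 mul1r.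
have K g : measurable_fun setT g -> (forall r : R, 0 <= g r) ->
    \int[mu n]_y (g (eucl_norm y) * (w y)%:E) =
    (v * m.+1%:R)%:E * \int[leb]_(r in `]0%R, +oo[) (g r * (r ^+ m)%:E).
  move=> mg g0; transitivity (\int[leb]_r (g (idfun r) * (w2 r)%:E)).
    move: g mg g0; apply: ge0_integral_unique_pos => //.
    - exact: measurable_eucl_norm.
    - exact: measurable_id.
    - rewrite eucl_norm_le0_set; apply: null_set_integral => //.
      + by rewrite -eucl_norm_le0_set -[X in measurable X]setTI; apply: measurable_eucl_norm => //; exact: measurable_itv.
      + by apply: measurable_funEFin; exact: measurable_funTS.
      + exact: lebesgue_rV_set0.
    - apply: integral0_eq => r /=; rewrite in_itv/= => r0.
      by rewrite /w2 indic_itvoy ltNge r0 mul0r.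
    - by move=> b b0; rewrite -/(ball0 b) -/(V b) V_scale// vE -EFinM ltry.
    - by move=> b b0; rewrite -/(ball0 b) -/(V b) V_scale// vE Iw2// mE -EFinM mulrC.
  rewrite -ge0_integralZl//; last 3 first.
  - apply: emeasurable_funM; first exact: measurable_funTS.
    by apply: measurable_funEFin; apply: measurable_funTS; exact: measurable_funX.
  - move=> r /=; rewrite in_itv/= andbT => r0.
    by rewrite mule_ge0// lee_fin exprn_ge0// ltW.
  - by rewrite lee_fin mulr_ge0.
  rewrite [RHS]integral_mkcond; apply: eq_integral => r _.
  rewrite patchE /w2 indicE; case: (_ \in _); rewrite ?mul0r ?mule0// mul1r.
  by rewrite muleCA -EFinM; congr (_ * _%:E); ring.
move=> mh h0; rewrite K// -/m; congr (_%:E * _).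
have [G G0 GE] := @eGamma_half_nat R _ (ltn_addr k.*2 n0).
have eG : eGamma (n%:R / 2 + k%:R) = G%:E.
  by rewrite -GE; congr eGamma; rewrite natrD -muln2 natrM; field.
pose I := \int[leb]_(r in `]0%R, +oo[) ((expR (- r ^+ 2))%:E * (r ^+ m)%:E) : \bar R.
have IE : I = (G / 2)%:E.
  have I2 : 2%:E * I = G%:E.
    rewrite -GE mE -integral_gauss_exprn; congr (_ * _).
    by apply: eq_integral => r _; rewrite -EFinM mulrC.
  have -> : I = 2^-1%:E * (2%:E * I) by rewrite muleA -EFinM mulVf ?mul1e.
  by rewrite I2 -EFinM mulrC.
have me : measurable_fun setT (fun r : R => (expR (- r ^+ 2))%:E).
  by apply: measurable_funEFin; apply: (measurableT_comp measurable_expRN); exact: measurable_funX.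
(* Both sides of [K] are known for the Gaussian, which determines [v]. *)
have := K _ me (fun r => _ : 0 <= (expR (- r ^+ 2))%:E).
rewrite -/I IE -EFinM => KE.
have {}KE : (pochhammer (1 / 2) k * Num.sqrt pi ^+ n * dotv x x ^+ k = v * m.+1%:R * (G / 2))%R.
  apply: EFin_inj; rewrite -KE; last by move=> r; rewrite lee_fin expR_ge0.
  rewrite -integral_gauss_dotv; apply: eq_integral => y _.
  by rewrite -EFinM mulrC sqr_eucl_norm.
rewrite eG /=; apply/esym.
transitivity (2 * (pochhammer (1 / 2) k * Num.sqrt pi ^+ n * dotv x x ^+ k) / G)%R; first by ring.
by rewrite KE; field; rewrite gt_eqF.
Qed.

End shell.

End radial_integrals.

(** * The spherical mean of the kernel as a hypergeometric function *)

Section kernel_expansion.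
Local Open Scope ereal_scope.
Context {R : realType}.
Local Notation leb := (@lebesgue_measure R).
Local Notation mu n := (@lebesgue_rV R n).

Lemma ge0_integral_mean d (T : measurableType d) (m : {measure set T -> \bar R})
    (f1 f2 : T -> \bar R) :
  measurable_fun setT f1 -> measurable_fun setT f2 ->
  (forall y, 0 <= f1 y) -> (forall y, 0 <= f2 y) ->
  \int[m]_y f1 y = \int[m]_y f2 y ->
  \int[m]_y f1 y = \int[m]_y (2^-1%:E * (f1 y + f2 y)).
Proof.
move=> mf1 mf2 f10 f20 f12.
rewrite ge0_integralZl//; last 2 first.
- exact: emeasurable_funD.
- by move=> y _; rewrite adde_ge0.
rewrite ge0_integralD// -f12; case: (\int[m]_y f1 y) => [r| |].
- by rewrite -EFinD -EFinM; congr EFin; field.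
- by rewrite addye// gt0_muley// lte_fin invr_gt0.
- by rewrite addNye gt0_muleNy// lte_fin invr_gt0.
Qed.

Lemma ge0_integralZl_eq d (T : measurableType d) (m : {measure set T -> \bar R})
    (D : set T) (f1 f2 : T -> \bar R) (k1 k2 : R) : measurable D ->
  measurable_fun D f1 -> measurable_fun D f2 ->
  (forall y, D y -> 0 <= f1 y) -> (forall y, D y -> 0 <= f2 y) ->
  (0 <= k1)%R -> (0 <= k2)%R -> (forall y, D y -> k1%:E * f1 y = k2%:E * f2 y) ->
  k1%:E * \int[m]_(y in D) f1 y = k2%:E * \int[m]_(y in D) f2 y.
Proof.
move=> mD mf1 mf2 f10 f20 k10 k20 f12.
rewrite -!ge0_integralZl// ?lee_fin//.
by apply: eq_integral => y /[!inE]; exact: f12.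
Qed.

Lemma mean_mule (z : \bar R) (u v : R) : (0 <= u)%R -> (0 <= v)%R ->
  2^-1%:E * (z * u%:E + z * v%:E) = z * ((u + v) / 2)%:E.
Proof.
move=> u0 v0; rewrite -ge0_muleDr ?lee_fin// muleCA -EFinD -EFinM.
by congr (_ * _%:E); rewrite mulrC.
Qed.

Lemma nneseries_EFin (u : nat -> R) l : series u @ \oo --> l ->
  \sum_(0 <= k <oo) (u k)%:E = l%:E.
Proof.
move=> ul; apply/cvg_lim => //.
rewrite [X in X @ _ --> _](_ : _ = EFin \o series u); last first.
  by apply/funext => n /=; rewrite sumEFin.
by apply: cvg_EFin; [exact: nearW|exact: ul].
Qed.

Lemma even_binomial_series (a t : R) : (0 < a)%R -> (`|t| < 1)%R ->
  \sum_(0 <= k <oo) (hyp_coef a 1 1 k.*2 * t ^+ k.*2)%:E =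
  (((1 - t) `^ (- a) + (1 + t) `^ (- a)) / 2)%:E.
Proof.
move=> a0 t1; apply: nneseries_EFin.
have tN1 : (`|- t| < 1)%R by rewrite normrN.
have cb : cvg_on 1 (hyp_coef a 1 1) by exact: cvg_on_hyp.
have c1 : pseries (hyp_coef a 1 1) t @ \oo --> ((1 - t) `^ (- a))%R.
  by rewrite -binomial_series//; exact: cb.
have c2 : pseries (hyp_coef a 1 1) (- t)%R @ \oo --> ((1 + t) `^ (- a))%R.
  have := binomial_series a (- t)%R a0 tN1; rewrite opprK => <-; exact: cb.
have c12 : (fun m => (pseries (hyp_coef a 1 1) t m + pseries (hyp_coef a 1 1) (- t) m) / 2)%R @ \oo -->
    (((1 - t) `^ (- a) + (1 + t) `^ (- a)) / 2)%R.
  by apply: cvgM; [exact: cvgD c1 c2|exact: cvg_cst].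
(* The first m even terms are the partial sum of length 2m of the averaged series, whose odd terms
   cancel; so a subsequence of its partial sums is enough. *)
have dbl : (fun m => m.*2) @ \oo --> \oo.
  move=> A [N _ NA]; exists N => // m /= Nm; apply: NA => /=.
  by rewrite (leq_trans Nm)// -addnn leq_addr.
have := cvg_comp _ _ dbl c12.
rewrite [X in X @ _ --> _ -> _](_ : _ = series (fun k => hyp_coef a 1 1 k.*2 * t ^+ k.*2)%R)//.
apply/funext => m; rewrite /pseries /series/=.
elim: m => [|m IH]; first by rewrite !big_geq// addr0 mul0r.
rewrite doubleS !(big_nat_recr m.*2.+1)//= !(big_nat_recr m.*2)//= [RHS]big_nat_recr//= -IH.
have e1 : ((- t) ^+ m.*2 = t ^+ m.*2)%R by rewrite exprNn -signr_odd odd_double mul1r.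
have e2 : ((- t) ^+ m.*2.+1 = - t ^+ m.*2.+1)%R by rewrite exprSr e1 mulrN exprSr.
by rewrite e1 e2; field.
Qed.

Variables (n : nat) (lam : R).
Hypotheses (n0 : (0 < n)%N) (lam0 : (0 < lam)%R).
Let c : R := n%:R / 2.
Hypothesis lamc : (0 < lam + 1 - c)%R.

Let c0 : (0 < c)%R. Proof. by rewrite /c divr_gt0// ltr0n. Qed.

(* The area of the unit sphere of R^m, namely 2 pi^(m/2) / Gamma(m/2). *)
Definition sphere_area (m : nat) : R := (2 * Num.sqrt pi ^+ m / fine (eGamma (m%:R / 2)))%R.

(** For lam = (n + s p) / 2 the second parameter is (s p + 2) / 2, so these are the parameters in
    [G_hyp]. *)
Definition kernel_series (t : R) : R := psum (hyp_coef lam (lam + 1 - n%:R / 2) (n%:R / 2)) t.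

(* The mean of |x - y|^(- 2 lam) over the sphere |y| = r, for |x| = a. *)
Definition kernel_mean (a r : R) : R :=
  (if r < a then a `^ (- (2 * lam)) * kernel_series ((r / a) ^+ 2)
   else r `^ (- (2 * lam)) * kernel_series ((a / r) ^+ 2))%R.

(** The kernel mean in the form that termwise integration produces: symmetric in [a] and [r], before
    the quadratic transformation with t = (r / a)^2 or (a / r)^2. *)
Let Q (a r : R) : R := ((a ^+ 2 + r ^+ 2) `^ (- lam) *
  psum (hyp_coef (lam / 2) ((lam + 1) / 2) c) (4 * (a * r) ^+ 2 / (a ^+ 2 + r ^+ 2) ^+ 2))%R.

Let hcq0 k : (0 < hyp_coef (lam / 2) ((lam + 1) / 2) c k)%R.
Proof.
have l1 : (0 < lam / 2)%R by rewrite divr_gt0.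
have l2 : (0 < (lam + 1) / 2)%R by rewrite divr_gt0// addr_gt0.
exact: hyp_coef_gt0.
Qed.

Let QC a r : Q a r = Q r a.
Proof. by rewrite /Q [(r ^+ 2 + _)%R]addrC [(r * a)%R]mulrC. Qed.

Let QE a r : (0 < a)%R -> (0 <= r)%R -> (r < a)%R ->
  Q a r = (a `^ (- (2 * lam)) * kernel_series ((r / a) ^+ 2))%R.
Proof.
move=> a0 r0 ra; have an0 : a != 0%R by rewrite gt_eqF.
have ra0 : (0 <= r / a)%R by rewrite divr_ge0// ltW.
have ra1 : (r / a < 1)%R by rewrite ltr_pdivrMr// mul1r.
rewrite /kernel_series hyp_quadratic//; last first.
  by apply/andP; split; [exact: sqr_ge0|rewrite expr_lt1].
rewrite /Q mulrA; congr (_ * psum _ _)%R.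
- rewrite mulrC -[(- (2 * lam))%R]mulrN -powR_sqr ?(ltW a0)// -powRM ?sqr_ge0//; last first.
    by rewrite addr_ge0// sqr_ge0.
  by congr (_ `^ _)%R; field.
- have h : (1 + (r / a) ^+ 2 = (a ^+ 2 + r ^+ 2) / a ^+ 2)%R by field.
  have A0 : (a ^+ 2 + r ^+ 2 != 0)%R by rewrite gt_eqF// ltr_pwDl// ?exprn_gt0// sqr_ge0.
  by rewrite h; field; rewrite A0 an0.
Qed.

Lemma kernel_meanE a r : (0 < a)%R -> (0 < r)%R -> r != a -> kernel_mean a r = Q a r.
Proof.
move=> a0 r0 ra; rewrite /kernel_mean; case: ltP => h.
  by rewrite QE// ltW.
by rewrite QC QE// ?(ltW a0)// lt_neqAle eq_sym ra.
Qed.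

Let kern (z : 'rV[R]_n) : R := eucl_norm z `^ (- (2 * lam)).

Let mkern : measurable_fun setT kern.
Proof. by apply: (measurableT_comp (measurable_powR _)); exact: measurable_eucl_norm. Qed.

Let kernB x y : (0 < eucl_norm x ^+ 2 + eucl_norm y ^+ 2)%R ->
  (`|2 * dotv x y / (eucl_norm x ^+ 2 + eucl_norm y ^+ 2)| < 1)%R ->
  kern (x - y) = ((eucl_norm x ^+ 2 + eucl_norm y ^+ 2) `^ (- lam) *
    (1 - 2 * dotv x y / (eucl_norm x ^+ 2 + eucl_norm y ^+ 2)) `^ (- lam))%R.
Proof.
set A := (_ + _)%R => A0 t1.
rewrite /kern -mulrN -powR_sqr ?eucl_norm_ge0// sqr_eucl_normB -/A -powRM ?(ltW A0)//.
  by congr (_ `^ _)%R; field; rewrite gt_eqF.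
by rewrite subr_ge0 ltW// (le_lt_trans (ler_norm _)).
Qed.

(** The factor of (x.y)^(2k) in the symmetrized kernel; [4 ^+ k] comes from (2 x.y)^(2k), and the
    division by (|x|^2 + r^2)^(2k) is a power with exponent -1. *)
Let term (x : 'rV[R]_n) (k : nat) (r : R) : R :=
  (hyp_coef lam 1 1 k.*2 * 4 ^+ k *
     ((eucl_norm x ^+ 2 + r ^+ 2) `^ (- lam) * ((eucl_norm x ^+ 2 + r ^+ 2) `^ (- 1)) ^+ k.*2))%R.

Let term_ge0 x k r : (0 <= term x k r)%R.
Proof.
have := ltW (hyp_coef_gt0 lam 1 1 k.*2 lam0 ltr01 ltr01); rewrite /term.
by move: (hyp_coef _ _ _ _) => h h0; rewrite !mulr_ge0 ?exprn_ge0 ?powR_ge0.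
Qed.

Let mterm x k : measurable_fun setT (term x k).
Proof.
have mA : measurable_fun setT (fun r : R => eucl_norm x ^+ 2 + r ^+ 2)%R.
  by apply: measurable_funD => //; exact: measurable_funX.
apply: measurable_funM => //; apply: measurable_funM.
  exact: (measurableT_comp (measurable_powR _) mA).
apply: measurable_funX; exact: (measurableT_comp (measurable_powR _) mA).
Qed.

(** |2 x.y| <= 2 |x| |y| < |x|^2 + |y|^2, the second inequality being strict because the norms
    differ. *)
Let AB_lt1 (x y : 'rV[R]_n) : eucl_norm x != eucl_norm y ->
  (0 < eucl_norm x ^+ 2 + eucl_norm y ^+ 2)%R /\
  (`|2 * dotv x y / (eucl_norm x ^+ 2 + eucl_norm y ^+ 2)| < 1)%R.
Proof.
move=> xy; have d0 : (0 < (eucl_norm x - eucl_norm y) ^+ 2)%R.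
  by rewrite lt_neqAle sqr_ge0 andbT eq_sym expf_neq0// subr_eq0.
have h1 := eucl_norm_ge0 x; have h2 := eucl_norm_ge0 y.
have A0 : (0 < eucl_norm x ^+ 2 + eucl_norm y ^+ 2)%R by nra.
split=> //; rewrite normrM normfV (gtr0_norm A0) ltr_pdivrMr// mul1r normrM ger0_norm//.
have := CauchySchwarz_dotv x y; nra.
Qed.

Let kern_sum (x y : 'rV[R]_n) : eucl_norm x != eucl_norm y ->
  ((kern (x - y) + kern (x + y)) / 2)%:E =
  \sum_(0 <= k <oo) (term x k (eucl_norm y) * dotv x y ^+ k.*2)%:E.
Proof.
move=> /[dup] xy /AB_lt1[A0 t1].
have := kernB x y A0 t1; have := kernB x (- y); rewrite opprK eucl_normN dotvNr mulrN mulNr normrN opprK.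
move=> /(_ A0 t1) -> ->.
set A := (eucl_norm x ^+ 2 + eucl_norm y ^+ 2)%R in A0 t1 *.
set t := (2 * dotv x y / A)%R in t1 *.
have := even_binomial_series lam t lam0 t1 => E.
transitivity ((A `^ (- lam))%:E * \sum_(0 <= k <oo) (hyp_coef lam 1 1 k.*2 * t ^+ k.*2)%:E).
  by rewrite E -EFinM; congr EFin; ring.
rewrite -nneseriesZl; last first.
  move=> k _; rewrite lee_fin; have := ltW (hyp_coef_gt0 lam 1 1 k.*2 lam0 ltr01 ltr01).
  by move: (hyp_coef _ _ _ _) => h h0; rewrite mulr_ge0// exprn_even_ge0'.
apply: eq_eseriesr => k _; rewrite -EFinM; congr EFin; rewrite /term -/A /t powR_inv1 ?(ltW A0)//.
have -> : ((2 * dotv x y / A) ^+ k.*2 = 4 ^+ k * dotv x y ^+ k.*2 * A^-1 ^+ k.*2)%R.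
  rewrite !exprMn; congr (_ * _ * _)%R; rewrite -mul2n exprM; congr (_ ^+ _)%R; ring.
by ring.
Qed.

(** That [f] vanishes at |x| discards the sphere |y| = |x|, where the argument of the series can
    reach 1. Elsewhere all terms are nonnegative, so sum and integral are exchanged freely. *)
Lemma integral_kernel_radial (x : 'rV[R]_n) (f : R -> R) :
  x != 0%R -> measurable_fun setT f -> (forall r, 0 <= f r)%R -> f (eucl_norm x) = 0%R ->
  \int[mu n]_y ((f (eucl_norm y))%:E * (eucl_norm (x - y) `^ (- (2 * lam)))%:E) =
  (sphere_area n)%:E * \int[leb]_(r in `]0%R, +oo[)
    ((f r)%:E * (r ^+ n.-1 * kernel_mean (eucl_norm x) r)%:E).
Proof.
move=> xn0 mf f0 fx; set a := eucl_norm x.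
have a0 : (0 < a)%R by rewrite eucl_norm_gt0.
pose g (r : R) := (f r)%:E.
have mg : measurable_fun setT g by exact: measurable_funEFin.
have g0 r : 0 <= g r by rewrite lee_fin.
have gx : g a = 0 by rewrite /g fx.
have mgy : measurable_fun setT (fun y : 'rV[R]_n => g (eucl_norm y)).
  by apply: (measurableT_comp mg); exact: measurable_eucl_norm.
have mk1 : measurable_fun setT (fun y : 'rV[R]_n => (kern (x - y))%:E).
  apply: measurable_funEFin; apply: (measurableT_comp mkern).
  have -> : (fun y : 'rV[R]_n => (x - y)%R) = (fun y => (-1) *: y + x)%R.
    by apply/funext => y; rewrite scaleN1r addrC.
  exact: measurable_rV_affine.
have mk2 : measurable_fun setT (fun y : 'rV[R]_n => (kern (x + y))%:E).
  apply: measurable_funEFin; apply: (measurableT_comp mkern).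
  rewrite [X in measurable_fun _ X](_ : _ = (fun y => 1 *: y + x)%R); last first.
    by apply/funext => y; rewrite scale1r addrC.
  exact: measurable_rV_affine.
pose f1 (y : 'rV[R]_n) := g (eucl_norm y) * (kern (x - y))%:E.
pose f2 (y : 'rV[R]_n) := g (eucl_norm y) * (kern (x + y))%:E.
have f10 y : 0 <= f1 y by rewrite mule_ge0// lee_fin powR_ge0.
have f20 y : 0 <= f2 y by rewrite mule_ge0// lee_fin powR_ge0.
have mf1 : measurable_fun setT f1 by exact: emeasurable_funM mgy mk1.
have mf2 : measurable_fun setT f2 by exact: emeasurable_funM mgy mk2.
have f12 : \int[mu n]_y f1 y = \int[mu n]_y f2 y.
  apply: etrans (ge0_integral_rVN n f2 mf2 f20); apply: eq_integral => y _.
  by rewrite /f1 /f2 eucl_normN.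
(* The radial factor is even, so the kernel may be replaced by its mean over y and -y. *)
rewrite (ge0_integral_mean _ _ (mu n) f1 f2 mf1 mf2 f10 f20 f12).
have [T [T0 mT TE sumT]] : exists T : nat -> R -> R, [/\ forall k r, (0 <= T k r)%R,
    forall k, measurable_fun setT (T k), forall k r, T k r = term x k r &
    forall y, a != eucl_norm y -> ((kern (x - y) + kern (x + y)) / 2)%:E =
      \sum_(0 <= k <oo) (T k (eucl_norm y) * dotv x y ^+ k.*2)%:E].
  by exists (term x); split; [exact: term_ge0|exact: mterm| |exact: kern_sum].
have [hc hc0 hcE] : exists2 hc : nat -> R, (forall k, (0 < hc k)%R) &
    hc = hyp_coef (lam / 2) ((lam + 1) / 2) c.
  by exists (hyp_coef (lam / 2) ((lam + 1) / 2) c); first exact: hcq0.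
pose h k (r : R) := g r * (T k r)%:E.
have h0 k r : 0 <= h k r.
  by apply: mule_ge0; [exact: g0|rewrite lee_fin; exact: T0].
have mh k : measurable_fun setT (h k).
  by apply: emeasurable_funM; [exact: mg|apply: measurable_funEFin; exact: mT].
transitivity (\int[mu n]_y \sum_(0 <= k <oo) (h k (eucl_norm y) * (dotv x y ^+ k.*2)%:E)).
  apply: eq_integral => y _; have [xy|xy] := eqVneq (eucl_norm y) a.
    have e1 : f1 y = 0 by rewrite /f1 xy gx mul0e.
    have e2 : f2 y = 0 by rewrite /f2 xy gx mul0e.
    have e3 k : h k (eucl_norm y) * (dotv x y ^+ k.*2)%:E = 0 by rewrite /h xy gx mul0e mul0e.
    by rewrite e1 e2 adde0 mule0; apply/esym/eseries0 => k _ _; exact: e3.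
  have ay : a != eucl_norm y by rewrite eq_sym.
  apply: etrans (mean_mule (g (eucl_norm y)) _ _ (powR_ge0 _ _) (powR_ge0 _ _)) _.
  rewrite (sumT _ ay) /g -nneseriesZl; last first.
    by move=> k _; rewrite lee_fin; apply: mulr_ge0; [exact: T0|exact: exprn_even_ge0'].
  by apply: eq_eseriesr => k _; rewrite /h -muleA -EFinM.
pose hd k (y : 'rV[R]_n) := h k (eucl_norm y) * (dotv x y ^+ k.*2)%:E.
have mhd k : measurable_fun setT (hd k).
  apply: emeasurable_funM.
    by apply: (measurableT_comp (mh k)); exact: measurable_eucl_norm.
  by apply: measurable_funEFin; apply: measurable_funX; exact: measurable_dotv.
have hd0 k y : setT y -> 0 <= hd k y.
  by move=> _; apply: mule_ge0; [exact: h0|rewrite lee_fin; exact: exprn_even_ge0'].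
apply: etrans (integral_nneseries (mu n) measurableT mhd hd0) _.
clear f12 mk1 mk2 f10 f20 mf1 mf2 mgy f1 f2.
have [G G0 GE] := @eGamma_half_nat R _ n0.
pose z (r : R) := (4 * (a * r) ^+ 2 * ((a ^+ 2 + r ^+ 2) `^ (- 1)) ^+ 2)%R.
have z0 r : (0 <= z r)%R.
  by apply: mulr_ge0; [apply: mulr_ge0; [|exact: sqr_ge0]|exact: sqr_ge0].
pose q k (r : R) := g r * (r ^+ n.-1 * ((a ^+ 2 + r ^+ 2) `^ (- lam) * (hc k * z r ^+ k)))%:E.
have q0 k (r : R) : (0 <= r)%R -> 0 <= q k r.
  move=> r0; apply: mule_ge0; first exact: g0.
  rewrite lee_fin; apply: mulr_ge0; first exact: exprn_ge0.
  apply: mulr_ge0; first exact: powR_ge0.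
  by apply: mulr_ge0; [exact: ltW|exact: exprn_ge0].
have mA : measurable_fun setT (fun r : R => a ^+ 2 + r ^+ 2)%R.
  by apply: measurable_funD => //; exact: measurable_funX.
have mq k : measurable_fun setT (q k).
  apply: emeasurable_funM => //; apply: measurable_funEFin.
  apply: measurable_funM; first exact: measurable_funX.
  apply: measurable_funM; first exact: (measurableT_comp (measurable_powR _) mA).
  apply: measurable_funM => //; apply: measurable_funX; apply: measurable_funM.
    by apply: measurable_funM => //; apply: measurable_funX; exact: measurable_funM.
  by apply: measurable_funX; exact: (measurableT_comp (measurable_powR _) mA).
(* Integration of the k-th term brings (1/2)_k, and (n/2)_k in the denominator from Gamma(n/2 + k).
   By the duplication formulas for (lam)_(2k) and (2k)!, the product is the coefficient [hc k] with
   halved parameters. *)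
transitivity (\sum_(0 <= k <oo) ((sphere_area n)%:E * \int[leb]_(r in `]0%R, +oo[) q k r)).
  apply: eq_eseriesr => k _; apply: etrans (ge0_integral_shell n x k n0 _ (mh k) (h0 k)) _.
  have [Gk Gk0 GkE] : exists2 r : R, (0 < r)%R & eGamma (n%:R / 2 + k%:R) = r%:E.
    by rewrite eGamma_shift// GE; exists (pochhammer c k * G)%R; rewrite ?mulr_gt0// pochhammer_gt0.
  have GkG : (Gk = pochhammer c k * G)%R.
    by apply/EFin_inj; rewrite -GkE eGamma_shift// GE EFinM.
  rewrite /sphere_area GkE GE.
  have [ph ph0 phE] : exists2 r : R, (0 < r)%R & r = pochhammer (1 / 2) k.
    by exists (pochhammer (1 / 2) k); rewrite ?pochhammer_gt0// divr_gt0.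
  have pi0 : (0 <= Num.sqrt (pi : R) ^+ n)%R by rewrite exprn_ge0// sqrtr_ge0.
  rewrite -phE /fine; apply: ge0_integralZl_eq.
  - exact: measurable_itv.
  - apply: emeasurable_funM; first by apply: measurable_funTS; exact: mh.
    by apply: measurable_funEFin; apply: measurable_funTS; exact: measurable_funX.
  - by apply: measurable_funTS; exact: mq.
  - move=> r /=; rewrite in_itv/= andbT => r0.
    by apply: mule_ge0; [exact: h0|rewrite lee_fin exprn_ge0// ltW].
  - by move=> r /=; rewrite in_itv/= andbT => r0; apply: q0; rewrite ltW.
  - by apply: divr_ge0; [apply: mulr_ge0; [apply: mulr_ge0 => //; apply: mulr_ge0 => //; exact: ltW|apply: exprn_ge0; exact: dotvv_ge0]|exact: ltW].
  - by apply: divr_ge0; [apply: mulr_ge0|exact: ltW].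
  move=> r; rewrite /= in_itv/= andbT => r0.
  rewrite /h /q ![_%:E * (g r * _)]muleCA -!muleA ![_%:E * (g r * _)]muleCA; congr (_ * _).
  rewrite -!EFinM; congr EFin.
  have A0 : (0 < a ^+ 2 + r ^+ 2)%R by rewrite ltr_pwDl ?exprn_gt0// sqr_ge0.
  have pk : (0 < pochhammer c k)%R by exact: pochhammer_gt0.
  have fk : (k`!%:R != 0 :> R)%R by rewrite pnatr_eq0 -lt0n fact_gt0.
  rewrite TE /term -/a /z hcE -sqr_eucl_norm -/a /hyp_coef !pochhammer1 fact_double pochhammerM2 -phE GkG -/c.
  rewrite (_ : (n + k.*2).-1 = (n.-1 + k.*2)%N); last by case: (n) n0.
  rewrite exprD (_ : (a * r) ^+ 2 = a ^+ 2 * r ^+ 2)%R; last by ring.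
  rewrite -!mul2n !exprM; move: (a ^+ 2 + r ^+ 2)%R => A.
  move: (a ^+ 2)%R (r ^+ 2)%R ((A `^ (-1)) ^+ 2)%R (A `^ (- lam))%R => U V W L.
  rewrite !exprMn; field.
  by rewrite fk !gt_eqF//= expf_neq0// pnatr_eq0.
rewrite nneseriesZl; last by move=> k _; apply: integral_ge0 => r /=; rewrite in_itv/= andbT => r0; rewrite q0// ltW.
congr (_ * _); rewrite -integral_nneseries//; last 2 first.
- by move=> k; apply: measurable_funTS; exact: mq.
- by move=> k r /=; rewrite in_itv/= andbT => r0; rewrite q0// ltW.
apply: eq_integral => r; rewrite inE/= in_itv/= andbT => r0.
have [ra|ra] := eqVneq r a.
  have e k : q k r = 0 by rewrite /q ra gx mul0e.
  by rewrite ra fx mul0e; apply: eseries0 => k _ _; rewrite -ra; exact: e.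
rewrite kernel_meanE// /q /g nneseriesZl; last first.
  move=> k _; rewrite lee_fin; apply: mulr_ge0; first by rewrite exprn_ge0// ltW.
  apply: mulr_ge0; first exact: powR_ge0.
  by apply: mulr_ge0; [exact: ltW|exact: exprn_ge0].
congr (_ * _).
have A0 : (0 < a ^+ 2 + r ^+ 2)%R by rewrite ltr_pwDl ?exprn_gt0// sqr_ge0.
have zE : (z r = 4 * (a * r) ^+ 2 / (a ^+ 2 + r ^+ 2) ^+ 2)%R.
  by rewrite /z powR_inv1 ?(ltW A0)// exprVn.
(* 1 - z(r) is the square of (a^2 - r^2) / (a^2 + r^2), hence positive because r differs from a. *)
have z1 : (`|z r| < 1)%R.
  rewrite ger0_norm// zE ltr_pdivrMr ?exprn_gt0// mul1r.
  have : (0 < (a ^+ 2 - r ^+ 2) ^+ 2)%R.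
    rewrite lt_neqAle sqr_ge0 andbT eq_sym expf_neq0// subr_eq0 eqrXn2 ?(ltW a0) ?(ltW r0)//.
    by rewrite eq_sym.
  by rewrite exprMn; nra.
transitivity ((r ^+ n.-1 * (a ^+ 2 + r ^+ 2) `^ (- lam))%:E * \sum_(0 <= k <oo) (hc k * z r ^+ k)%:E).
  rewrite -nneseriesZl; last by move=> k _; rewrite lee_fin mulr_ge0 ?exprn_ge0// ltW.
  by apply: eq_eseriesr => k _; rewrite -EFinM mulrA.
rewrite (nneseries_EFin _ (psum hc (z r))); last first.
  have l1 : (0 < lam / 2)%R by rewrite divr_gt0.
  have l2 : (0 < (lam + 1) / 2)%R by rewrite divr_gt0// addr_gt0.
  by rewrite hcE in z1 *; exact: (cvg_on_hyp _ _ _ l1 l2 c0).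
by rewrite /Q -zE -hcE -EFinM mulrA.
Qed.

End kernel_expansion.

(** * Inner integrals over the truncated scale-invariant region *)

Section radial_kernel.
Local Open Scope ereal_scope.
Context {R : realType}.
Local Notation leb := (@lebesgue_measure R).
Local Notation mu n := (@lebesgue_rV R n).

Lemma powR_expR (a x : R) : (0 < a)%R -> (a `^ x = expR (x * ln a))%R.
Proof. by move=> a0; rewrite /powR gt_eqF. Qed.

(** The default value 0 at 0 makes inversion the extension by 0 of a function continuous off 0. *)
Lemma measurable_invr : measurable_fun setT (@GRing.inv R).
Proof.
have oD : open [set x : R | x != 0%R] by exact: open_neq.
have mD : measurable [set x : R | x != 0%R] by exact: open_measurable.
rewrite (_ : @GRing.inv R = (fun x : R => x^-1 : R)%R \_ [set x | x != 0%R]); last first.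
  apply/funext => x; rewrite patchE; case: ifPn => //.
  by rewrite notin_setE/= => /negP; rewrite negbK => /eqP ->; rewrite invr0.
apply: ((measurable_restrictT _ mD).1 _); apply: open_continuous_measurable_fun => // x.
by rewrite inE/= => x0; exact: inv_continuous.
Qed.

Lemma ge0_integral_scale (a : R) (h : R -> \bar R) : (0 < a)%R ->
  measurable_fun setT h -> (forall r, 0 <= h r) ->
  \int[leb]_(r in `]0%R, +oo[) h r = a%:E * \int[leb]_(r in `]0%R, +oo[) h (a * r)%R.
Proof.
move=> a0 mh h0; have mD : measurable (`]0%R, +oo[%classic : set R) by exact: measurable_itv.
have mh' : measurable_fun setT (h \_ `]0%R, +oo[%classic).
  exact: ((measurable_restrictT _ mD).1 (measurable_funTS mh)).
have h'0 t : 0 <= (h \_ `]0%R, +oo[%classic) t by exact: erestrict_ge0.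
have an0 : a != 0%R by rewrite gt_eqF.
have E := ge0_integral_affine (h \_ `]0%R, +oo[%classic) a 0%R an0 mh' h'0.
rewrite [LHS]integral_mkcond [X in _ = _ * X]integral_mkcond.
have -> : \int[leb]_t ((fun r => h (a * r)%R) \_ `]0%R, +oo[%classic) t =
    \int[leb]_t (h \_ `]0%R, +oo[%classic) (a * t + 0)%R.
  apply: eq_integral => t _; rewrite !patchE addr0 !mem_setE !in_itv/= !andbT.
  by rewrite pmulr_rgt0.
by rewrite E muleA -EFinM gtr0_norm// divff// mul1e.
Qed.

Lemma integral_radial n (h : R -> \bar R) : (0 < n)%N -> measurable_fun setT h ->
  (forall r, 0 <= h r) ->
  \int[mu n]_y h (eucl_norm y) =
  (sphere_area n)%:E * \int[leb]_(r in `]0%R, +oo[) (h r * (r ^+ n.-1)%:E).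
Proof.
move=> n0 mh h0; have := ge0_integral_shell n 0 0 n0 h mh h0.
rewrite /pochhammer big_ord0 addn0 addr0 !mulr1 => <-.
by apply: eq_integral => y _; rewrite expr0 mule1.
Qed.

Lemma integral_itv0yW (g : R -> \bar R) : (forall r, (1 <= r)%R -> g r = 0) ->
  \int[leb]_(r in `]0%R, +oo[) g r = \int[leb]_(r in `]0%R, 1%R[) g r.
Proof.
move=> g1; rewrite [LHS]integral_mkcond [RHS]integral_mkcond; apply: eq_integral => r _.
rewrite !patchE !mem_setE !in_itv/= andbT; case: (ltP r 1%R) => r1; first by rewrite andbT.
by rewrite andbF g1//; case: ifP.
Qed.

Lemma integral_itv0yN (g : R -> \bar R) : (forall r, (r <= 1)%R -> g r = 0) ->
  \int[leb]_(r in `]0%R, +oo[) g r = \int[leb]_(r in `]1%R, +oo[) g r.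
Proof.
move=> g1; rewrite [LHS]integral_mkcond [RHS]integral_mkcond; apply: eq_integral => r _.
rewrite !patchE !mem_setE !in_itv/= !andbT; case: (ltP 1%R r) => r1; first by rewrite (lt_trans _ r1).
by rewrite g1//; case: ifP.
Qed.

Variables (n : nat) (s p kap : R) (U : R -> R).
Hypotheses (n0 : (0 < n)%N) (s0 : (0 < s)%R) (p0 : (0 < p)%R).
Hypothesis mU : measurable_fun setT U.

(** The size of Psi_p(U(r) - U(q)); its sign is treated apart, through the monotonicity of U. *)
Definition osc (r q : R) : R := (`|U r - U q| `^ (p - 1))%R.

Hypothesis oscH : forall t r q : R, (0 < t)%R -> (0 < r)%R -> (0 < q)%R ->
  osc (t * r) (t * q) = (t `^ kap * osc r q)%R.

Lemma oscC r q : osc r q = osc q r.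
Proof. by rewrite /osc distrC. Qed.

(** The condition r > 0 excludes the origin, where U only has a default value and homogeneity is not
    assumed. *)
Definition trunc (th a r : R) : R := if ((0 < r) && (r <= th * a))%R then osc a r else 0%R.

Lemma trunc_ge0 th a r : (0 <= trunc th a r)%R.
Proof. by rewrite /trunc; case: ifP => // _; exact: powR_ge0. Qed.

Lemma truncZ th t a r : (0 < t)%R -> (0 < a)%R -> 
  trunc th (t * a) (t * r) = (t `^ kap * trunc th a r)%R.
Proof.
move=> t0 a0; rewrite /trunc pmulr_rgt0// mulrCA ler_pM2l//.
by case: ifP => [/andP[r0 _]|]; rewrite ?mulr0// oscH.
Qed.

Lemma measurable_trunc th : measurable_fun setT (fun z : R * R => trunc th z.1 z.2).
Proof.
apply: measurable_fun_ifT => //.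
- apply: measurable_and; first exact: measurable_fun_ltr.
  apply: measurable_fun_ler => //; exact: measurable_funM.
- apply: (measurableT_comp (measurable_powR _)); apply: measurableT_comp => //.
  by apply: measurable_funB; exact: (measurableT_comp mU).
Qed.

Lemma measurable_trunc_r th a : measurable_fun setT (trunc th a).
Proof. exact: (measurableT_comp (measurable_trunc th) (measurable_pair1 a)). Qed.

Lemma measurable_trunc_l th r : measurable_fun setT (fun a => trunc th a r).
Proof. exact: (measurableT_comp (measurable_trunc th) (measurable_pair2 r)). Qed.

Lemma trunc_le0 th a r : (r <= 0)%R -> trunc th a r = 0%R.
Proof. by move=> r0; rewrite /trunc ltNge r0. Qed.

Lemma trunc_ge th a r : (0 < th < 1)%R -> (a <= r)%R -> trunc th a r = 0%R.
Proof.
move=> /andP[th0 th1] ar; rewrite /trunc; case: ifP => // /andP[r0 h].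
suff : (r < r)%R by rewrite ltxx.
have [a0|a0] := leP a 0%R; last by apply: (le_lt_trans h); apply: lt_le_trans ar; rewrite gtr_pMl.
by apply: (le_lt_trans h); apply: le_lt_trans r0; rewrite pmulr_rle0.
Qed.

Let lam : R := ((n%:R + s * p) / 2)%R.
Let sp0 : (0 < s * p)%R. Proof. exact: mulr_gt0. Qed.
Let lam0 : (0 < lam)%R. Proof. by rewrite divr_gt0// ltr_wpDl// ler0n. Qed.
Let lamc : (0 < lam + 1 - n%:R / 2)%R.
Proof. by rewrite /lam; move: sp0 => ?; lra. Qed.

(* Cut off where the series diverges and [limn] is a junk value. *)
Definition kernel_profile (r : R) : R :=
  if (`|r| < 1)%R then kernel_series n ((n%:R + s * p) / 2) (r ^+ 2) else 0%R.

Let n20 : (0 < n%:R / 2 :> R)%R. Proof. by rewrite divr_gt0// ltr0n. Qed.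

Lemma kernel_series_ge0 t : (0 <= t < 1)%R -> (0 <= kernel_series n lam t)%R.
Proof.
move=> /andP[t0 t1]; apply: limr_ge.
  by apply: (cvg_on_hyp _ _ _ lam0 lamc n20); rewrite ger0_norm.
apply: nearW => k; apply: sumr_ge0 => i _; apply: mulr_ge0; last exact: exprn_ge0.
by apply: ltW; exact: hyp_coef_gt0.
Qed.

Lemma kernel_profile_ge0 r : (0 <= kernel_profile r)%R.
Proof.
rewrite /kernel_profile; case: ifP => // r1; apply: kernel_series_ge0.
by rewrite sqr_ge0 -real_normK ?num_real// expr_lt1.
Qed.

Lemma measurable_kernel_profile : measurable_fun setT kernel_profile.
Proof.
have mD : measurable (`](-1)%R, 1%R[%classic : set R) by exact: measurable_itv.
rewrite (_ : kernel_profile = (fun r => kernel_series n lam (r ^+ 2)) \_ `](-1)%R, 1%R[%classic); last first.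
  by apply/funext => r; rewrite /kernel_profile patchE mem_setE in_itv/= ltr_norml.
apply: ((measurable_restrictT _ mD).1 _); apply: open_continuous_measurable_fun.
  exact: interval_open.
move=> r; rewrite inE/= in_itv/= -ltr_norml => r1.
apply: (@continuous_comp _ _ _ (fun r : R => r ^+ 2)%R (kernel_series n lam)).
  exact: exprn_continuous.
have r2 : (`|r ^+ 2| < 1)%R by rewrite normrX expr_lt1.
exact: is_derive_continuous (is_derive_psum _ _ _ (cvg_on_hyp _ _ _ lam0 lamc n20) r2).
Qed.

(** What remains of the phi(x) part once |y| = rho |x| and the powers of |x| are taken out. *)
Definition in_mass (th : R) : \bar R := \int[leb]_(r in `]0%R, 1%R[)
  (trunc th 1 r * (r ^+ n.-1 * kernel_profile r))%:E.

(** The same for the phi(y) part, with |x| = |y| / rho. The exponent collects rho^(-kap) from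
    homogeneity, rho^(1 + s p) from the kernel together with the radial factor r^(n-1), and rho^(-2)
    from the inversion. *)
Definition out_mass (th : R) : \bar R := \int[leb]_(r in `]0%R, 1%R[)
  (trunc th 1 r * (r `^ (s * p - kap - 1) * kernel_profile r))%:E.

Let nE : (n%:R = n.-1%:R + 1 :> R)%R. Proof. by rewrite natr1 prednK. Qed.

Lemma integral_inner (th : R) (x : 'rV[R]_n) : (0 < th)%R -> (th < 1)%R -> x != 0%R ->
  \int[mu n]_y (trunc th (eucl_norm x) (eucl_norm y)
    * eucl_norm (x - y) `^ (- (n%:R + s * p)))%:E =
  (sphere_area n * eucl_norm x `^ (kap - s * p))%:E * in_mass th.
Proof.
move=> th0 th1 xn0; set a := eucl_norm x.
have a0 : (0 < a)%R by rewrite eucl_norm_gt0.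
have th01 : (0 < th < 1)%R by rewrite th0.
have fa : trunc th a a = 0%R by exact: trunc_ge.
have l2 : (2 * lam = n%:R + s * p)%R by rewrite /lam; field.
transitivity (\int[mu n]_y ((trunc th a (eucl_norm y))%:E *
    (eucl_norm (x - y) `^ (- (2 * lam)))%:E)); first by rewrite l2.
apply: etrans (integral_kernel_radial n lam n0 lam0 lamc x (trunc th a) xn0
  (measurable_trunc_r th a) (trunc_ge0 th a) fa) _.
rewrite -/a (EFinM (sphere_area n)) -muleA; congr (_ * _).
pose h (r : R) := (trunc th a r * (r ^+ n.-1 * (a `^ (- (2 * lam)) * kernel_profile (r / a))))%:E.
have mprof : measurable_fun setT (fun r : R => kernel_profile (r / a)).
  by apply: (measurableT_comp measurable_kernel_profile); exact: measurable_funM.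
have mh : measurable_fun setT h.
  apply: measurable_funEFin; apply: measurable_funM; first exact: measurable_trunc_r.
  apply: measurable_funM; first exact: measurable_funX.
  by apply: measurable_funM.
have h0 r : 0 <= h r.
  rewrite lee_fin; have [r0|r0] := leP r 0%R; first by rewrite trunc_le0// mul0r.
  apply: mulr_ge0; first exact: trunc_ge0.
  apply: mulr_ge0; first by rewrite exprn_ge0// ltW.
  by apply: mulr_ge0; [exact: powR_ge0|exact: kernel_profile_ge0].
transitivity (\int[leb]_(r in `]0%R, +oo[) h r).
  apply: eq_integral => r; rewrite inE/= in_itv/= andbT => r0; rewrite -EFinM /h.
  have [ra|ra] := ltP r a; last by rewrite trunc_ge// !mul0r.
  rewrite /kernel_mean ra /kernel_profile ger0_norm ?divr_ge0 ?ltW//.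
  by rewrite ltr_pdivrMr// mul1r ra.
rewrite (ge0_integral_scale a h a0 mh h0) integral_itv0yW; last first.
  by move=> r r1; rewrite /h trunc_ge ?mul0r// ler_pMr.
rewrite /in_mass; apply: ge0_integralZl_eq.
- exact: measurable_itv.
- apply: measurable_funTS; apply: (measurableT_comp mh); exact: measurable_funM.
- apply: measurable_funTS; apply: measurable_funEFin; apply: measurable_funM; first exact: measurable_trunc_r.
  apply: measurable_funM; first exact: measurable_funX.
  exact: measurable_kernel_profile.
- by move=> r _; exact: h0.
- move=> r /=; rewrite in_itv/= => /andP[r0 _]; rewrite lee_fin.
  apply: mulr_ge0; first exact: trunc_ge0.
  by apply: mulr_ge0; [rewrite exprn_ge0// ltW|exact: kernel_profile_ge0].
- exact: ltW.
- exact: powR_ge0.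
move=> r /=; rewrite in_itv/= => /andP[r0 r1]; rewrite -!EFinM; congr EFin.
rewrite (_ : trunc th a (a * r) = a `^ kap * trunc th 1 r)%R; last by rewrite -truncZ// mulr1.
rewrite exprMn (_ : a * r / a = r)%R ?l2; last by rewrite mulrAC divff ?mul1r ?gt_eqF.
have -> : (a `^ (kap - s * p) = a * a `^ kap * a ^+ n.-1 * a `^ (- (n%:R + s * p)))%R.
  rewrite -powR_mulrn ?(ltW a0)// -[X in (X * _ * _ * _)%R]powRr1 ?(ltW a0)// !powR_expR// -!expRD -!mulrDl.
  apply: (congr1 (fun t => expR (t * ln a))%R); rewrite nE; move: (n.-1%:R : R)%R => m; clear; ring.
by ring.
Qed.

Lemma integral_outer (th : R) (y : 'rV[R]_n) : (0 < th)%R -> (th < 1)%R -> y != 0%R ->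
  \int[mu n]_x (trunc th (eucl_norm x) (eucl_norm y)
    * eucl_norm (x - y) `^ (- (n%:R + s * p)))%:E =
  (sphere_area n * eucl_norm y `^ (kap - s * p))%:E * out_mass th.
Proof.
move=> th0 th1 yn0; set a := eucl_norm y.
have a0 : (0 < a)%R by rewrite eucl_norm_gt0.
have th01 : (0 < th < 1)%R by rewrite th0.
have fa : trunc th a a = 0%R by exact: trunc_ge.
have l2 : (2 * lam = n%:R + s * p)%R by rewrite /lam; field.
have f0 r : (0 <= trunc th r a)%R by exact: trunc_ge0.
transitivity (\int[mu n]_x ((trunc th (eucl_norm x) a)%:E *
    (eucl_norm (y - x) `^ (- (2 * lam)))%:E)).
  by rewrite l2; apply: eq_integral => x _; rewrite eucl_norm_distC.
apply: etrans (integral_kernel_radial n lam n0 lam0 lamc y (fun r => trunc th r a) yn0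
  (measurable_trunc_l th a) f0 fa) _.
rewrite -/a (EFinM (sphere_area n)) -muleA; congr (_ * _).
pose h (r : R) := (trunc th r a * (r `^ (- (1 + s * p)) * kernel_profile (a / r)))%:E.
have mprof : measurable_fun setT (fun r : R => kernel_profile (a / r)).
  apply: (measurableT_comp measurable_kernel_profile); apply: measurable_funM => //.
  exact: measurable_invr.
have mh : measurable_fun setT h.
  apply: measurable_funEFin; apply: measurable_funM; first exact: measurable_trunc_l.
  by apply: measurable_funM => //; exact: measurable_powR.
have h0 r : 0 <= h r.
  rewrite lee_fin; apply: mulr_ge0; first exact: trunc_ge0.
  by apply: mulr_ge0; [exact: powR_ge0|exact: kernel_profile_ge0].
transitivity (\int[leb]_(r in `]0%R, +oo[) h r).
  apply: eq_integral => r; rewrite inE/= in_itv/= andbT => r0; rewrite -EFinM /h.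
  have [ra|ra] := ltP a r; last by rewrite trunc_ge// !mul0r.
  rewrite /kernel_mean ltNge (ltW ra)/= /kernel_profile ger0_norm ?divr_ge0 ?ltW//.
  rewrite ltr_pdivrMr// mul1r ra mulrA; congr (_ * (_ * _))%:E.
  rewrite -powR_mulrn ?(ltW r0)// !powR_expR// -expRD -mulrDl l2 nE.
  by apply: (congr1 (fun t => expR (t * ln r))%R); move: (n.-1%:R : R)%R => m; clear; ring.
rewrite (ge0_integral_scale a h a0 mh h0) integral_itv0yN; last first.
  by move=> r r1; rewrite /h trunc_ge ?mul0r// ler_piMr// ltW.
have mha : measurable_fun setT (fun r => h (a * r)%R).
  by apply: (measurableT_comp mh); exact: measurable_funM.
(* Passes from the ratio |x| / |y| > 1 to its inverse in (0, 1), the variable of [in_mass]. *)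
rewrite ge0_integral_inv//.
rewrite /out_mass; apply: ge0_integralZl_eq.
- exact: measurable_itv.
- apply: measurable_funTS; apply: emeasurable_funM; last by apply: measurable_funEFin; exact: measurable_powR.
  by apply: (measurableT_comp mha); exact: measurable_invr.
- apply: measurable_funTS; apply: measurable_funEFin; apply: measurable_funM; first exact: measurable_trunc_r.
  apply: measurable_funM; first exact: measurable_powR.
  exact: measurable_kernel_profile.
- by move=> r _; rewrite mule_ge0// lee_fin powR_ge0.
- move=> r _; rewrite lee_fin.
  apply: mulr_ge0; first exact: trunc_ge0.
  by apply: mulr_ge0; [exact: powR_ge0|exact: kernel_profile_ge0].
- exact: ltW.
- exact: powR_ge0.
move=> r /=; rewrite in_itv/= => /andP[r0 r1]; rewrite -!EFinM; congr EFin.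
have -> : (trunc th (a / r) a = (a / r) `^ kap * trunc th 1 r)%R.
  have ar0 : (0 < a / r)%R by exact: divr_gt0.
  by rewrite -truncZ// mulr1 divfK// gt_eqF.
rewrite (_ : a / (a / r) = r)%R; last by rewrite invf_div mulrCA divff ?mulr1 ?gt_eqF.
have -> : (a `^ (kap - s * p) * (trunc th 1 r * (r `^ (s * p - kap - 1) * kernel_profile r)) =
  trunc th 1 r * kernel_profile r * (a `^ (kap - s * p) * r `^ (s * p - kap - 1)))%R by ring.
have -> : (a `^ (kap - s * p) * r `^ (s * p - kap - 1) =
  a * (a / r) `^ kap * (a / r) `^ (- (1 + s * p)) * r `^ (- 2))%R.
  have e : (ln (a / r) = ln a - ln r)%R by rewrite lnM ?posrE ?invr_gt0// lnV ?posrE.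
  rewrite -[X in (X * _ * _ * _)%R]powRr1 ?(ltW a0)// !powR_expR ?divr_gt0// -!expRD e.
  by congr expR; ring.
by ring.
Qed.

End radial_kernel.

(** * Integrable majorants near the diagonal and at infinity *)

Section radial_estimates.
Local Open Scope ereal_scope.
Context {R : realType}.
Local Notation leb := (@lebesgue_measure R).
Local Notation mu n := (@lebesgue_rV R n).

Lemma powRD_gt0 (a x y : R) : (0 < a)%R -> (a `^ x * a `^ y = a `^ (x + y))%R.
Proof. by move=> a0; rewrite !powR_expR// -expRD mulrDl. Qed.

Lemma sphere_area_gt0 n : (0 < n)%N -> (0 < @sphere_area R n)%R.
Proof.
move=> n0; have [G G0 GE] := @eGamma_half_nat R _ n0; rewrite /sphere_area GE/=.
by rewrite divr_gt0// mulr_gt0// exprn_gt0// sqrtr_gt0 pi_gt0.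
Qed.

Lemma radial_lty n (h : R -> R) (d1 d2 C : R) : (0 < n)%N ->
  measurable_fun setT h -> (forall r, 0 <= h r)%R -> (0 < d1)%R -> (0 < d2)%R ->
  (forall r, 0 < r -> r <= 1 -> h r <= C * r `^ (d1 - n%:R))%R ->
  (forall r, 1 < r -> h r <= C * r `^ (- d2 - n%:R))%R ->
  \int[mu n]_y (h (eucl_norm y))%:E < +oo.
Proof.
move=> n0 mh h0 d10 d20 h1 h2; have mEh : measurable_fun setT (fun r => (h r)%:E) by exact: measurable_funEFin.
have C0 : (0 <= C)%R.
  by have := h1 1%R ltr01 (lexx _); rewrite powR1 mulr1; apply: le_trans.
rewrite (integral_radial n (fun r => (h r)%:E))//.
rewrite lte_mul_pinfty ?lee_fin ?(ltW (sphere_area_gt0 _ n0))//.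
have mhr : measurable_fun setT (fun r : R => (h r)%:E * (r ^+ n.-1)%:E).
  by apply: emeasurable_funM => //; apply: measurable_funEFin; exact: measurable_funX.
have -> : (`]0%R, +oo[ = `]0%R, 1%R] `|` `]1%R, +oo[ :> set R)%classic.
  apply/seteqP; split => r /=; rewrite !in_itv/= ?andbT.
    by move=> r0; have [r1|r1] := leP r 1%R; [left; rewrite r0|right].
  by move=> [/andP[]//|]; exact: lt_trans.
have hr0 (r : R) : (0 < r)%R -> 0 <= (h r)%:E * (r ^+ n.-1)%:E.
  by move=> r0; rewrite mule_ge0 ?lee_fin// exprn_ge0// ltW.
have nE : (n%:R = n.-1%:R + 1 :> R)%R by rewrite natr1 prednK.
have rn (r d : R) : (0 < r)%R -> (r `^ (d - n%:R) * r ^+ n.-1 = r `^ (d - 1))%R.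
  move=> r0; rewrite -powR_mulrn ?(ltW r0)// !powR_expR// -expRD -mulrDl nE.
  by apply: (congr1 (fun t => expR (t * ln r))%R); move: (n.-1%:R : R)%R => m; clear; ring.
rewrite ge0_integral_setU//=; last 3 first.
- exact: measurable_funTS.
- move=> r /=; rewrite !in_itv/= andbT => -[/andP[r0 _]|r1]; first exact: hr0.
  by apply: hr0; exact: lt_trans r1.
- apply/disj_setPS => r [/=]; rewrite !in_itv/= andbT => /andP[_ r1].
  by rewrite ltNge r1.
apply: lte_add_pinfty.
- apply: (@le_lt_trans _ _ (\int[leb]_(r in `]0%R, 1%R]) (C%:E * (r `^ (d1 - 1))%:E))).
    apply: ge0_le_integral.
    + exact: measurable_itv.
    + by move=> r /=; rewrite in_itv/= => /andP[r0 _]; exact: hr0.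
    + exact: measurable_funTS.
    + by apply: measurable_funTS; apply: emeasurable_funM => //; apply: measurable_funEFin; exact: measurable_powR.
    + move=> r /=; rewrite in_itv/= => /andP[r0 r1]; rewrite -!EFinM lee_fin.
      by rewrite -(rn _ _ r0) mulrA ler_wpM2r ?exprn_ge0 ?(ltW r0)// h1.
  rewrite ge0_integralZl//; last 2 first.
  + by apply: measurable_funTS; apply: measurable_funEFin; exact: measurable_powR.
  + by move=> r _; rewrite lee_fin powR_ge0.
  rewrite -integral_itv_bndo_bndc; last first.
    by apply: measurable_funTS; apply: measurable_funEFin; exact: measurable_powR.
  by rewrite integral_powR0// -EFinM ltry.
- apply: (@le_lt_trans _ _ (\int[leb]_(r in `]1%R, +oo[) (C%:E * (r `^ (- d2 - 1))%:E))).
    apply: ge0_le_integral.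
    + exact: measurable_itv.
    + by move=> r /=; rewrite in_itv/= andbT => r1; apply: hr0; exact: lt_trans r1.
    + exact: measurable_funTS.
    + by apply: measurable_funTS; apply: emeasurable_funM => //; apply: measurable_funEFin; exact: measurable_powR.
    + move=> r /=; rewrite in_itv/= andbT => r1; rewrite -!EFinM lee_fin.
      have r0 : (0 < r)%R by exact: lt_trans r1.
      by rewrite -(rn _ _ r0) mulrA ler_wpM2r ?exprn_ge0 ?(ltW r0)// h2.
  rewrite ge0_integralZl//; last 2 first.
  + by apply: measurable_funTS; apply: measurable_funEFin; exact: measurable_powR.
  + by move=> r _; rewrite lee_fin powR_ge0.
  by rewrite integral_powRy// -EFinM ltry.
Qed.

(** With d = p - s p > 0 this is |x - y|^p / |x - y|^(n + s p) close to the diagonal, the result of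
    Lipschitz bounds. *)
Definition near_kernel (rho d : R) (n : nat) (r : R) : R :=
  if (r <= rho)%R then (r `^ (d - n%:R))%R else 0%R.

Lemma near_kernel_ge0 rho d n r : (0 <= near_kernel rho d n r)%R.
Proof. by rewrite /near_kernel; case: ifP => // _; exact: powR_ge0. Qed.

Lemma measurable_near_kernel rho d n : measurable_fun setT (near_kernel rho d n).
Proof.
apply: measurable_fun_ifT; [exact: measurable_fun_ler|exact: measurable_powR|].
exact: measurable_cst.
Qed.

Lemma near_kernel_lty rho d n : (0 < n)%N -> (0 < d)%R ->
  \int[mu n]_y (near_kernel rho d n (eucl_norm y))%:E < +oo.
Proof.
(* For 1 < r <= rho one has r^(d - n) <= |rho|^(d + 1) r^(-1 - n); this dictates the constant and
   the decay exponent 1. *)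
move=> n0 d0; apply: (radial_lty n _ d 1%R (1 + `|rho| `^ (d + 1))%R) => //.
- exact: measurable_near_kernel.
- exact: near_kernel_ge0.
- move=> r r0 r1; rewrite /near_kernel; case: ifP => _.
    by rewrite ler_peMl ?powR_ge0// lerDl powR_ge0.
  by rewrite mulr_ge0 ?powR_ge0// addr_ge0// powR_ge0.
- move=> r r1; have r0 : (0 < r)%R by exact: lt_trans r1.
  rewrite /near_kernel; case: ifP => [rr|_]; last first.
    by rewrite mulr_ge0 ?powR_ge0// addr_ge0// powR_ge0.
  have -> : (r `^ (d - n%:R) = r `^ (d + 1) * r `^ (- 1 - n%:R))%R.
    by rewrite powRD_gt0//; congr powR; move: (n%:R : R)%R => m; clear; ring.
  rewrite ler_wpM2r ?powR_ge0//; apply: ler_wpDl => //.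
  apply: ge0_ler_powR; rewrite ?nnegrE ?(ltW r0) ?addr_ge0 ?(ltW d0)//.
  exact: le_trans rr (ler_norm _).
Qed.

Lemma near_kernel_shift rho d n (x : 'rV[R]_n) :
  \int[mu n]_y (near_kernel rho d n (eucl_norm (x - y)))%:E =
  \int[mu n]_y (near_kernel rho d n (eucl_norm y))%:E.
Proof.
have mk : measurable_fun setT (fun y : 'rV[R]_n => (near_kernel rho d n (eucl_norm y))%:E).
  apply: measurable_funEFin; apply: (measurableT_comp (measurable_near_kernel _ _ _)).
  exact: measurable_eucl_norm.
have k0 (y : 'rV[R]_n) : 0 <= (near_kernel rho d n (eucl_norm y))%:E.
  by rewrite lee_fin near_kernel_ge0.
rewrite -[RHS](ge0_integral_rVshift n _ (- x) mk k0).
by apply: eq_integral => y _; rewrite eucl_norm_distC.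
Qed.

Lemma near_kernel_fin rho d n : (0 < n)%N -> (0 < d)%R -> exists2 K : R, (0 <= K)%R &
  forall x : 'rV[R]_n, \int[mu n]_y (near_kernel rho d n (eucl_norm (x - y)))%:E = K%:E.
Proof.
move=> n0 d0; have := near_kernel_lty rho d n n0 d0.
have : 0 <= \int[mu n]_y (near_kernel rho d n (eucl_norm y))%:E.
  by apply: integral_ge0 => y _; rewrite lee_fin near_kernel_ge0.
case E : integral => [K| |] // K0 _; exists K; first by rewrite -lee_fin.
by move=> x; rewrite near_kernel_shift.
Qed.

Lemma measurable_ball_ind n (rho : R) : measurable_fun setT
  (fun x : 'rV[R]_n => (eucl_norm x <= rho)%R%:R : R).
Proof.
rewrite [X in measurable_fun _ X](_ : _ = fun x => if (eucl_norm x <= rho)%R then 1%R else 0%R); last first.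
  by apply/funext => x; case: (_ <= _)%R.
by apply: measurable_fun_ifT => //; apply: measurable_fun_ler => //; exact: measurable_eucl_norm.
Qed.

(** For d = n the near kernel is the indicator of the ball, at least for nonnegative radii. *)
Lemma ball_lty rho n : (0 < n)%N ->
  \int[mu n]_y ((eucl_norm y <= rho)%R%:R%:E : \bar R) < +oo.
Proof.
move=> n0; have d0 : (0 < n%:R :> R)%R by rewrite ltr0n.
have := near_kernel_lty rho _ _ n0 d0; congr (_ < _); apply: eq_integral => y _.
rewrite /near_kernel subrr; case: ifP => _ //.
by rewrite powRr0.
Qed.

(** Growth r^(-g1) at 0 and r^g2 at infinity, divided by the kernel seen from a bounded set; e = s p
    in use. *)
Definition tail_weight (e : R) (n : nat) (g1 g2 r : R) : R :=
  ((1 + `|r| `^ (- g1) + `|r| `^ g2) / (1 + `|r|) `^ (n%:R + e))%R.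

Lemma tail_weight_ge0 e n g1 g2 r : (0 <= tail_weight e n g1 g2 r)%R.
Proof. by rewrite /tail_weight divr_ge0 ?powR_ge0// !addr_ge0 ?powR_ge0. Qed.

Lemma measurable_tail_weight e n g1 g2 : measurable_fun setT (tail_weight e n g1 g2).
Proof.
have mp (q : R) : measurable_fun setT (fun r : R => `|r| `^ q)%R.
  by apply: (measurableT_comp (measurable_powR _)); exact: normr_measurable.
apply: measurable_funM; first by apply: measurable_funD => //; apply: measurable_funD.
apply: (measurableT_comp measurable_invr); apply: (measurableT_comp (measurable_powR _)).
by apply: measurable_funD => //; exact: normr_measurable.
Qed.

Lemma tail_weight_lty e n g1 g2 : (0 < n)%N -> (0 <= g1)%R -> (g1 < n%:R)%R ->
  (0 <= g2)%R -> (g2 < e)%R ->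
  \int[mu n]_y (tail_weight e n g1 g2 (eucl_norm y))%:E < +oo.
Proof.
move=> n0 g10 g1n g20 g2e.
have e0 : (0 < e)%R by exact: le_lt_trans g2e.
apply: (radial_lty n _ (n%:R - g1) (e - g2) 3%R) => //.
- exact: measurable_tail_weight.
- by move=> r; exact: tail_weight_ge0.
- by rewrite subr_gt0.
- by rewrite subr_gt0.
- move=> r r0 r1; rewrite /tail_weight (ger0_norm (ltW r0)).
  have p1 : (1 <= (1 + r) `^ (n%:R + e))%R.
    by rewrite -[X in (X <= _)%R](powRr0 (1 + r)%R) ler_powR// ?lerDl ?addr_ge0// ltW.
  rewrite ler_pdivrMr; last exact: lt_le_trans ltr01 p1.
  have -> : (n%:R - g1 - n%:R = - g1)%R by ring.
  have q1 : (1 <= r `^ (- g1))%R.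
    by rewrite -(powRr0 r) ger_powR// ?r0// oppr_le0.
  have q2 : (r `^ g2 <= 1)%R by rewrite -(powRr0 r) ger_powR// r0.
  by have := powR_ge0 r (- g1); nra.
- move=> r r1; have r0 : (0 < r)%R by exact: lt_trans r1.
  rewrite /tail_weight (ger0_norm (ltW r0)).
  have p1 : (r `^ (n%:R + e) <= (1 + r) `^ (n%:R + e))%R.
    apply: ge0_ler_powR; rewrite ?nnegrE ?addr_ge0 ?(ltW r0) ?ler0n ?(ltW e0)//.
    by rewrite lerDr.
  rewrite ler_pdivrMr ?powR_gt0 ?addr_gt0//.
  have q1 : (r `^ (- g1) <= 1)%R.
    by rewrite -(powRr0 r) ler_powR ?(ltW r1)// oppr_le0.
  have q2 : (1 <= r `^ g2)%R by rewrite -{1}(powRr0 r) ler_powR ?(ltW r1).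
  have -> : (- (e - g2) - n%:R = g2 - (n%:R + e))%R by ring.
  have E : (r `^ (g2 - (n%:R + e)) * r `^ (n%:R + e) = r `^ g2)%R.
    by rewrite powRD_gt0// subrK.
  have := powR_ge0 r (g2 - (n%:R + e)).
  move: (r `^ (- g1))%R q1 (r `^ g2)%R q2 E ((1 + r) `^ _)%R p1 => a q1 b q2.
  move: (r `^ _)%R (r `^ _)%R => u v E w p1 u0.
  by rewrite -E in q2 *; nra.
Qed.

End radial_estimates.

(** * Exchanging the two variables *)

Section swap.
Local Open Scope ereal_scope.
Context d (T : measurableType d) (R : realType) (m : {sigma_finite_measure set T -> \bar R}).
Implicit Types f : T * T -> \bar R.

Lemma ge0_integral_swap f : measurable_fun setT f -> (forall z, 0 <= f z) ->
  \int[m \x m]_z f (z.2, z.1) = \int[m \x m]_z f z.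
Proof.
move=> mf f0; rewrite [RHS]fubini_tonelli1// fubini_tonelli2//.
by apply: (measurableT_comp mf); exact: measurable_swap.
Qed.

Lemma integrable_swap f : (m \x m).-integrable setT f ->
  (m \x m).-integrable setT (fun z => f (z.2, z.1)).
Proof.
move=> /integrableP[mf fi]; apply/integrableP; split.
  by apply: (measurableT_comp mf); exact: measurable_swap.
rewrite (ge0_integral_swap (fun z => `|f z|))//; exact: measurableT_comp.
Qed.

Lemma integral_swap f : (m \x m).-integrable setT f ->
  \int[m \x m]_z f (z.2, z.1) = \int[m \x m]_z f z.
Proof.
move=> fi; rewrite -(integral12_prod_meas1 fi) -(integral21_prod_meas1 (integrable_swap _ fi)).
by [].
Qed.

End swap.

(** * Absolute integrability of the weak form for radial functions *)

Section domination.
Context {R : realType}.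
Local Notation mu n := (@lebesgue_rV R n).

Lemma normr_Psi (p t : R) : 1 < p -> `|Psi p t| = `|t| `^ (p - 1).
Proof.
move=> p1; rewrite /Psi normrM ger0_norm ?powR_ge0//.
have [->|t0] := eqVneq t 0; first by rewrite normr0 mulr0 powR0// gt_eqF// subr_gt0.
have t1 : 0 < `|t| by rewrite normr_gt0.
rewrite -[X in _ * X]powRr1 ?normr_ge0// powRD_gt0//; congr powR; ring.
Qed.

Lemma powR_le (q x y : R) : 0 <= q -> 0 <= x -> x <= y -> x `^ q <= y `^ q.
Proof. by move=> q0 x0 xy; apply: ge0_ler_powR; rewrite ?nnegrE// (le_trans x0). Qed.

Lemma powR_anti (q x y : R) : q <= 0 -> 0 < x -> x <= y -> y `^ q <= x `^ q.
Proof.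
move=> q0 x0 xy; have y0 := lt_le_trans x0 xy; rewrite -[q]opprK 2!(powRN _ (- q)).
by rewrite lef_pV2 ?posrE ?powR_gt0//; apply: powR_le; rewrite ?oppr_ge0// ltW.
Qed.

Lemma powR_le_ends (a b x q : R) : 0 < a -> a <= x <= b -> x `^ q <= a `^ q + b `^ q.
Proof.
move=> a0 /andP[ax xb]; have [q0|/ltW q0] := leP 0 q.
  by rewrite -[leLHS]add0r lerD ?powR_ge0// powR_le// ltW// (lt_le_trans a0).
by rewrite -[leLHS]addr0 lerD ?powR_ge0// powR_anti.
Qed.

Lemma mulr_sqr1 (c x : R) : c ^+ 2 = 1 -> 0 <= c * x -> c * x = `|x|.
Proof.
move=> c2 cx; have c1 : `|c| = 1 by apply/eqP; rewrite -sqrp_eq1// -normrX c2 normr1.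
by rewrite -[LHS]ger0_norm// normrM c1 mul1r.
Qed.

Lemma PsiN (p t : R) : Psi p (- t) = - Psi p t.
Proof. by rewrite /Psi normrN mulrN. Qed.

Lemma powR_addr_le (q x y : R) : 0 <= q -> 0 <= x -> 0 <= y ->
  (x + y) `^ q <= 2 `^ q * (x `^ q + y `^ q).
Proof.
move=> q0; wlog xy : x y / x <= y => [hw|] x0 y0.
  have [xy|/ltW xy] := leP x y; first exact: hw.
  by rewrite addrC [X in _ * X]addrC; exact: hw.
apply: (@le_trans _ _ ((2 * y) `^ q)).
  by apply: powR_le; [|exact: addr_ge0|lra].
by rewrite powRM// ler_wpM2l ?powR_ge0// lerDr powR_ge0.
Qed.

Lemma shell_widen (a b q : R) : 0 < a -> a <= b -> a <= q <= b -> a / 2 <= q <= 2 * b.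
Proof. by move=> a0 ab /andP[aq qb]; apply/andP; split; lra. Qed.

(** For r in [a, b], the distance to q is at least a/2 if q < a/2 and at least q/2 if q > 2b. The
    constant a / (2 + 2a) puts both cases in the form of a multiple of 1 + q. *)
Lemma shell_far (a b r q d : R) : 0 < a -> a <= b -> a <= r <= b -> 0 <= q ->
  ~~ (a / 2 <= q <= 2 * b) -> `|r - q| <= d -> a / (2 + 2 * a) * (1 + q) <= d.
Proof.
move=> a0 ab /andP[ar rb] q0 qS dd.
have h3 : r - q <= d by apply: le_trans dd; exact: ler_norm.
have h4 : q - r <= d by apply: le_trans dd; rewrite distrC; exact: ler_norm.
rewrite mulrAC ler_pdivrMr; last by lra.
move: qS; rewrite negb_and -!ltNge => /orP[h|h].
  have : a / 2 <= d by lra.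
  move=> h5; apply: (@le_trans _ _ (a / 2 * (2 + 2 * a))); first by nra.
  by rewrite ler_wpM2r//; lra.
have h5 : q / 2 <= d by lra.
apply: (@le_trans _ _ (q / 2 * (2 + 2 * a))); first by nra.
by rewrite ler_wpM2r//; lra.
Qed.

Variables (n : nat) (s p : R) (U : R -> R).
Hypotheses (n0 : (0 < n)%N) (s0 : 0 < s) (s1 : s < 1) (p1 : 1 < p).
Let e := s * p.
Let e0 : 0 < e. Proof. by rewrite mulr_gt0// (lt_trans ltr01). Qed.
Hypothesis mU : measurable_fun setT U.
Variables (g1 g2 Cg : R).
Hypotheses (g10 : 0 <= g1) (g1n : g1 < n%:R) (g20 : 0 <= g2) (g2e : g2 < e).
Hypothesis Cg0 : 0 <= Cg.
Hypothesis growthU : forall r : R, 0 <= r ->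
  `|U r| `^ (p - 1) <= Cg * (1 + r `^ (- g1) + r `^ g2).
Variables (a b L : R).
Hypotheses (a0 : 0 < a) (ab : a <= b) (L0 : 0 <= L).
Hypothesis lipU : forall r q : R, a / 2 <= r <= 2 * b -> a / 2 <= q <= 2 * b ->
  `|U r - U q| <= L * `|r - q|.

Lemma osc_growth (r q : R) : a <= r <= b -> 0 <= q ->
  `|U r - U q| `^ (p - 1) <=
  2 `^ (p - 1) * (Cg * (2 + a `^ (- g1) + b `^ g2)) * (1 + q `^ (- g1) + q `^ g2).
Proof.
move=> /andP[ar rb] q0; have r0 : 0 < r by exact: lt_le_trans ar.
have p10 : 0 <= p - 1 by rewrite subr_ge0 ltW.
apply: (@le_trans _ _ ((`|U r| + `|U q|) `^ (p - 1))).
  by apply: powR_le => //; exact: ler_normB.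
apply: le_trans (powR_addr_le _ _ _ p10 (normr_ge0 _) (normr_ge0 _)) _.
rewrite -mulrA ler_wpM2l ?powR_ge0//.
have := growthU r (ltW r0); have := growthU q q0.
have h1 : r `^ (- g1) <= a `^ (- g1) by apply: powR_anti; rewrite ?oppr_le0.
have h2 : r `^ g2 <= b `^ g2.
  by apply: powR_le => //; exact: ltW.
have h3 := powR_ge0 q (- g1); have h4 := powR_ge0 q g2.
have h5 := powR_ge0 r (- g1); have h6 := powR_ge0 r g2.
move: (`|U r| `^ _) (`|U q| `^ _) (r `^ _) (r `^ _) (a `^ _) (b `^ _) (q `^ _) (q `^ _) h1 h2 h3 h4 h5 h6.
move=> X Y r1 r2 A1 B2 q1 q2 h1 h2 h3 h4 h5 h6 hq hr.
have hr' : X <= Cg * (1 + A1 + B2) by apply: (le_trans hr); rewrite ler_wpM2l//; lra.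
rewrite -mulrA; apply: (le_trans (lerD hr' hq)); rewrite -mulrDr ler_wpM2l//.
by nra.
Qed.

(** Majorant for x in the support shell: the first term serves y in the widened shell, where |x - y|
    <= 3b and U is Lipschitz, the second every other y. *)
Definition shell_dom (C1 C2 : R) (z : 'rV[R]_n * 'rV[R]_n) : R :=
  (a <= eucl_norm z.1 <= b)%R%:R *
  (C1 * near_kernel (3 * b) (p - s * p) n (eucl_norm (z.1 - z.2))
   + C2 * tail_weight (s * p) n g1 g2 (eucl_norm z.2)).

Lemma shell_dom_ge0 C1 C2 z : 0 <= C1 -> 0 <= C2 -> 0 <= shell_dom C1 C2 z.
Proof.
move=> C10 C20; rewrite /shell_dom mulr_ge0// addr_ge0// mulr_ge0//.
- exact: near_kernel_ge0.
- exact: tail_weight_ge0.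
Qed.

Lemma measurable_eucl_normB : measurable_fun setT
  (fun z : 'rV[R]_n * 'rV[R]_n => eucl_norm (z.1 - z.2)).
Proof.
apply: (measurableT_comp measurable_eucl_norm); exact: measurable_rVB.
Qed.

Lemma measurable_shell_ind (c d : R) : measurable_fun setT
  (fun x : 'rV[R]_n => (c <= eucl_norm x <= d)%R%:R : R).
Proof.
have mN : measurable_fun setT (@eucl_norm R n) by exact: measurable_eucl_norm.
rewrite [X in measurable_fun _ X](_ : _ = fun x : 'rV[R]_n => if (c <= eucl_norm x) && (eucl_norm x <= d) then 1 else 0 : R); last first.
  by apply/funext => x; case: (_ && _).
apply: measurable_fun_ifT => //; apply: measurable_and; exact: measurable_fun_ler.
Qed.

Lemma measurable_shell_dom C1 C2 : measurable_fun setT (shell_dom C1 C2).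
Proof.
apply: measurable_funM.
  exact: (measurableT_comp (measurable_shell_ind a b) measurable_fst).
apply: measurable_funD; apply: measurable_funM => //.
  exact: (measurableT_comp (measurable_near_kernel _ _ _) measurable_eucl_normB).
apply: (measurableT_comp (measurable_tail_weight _ _ _ _)).
exact: (measurableT_comp measurable_eucl_norm measurable_snd).
Qed.

Lemma shell_dom_lty C1 C2 : 0 <= C1 -> 0 <= C2 ->
  (\int[mu n \x mu n]_z (shell_dom C1 C2 z)%:E < +oo)%E.
Proof.
move=> C10 C20; have md := measurable_shell_dom C1 C2.
rewrite fubini_tonelli1//; last 2 first.
- exact: measurable_funEFin.
- by move=> z; rewrite lee_fin shell_dom_ge0.
have d0 : 0 < p - s * p by rewrite subr_gt0 gtr_pMl// (lt_trans ltr01).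
have [K K0 KE] := near_kernel_fin (3 * b) _ n n0 d0.
have [W WE] : exists W : R, (\int[mu n]_y (tail_weight (s * p) n g1 g2 (eucl_norm y))%:E = W%:E)%E.
  have := tail_weight_lty (s * p) n g1 g2 n0 g10 g1n g20 g2e.
  have : (0 <= \int[mu n]_y (tail_weight (s * p) n g1 g2 (eucl_norm y))%:E)%E.
    by apply: integral_ge0 => y _; rewrite lee_fin tail_weight_ge0.
  by case: integral => // W _ _; exists W.
rewrite /fubini_F.
have mb := measurable_ball_ind n b.
have W0 : 0 <= W by rewrite -lee_fin -WE integral_ge0// => y _; rewrite lee_fin tail_weight_ge0.
have T0 : 0 <= C1 * K + C2 * W by rewrite addr_ge0// mulr_ge0.
apply: (@le_lt_trans _ _ (\int[mu n]_x ((C1 * K + C2 * W)%:E * ((eucl_norm x <= b)%R%:R)%:E))%E).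
  apply: ge0_le_integral => //.
  - move=> x _; apply: integral_ge0 => y _; by rewrite lee_fin shell_dom_ge0.
  - apply: (measurable_fun_fubini_tonelli_F (fun z => (shell_dom C1 C2 z)%:E)).
      exact: measurable_funEFin.
    by move=> z; rewrite lee_fin shell_dom_ge0.
  - by apply: emeasurable_funM => //; apply: measurable_funEFin.
  - move=> x _; rewrite /shell_dom/=.
    case: (eucl_norm x <= b) => /=; last first.
      by rewrite andbF mule0 integral0_eq// => y _; rewrite mul0r.
    rewrite andbT mule1; case: (a <= eucl_norm x); last first.
      by rewrite integral0_eq ?lee_fin// => y _; rewrite mul0r.
    have mN : measurable_fun setT (fun y : 'rV[R]_n => near_kernel (3 * b) (p - s * p) n (eucl_norm (x - y))).
      exact: (measurableT_comp (measurableT_comp (measurable_near_kernel _ _ _) measurable_eucl_normB) (measurable_pair1 x)).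
    have mT : measurable_fun setT (fun y : 'rV[R]_n => tail_weight (s * p) n g1 g2 (eucl_norm y)).
      exact: (measurableT_comp (measurable_tail_weight _ _ _ _) measurable_eucl_norm).
    rewrite (@eq_integral _ _ _ (mu n) setT (fun y => C1%:E * (near_kernel (3 * b) (p - s * p) n (eucl_norm (x - y)))%:E
      + C2%:E * (tail_weight (s * p) n g1 g2 (eucl_norm y))%:E)%E); last first.
      by move=> y _; rewrite mul1r EFinD !EFinM.
    have mEN := measurable_funEFin _ _ _ _ _ mN; have mET := measurable_funEFin _ _ _ _ _ mT.
    rewrite ge0_integralD//; last 4 first.
    + by move=> y _; rewrite mule_ge0// lee_fin near_kernel_ge0.
    + by apply: emeasurable_funM.
    + by move=> y _; rewrite mule_ge0// lee_fin tail_weight_ge0.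
    + by apply: emeasurable_funM.
    rewrite ge0_integralZl//; last by move=> y _; rewrite lee_fin near_kernel_ge0.
    rewrite ge0_integralZl//; last by move=> y _; rewrite lee_fin tail_weight_ge0.
    by rewrite KE WE EFinD !EFinM.
rewrite ge0_integralZl//; last by exact: measurable_funEFin.
by rewrite lte_mul_pinfty// ball_lty.
Qed.

Definition radial : 'rV[R]_n -> R := fun x => U (eucl_norm x).

Lemma measurable_radial : measurable_fun setT radial.
Proof. exact: (measurableT_comp mU measurable_eucl_norm). Qed.

(** The real number inside [weak_integrand], for a radial function. *)
Definition weak_ratio (phi : 'rV[R]_n -> R) (z : 'rV[R]_n * 'rV[R]_n) : R :=
  Psi p (radial z.1 - radial z.2) * (phi z.1 - phi z.2)
     / eucl_norm (z.1 - z.2) `^ (n%:R + s * p).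

Lemma weak_ratioC phi x y : weak_ratio phi (x, y) = weak_ratio phi (y, x).
Proof.
rewrite /weak_ratio/= eucl_norm_distC -(opprB (radial y)) PsiN.
by rewrite -(opprB (phi y)) mulrNN.
Qed.

Lemma measurable_Psi : measurable_fun setT (@Psi R p).
Proof.
apply: measurable_funM => //; apply: (measurableT_comp (measurable_powR _)).
exact: normr_measurable.
Qed.

Lemma measurable_weak_ratio phi : measurable_fun setT phi ->
  measurable_fun setT (weak_ratio phi).
Proof.
move=> mphi.
have m12 (f : 'rV[R]_n -> R) : measurable_fun setT f ->
    measurable_fun setT (fun z : 'rV[R]_n * 'rV[R]_n => f z.1 - f z.2).
  move=> mf; apply: measurable_funB.
    exact: (measurableT_comp mf measurable_fst).
  exact: (measurableT_comp mf measurable_snd).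
apply: measurable_funM.
  apply: measurable_funM; last exact: m12.
  by apply: (measurableT_comp measurable_Psi); apply: m12; exact: measurable_radial.
apply: (measurableT_comp measurable_invr); apply: (measurableT_comp (measurable_powR _)).
exact: measurable_eucl_normB.
Qed.

Variables (phi : 'rV[R]_n -> R) (Lp B : R).
Hypotheses (Lp0 : 0 <= Lp) (B0 : 0 <= B).
Hypothesis phi_lip : forall x y, `|phi x - phi y| <= Lp * eucl_norm (x - y).
Hypothesis phi_le : forall x, `|phi x| <= B.
Hypothesis phi_supp : forall x, ~~ (a <= eucl_norm x <= b) -> phi x = 0.

Let C1 : R := L `^ (p - 1) * Lp.
Let C2 : R := B * (2 `^ (p - 1) * (Cg * (2 + a `^ (- g1) + b `^ g2))) *
  (a / (2 + 2 * a)) `^ (- (n%:R + s * p)).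

Let C10 : 0 <= C1. Proof. by rewrite mulr_ge0// powR_ge0. Qed.
Let C20 : 0 <= C2.
Proof.
rewrite /C2 mulr_ge0 ?powR_ge0// mulr_ge0// mulr_ge0 ?powR_ge0// mulr_ge0//.
by rewrite !addr_ge0 ?powR_ge0.
Qed.

Let ne0 : 0 < n%:R + s * p. Proof. by rewrite ltr_wpDl// ler0n. Qed.

(** The Lipschitz bounds of U and phi give |x - y|^(p-1) and |x - y|; the quotient by the kernel is
    |x - y|^(p - s p - n). *)
Let near_bound x y : a <= eucl_norm x <= b -> a / 2 <= eucl_norm y <= 2 * b ->
  `|weak_ratio phi (x, y)| <=
  C1 * near_kernel (3 * b) (p - s * p) n (eucl_norm (x - y)).
Proof.
move=> xS yS; have /andP[ax xb] := xS; have /andP[ay yb] := yS.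
have xS' : a / 2 <= eucl_norm x <= 2 * b by exact: shell_widen.
have [->|xy] := eqVneq x y.
  by rewrite /weak_ratio/= [phi y - _]subrr mulr0 mul0r normr0 mulr_ge0// near_kernel_ge0.
have d0 : 0 < eucl_norm (x - y) by rewrite eucl_norm_gt0 subr_eq0.
have -> : near_kernel (3 * b) (p - s * p) n (eucl_norm (x - y)) =
    eucl_norm (x - y) `^ (p - s * p - n%:R).
  rewrite /near_kernel ifT//; apply: (@le_trans _ _ (eucl_norm x + eucl_norm y)).
    by rewrite -(@eucl_normN _ _ y); exact: ler_eucl_normD.
  by rewrite (_ : 3 * b = b + 2 * b) ?lerD//; ring.
have p10 : 0 <= p - 1 by rewrite subr_ge0 ltW.
rewrite /weak_ratio/= normrM normfV normrM normr_Psi// [X in _ / X]ger0_norm ?powR_ge0//.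
have h1 : `|radial x - radial y| `^ (p - 1) <= L `^ (p - 1) * eucl_norm (x - y) `^ (p - 1).
  rewrite -powRM ?(ltW d0)//; apply: powR_le => //.
  by apply: (le_trans (lipU _ _ xS' yS)); rewrite ler_wpM2l// ler_eucl_dist.
apply: (@le_trans _ _ (L `^ (p - 1) * eucl_norm (x - y) `^ (p - 1) *
    (Lp * eucl_norm (x - y)) / eucl_norm (x - y) `^ (n%:R + s * p))).
  by rewrite ler_wpM2r ?invr_ge0 ?powR_ge0//; apply: ler_pM; rewrite ?powR_ge0.
rewrite -powRN le_eqVlt; apply/orP; left; apply/eqP.
have -> : eucl_norm (x - y) `^ (p - s * p - n%:R) =
    eucl_norm (x - y) `^ (p - 1) * eucl_norm (x - y) * eucl_norm (x - y) `^ (- (n%:R + s * p)).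
  rewrite -[X in _ * X * _]powRr1 ?(ltW d0)// !powRD_gt0//; congr powR.
  by move: (n%:R : R) => m; clear; ring.
by rewrite /C1; ring.
Qed.

(** Here phi(y) = 0 and |x - y| is at least a multiple of 1 + |y|, so only the growth of U
    matters. *)
Let far_bound x y : a <= eucl_norm x <= b -> ~~ (a / 2 <= eucl_norm y <= 2 * b) ->
  `|weak_ratio phi (x, y)| <= C2 * tail_weight (s * p) n g1 g2 (eucl_norm y).
Proof.
move=> xS yS; have /andP[ax xb] := xS.
have phiy : phi y = 0.
  apply: phi_supp; by apply: contra yS; exact: shell_widen.
have y0 := eucl_norm_ge0 y.
have dd : a / (2 + 2 * a) * (1 + eucl_norm y) <= eucl_norm (x - y).
  by apply: (shell_far _ b (eucl_norm x)) => //; exact: ler_eucl_dist.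
have eta0 : 0 < a / (2 + 2 * a) by rewrite divr_gt0// addr_gt0// mulr_gt0.
have y10 : 0 < 1 + eucl_norm y by rewrite ltr_pwDl.
rewrite /weak_ratio/= phiy subr0 normrM normfV normrM normr_Psi// [X in _ / X]ger0_norm ?powR_ge0//.
rewrite /tail_weight (ger0_norm y0).
have h1 := osc_growth (eucl_norm x) (eucl_norm y) xS y0.
have h2 : (eucl_norm (x - y) `^ (n%:R + s * p))^-1 <=
    (a / (2 + 2 * a)) `^ (- (n%:R + s * p)) / (1 + eucl_norm y) `^ (n%:R + s * p).
  rewrite powRN -invfM -powRM ?(ltW eta0) ?(ltW y10)// lef_pV2 ?posrE ?powR_gt0//.
  - by apply: powR_le => //; rewrite ?(ltW ne0)// mulr_ge0 ?(ltW eta0) ?(ltW y10).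
  - by apply: lt_le_trans dd; rewrite mulr_gt0.
  - by rewrite mulr_gt0.
rewrite /C2; set P := 2 `^ _ * _ in h1 *; set T := 1 + _ + _ in h1 *.
have T0 : 0 <= T by rewrite !addr_ge0 ?powR_ge0.
apply: (@le_trans _ _ ((P * T) * B * ((a / (2 + 2 * a)) `^ (- (n%:R + s * p)) / (1 + eucl_norm y) `^ (n%:R + s * p)))).
  apply: ler_pM => //; rewrite ?mulr_ge0 ?invr_ge0 ?powR_ge0//.
  by apply: ler_pM; rewrite ?powR_ge0.
by rewrite le_eqVlt; apply/orP; left; apply/eqP; ring.
Qed.

Let half_bound x y : a <= eucl_norm x <= b ->
  `|weak_ratio phi (x, y)| <= shell_dom C1 C2 (x, y).
Proof.
move=> xS; rewrite /shell_dom/= xS mul1r.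
have h1 : 0 <= C1 * near_kernel (3 * b) (p - s * p) n (eucl_norm (x - y)).
  by rewrite mulr_ge0// near_kernel_ge0.
have h2 : 0 <= C2 * tail_weight (s * p) n g1 g2 (eucl_norm y).
  by rewrite mulr_ge0// tail_weight_ge0.
have [yS|yS] := boolP (a / 2 <= eucl_norm y <= 2 * b).
  by apply: (le_trans (near_bound _ _ xS yS)); rewrite lerDl.
by apply: (le_trans (far_bound _ _ xS yS)); rewrite lerDr.
Qed.

(** The integrand is symmetric and vanishes unless one of the two points lies in the support
    shell. *)
Lemma weak_ratio_dom x y :
  `|weak_ratio phi (x, y)| <= shell_dom C1 C2 (x, y) + shell_dom C1 C2 (y, x).
Proof.
have h1 := shell_dom_ge0 _ _ (x, y) C10 C20; have h2 := shell_dom_ge0 _ _ (y, x) C10 C20.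
have [xS|xS] := boolP (a <= eucl_norm x <= b).
  by apply: (le_trans (half_bound _ y xS)); rewrite lerDl.
have [yS|yS] := boolP (a <= eucl_norm y <= b).
  by rewrite weak_ratioC; apply: (le_trans (half_bound _ x yS)); rewrite lerDr.
rewrite /weak_ratio/= (phi_supp _ xS) (phi_supp _ yS) subrr mulr0 mul0r normr0.
exact: addr_ge0.
Qed.

Hypothesis mphi : measurable_fun setT phi.

Lemma integrable_weak_ratio :
  (mu n \x mu n)%E.-integrable setT (fun z => (weak_ratio phi z)%:E).
Proof.
pose D z := (shell_dom C1 C2 z)%:E.
have D0 z : (0 <= D z)%E by rewrite lee_fin shell_dom_ge0.
have iD : (mu n \x mu n)%E.-integrable setT D.
  apply/integrableP; split; first by apply: measurable_funEFin; exact: measurable_shell_dom.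
  rewrite (@eq_integral _ _ _ _ setT D); last by move=> z _; rewrite gee0_abs.
  exact: shell_dom_lty.
apply: (@le_integrable _ _ _ _ _ measurableT _ (fun z => D z + D (z.2, z.1))%E).
- by apply: measurable_funEFin; exact: measurable_weak_ratio.
- move=> [x y] _; rewrite [X in (_ <= X)%E]gee0_abs ?adde_ge0//.
  exact: weak_ratio_dom.
by apply: (integrableD measurableT iD); exact: integrable_swap iD.
Qed.

End domination.

Lemma mule_shuffle (R : realType) (u v w : R) (I : \bar R) :
  (u%:E * ((v * w)%:E * I) = (u * w)%:E * (v%:E * I))%E.
Proof. by rewrite !muleA -!EFinM; congr (_%:E * _)%E; ring. Qed.

Lemma mule_double (R : realType) (c : R) (I : \bar R) :
  (c%:E * I + c%:E * I = (2 * c)%:E * I)%E.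
Proof.
case: I => [r| |]; first by rewrite -!EFinM -EFinD; congr EFin; ring.
- case: (ltgtP c 0) => [c0|c0|->].
  + by rewrite !lt0_muley ?lte_fin ?pmulr_rlt0.
  + by rewrite !gt0_muley ?lte_fin ?pmulr_rgt0.
  + by rewrite mulr0 mul0e adde0.
- case: (ltgtP c 0) => [c0|c0|->].
  + by rewrite !lt0_muleNy ?lte_fin ?pmulr_rlt0.
  + by rewrite !gt0_muleNy ?lte_fin ?pmulr_rgt0.
  + by rewrite mulr0 mul0e adde0.
Qed.

(** * The weak form of a radial profile *)

Section radial_solution.
Context {R : realType}.
Local Notation leb := (@lebesgue_measure R).
Local Notation mu n := (@lebesgue_rV R n).

(* Only the increments of [U] are homogeneous, so that the logarithm qualifies
   ([kap = 0]); [sg] is 1 for increasing and -1 for decreasing [U]. *)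
Record radial_profile (n : nat) (s p kap sg : R) (U : R -> R) : Prop := RadialProfile {
  profile_measurable : measurable_fun setT U ;
  profile_growth : exists g1 g2 C : R,
    [/\ 0 <= g1, g1 < n%:R, 0 <= g2, g2 < s * p & 0 <= C /\
      forall r : R, 0 <= r -> `|U r| `^ (p - 1) <= C * (1 + r `^ (- g1) + r `^ g2)] ;
  profile_lipschitz : forall a b : R, 0 < a -> exists2 L : R, 0 <= L &
    forall r q : R, a <= r <= b -> a <= q <= b -> `|U r - U q| <= L * `|r - q| ;
  profile_homogeneous : forall t r q : R, 0 < t -> 0 < r -> 0 < q ->
    osc p U (t * r) (t * q) = t `^ kap * osc p U r q ;
  profile_sign : sg ^+ 2 = 1 ;
  profile_monotone : forall r q : R, 0 < q -> q <= r -> 0 <= sg * (U r - U q) }.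

(** The properties of test functions on which the computation rests. They also admit a piecewise
    linear bump, which is not smooth. *)
Record annular_lipschitz (n : nat) (a b : R) (phi : 'rV[R]_n -> R) : Prop := AnnularLipschitz {
  annular_measurable : measurable_fun setT phi ;
  annular_lip : exists2 L : R, 0 <= L &
    forall x y, `|phi x - phi y| <= L * eucl_norm (x - y) ;
  annular_le : exists2 B : R, 0 <= B & forall x, `|phi x| <= B ;
  annular_supp : forall x, ~~ (a <= eucl_norm x <= b) -> phi x = 0 }.

Variables (n : nat) (s p kap sg : R) (U : R -> R).
Hypotheses (n0 : (0 < n)%N) (s0 : 0 < s) (s1 : s < 1) (p1 : 1 < p).
Hypothesis HU : radial_profile n s p kap sg U.

Let p0 : 0 < p. Proof. exact: lt_trans p1. Qed.
Let mU := profile_measurable _ _ _ _ _ _ HU.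
Let hU := profile_homogeneous _ _ _ _ _ _ HU.

Variables (a b : R) (phi : 'rV[R]_n -> R).
Hypotheses (a0 : 0 < a) (ab : a <= b) (Hphi : annular_lipschitz n a b phi).
Hypothesis phi0 : forall x, 0 <= phi x.
Let mphi := annular_measurable _ _ _ _ Hphi.
Let phi_supp := annular_supp _ _ _ _ Hphi.

Lemma integrable_weak_ratio_annular :
  (mu n \x mu n)%E.-integrable setT (fun z => (weak_ratio n s p U phi z)%:E).
Proof.
have [g1 [g2 [C [g10 g1n g20 g2e [C0 gr]]]]] := profile_growth _ _ _ _ _ _ HU.
have a20 : 0 < a / 2 by rewrite divr_gt0.
have [L L0 lipU] := profile_lipschitz _ _ _ _ _ _ HU (a / 2) (2 * b) a20.
have [Lp Lp0 lipp] := annular_lip _ _ _ _ Hphi.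
have [B B0 hB] := annular_le _ _ _ _ Hphi.
exact: (integrable_weak_ratio n s p U n0 s0 s1 p1 mU g1 g2 C g10 g1n g20 g2e C0 gr
  a b L a0 ab L0 lipU phi Lp B Lp0 B0 lipp hB phi_supp mphi).
Qed.

Definition truncated_kernel (th : R) (z : 'rV[R]_n * 'rV[R]_n) : R :=
  trunc p U th (eucl_norm z.1) (eucl_norm z.2) * eucl_norm (z.1 - z.2) `^ (- (n%:R + s * p)).

Lemma truncated_kernel_ge0 th z : 0 <= truncated_kernel th z.
Proof. by rewrite mulr_ge0 ?powR_ge0// trunc_ge0. Qed.

Lemma measurable_truncated_kernel th : measurable_fun setT (truncated_kernel th).
Proof.
apply: measurable_funM.
  have mp : measurable_fun setT (fun z : 'rV[R]_n * 'rV[R]_n => (eucl_norm z.1, eucl_norm z.2)).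
    apply/measurable_fun_pairP; split.
      exact: (measurableT_comp measurable_eucl_norm measurable_fst).
    exact: (measurableT_comp measurable_eucl_norm measurable_snd).
  exact: (measurableT_comp (measurable_trunc p U mU th) mp).
by apply: (measurableT_comp (measurable_powR _)); exact: measurable_eucl_normB.
Qed.

Local Open Scope ereal_scope.

(** The integral of phi against the power of |x| on the right-hand side of the equation, without the
    constant. *)
Definition weighted_mass : \bar R := \int[mu n]_x (phi x * eucl_norm x `^ (kap - s * p))%:E.

Let wphi0 x : (0 <= phi x * eucl_norm x `^ (kap - s * p))%R.
Proof. by rewrite mulr_ge0// powR_ge0. Qed.

Let phi0' x : 0 <= (phi x)%:E. Proof. by rewrite lee_fin. Qed.

Let mwphi : measurable_fun setT (fun x => (phi x * eucl_norm x `^ (kap - s * p))%:E).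
Proof.
apply: measurable_funEFin; apply: measurable_funM => //.
exact: (measurableT_comp (measurable_powR _) measurable_eucl_norm).
Qed.

Lemma in_mass_ge0 th : 0 <= in_mass n s p U th.
Proof.
apply: integral_ge0 => r /=; rewrite in_itv/= => /andP[r0 _].
rewrite lee_fin mulr_ge0 ?trunc_ge0// mulr_ge0 ?exprn_ge0 ?(ltW r0)//.
exact: kernel_profile_ge0.
Qed.

Lemma out_mass_ge0 th : 0 <= out_mass n s p kap U th.
Proof.
apply: integral_ge0 => r _.
rewrite lee_fin mulr_ge0 ?trunc_ge0// mulr_ge0 ?powR_ge0//.
exact: kernel_profile_ge0.
Qed.

Let phi00 : phi 0%R = 0%R.
Proof. by apply: phi_supp; rewrite eucl_norm0 negb_and -!ltNge a0. Qed.

(** The order of integration keeps phi out of the inner integral: y is integrated out here, x in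
    [integral_trunc_out]. *)
Lemma integral_trunc_in th : (0 < th < 1)%R ->
  \int[mu n \x mu n]_z (phi z.1 * truncated_kernel th z)%:E =
  weighted_mass * ((sphere_area n)%:E * in_mass n s p U th).
Proof.
move=> /andP[th0 th1]; have mT := measurable_truncated_kernel th.
have mf : measurable_fun setT (fun z : 'rV[R]_n * 'rV[R]_n => (phi z.1 * truncated_kernel th z)%:E).
  apply: measurable_funEFin; apply: measurable_funM => //.
  exact: (measurableT_comp mphi measurable_fst).
rewrite fubini_tonelli1//; last by move=> z; rewrite lee_fin mulr_ge0// truncated_kernel_ge0.
rewrite /fubini_F -ge0_integralZr//; last 2 first.
- by move=> x _; rewrite lee_fin.
-  by rewrite mule_ge0 ?in_mass_ge0// lee_fin ltW// sphere_area_gt0.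
apply: eq_integral => x _ /=.
have [->|xn0] := eqVneq x 0%R.
  rewrite phi00 mul0r mul0e integral0_eq// => y _; by rewrite mul0r.
have mk : measurable_fun setT (fun y => (truncated_kernel th (x, y))%:E).
  by apply: measurable_funEFin; exact: (measurableT_comp mT (measurable_pair1 x)).
have k0 y : setT y -> 0 <= (truncated_kernel th (x, y))%:E.
  by move=> _; rewrite lee_fin truncated_kernel_ge0.
apply: etrans (ge0_integralZl (mu n) measurableT mk k0 (phi0' x)) _.
rewrite (integral_inner n s p kap U n0 s0 p0 mU hU th x th0 th1 xn0).
exact: mule_shuffle.
Qed.

Lemma integral_trunc_out th : (0 < th < 1)%R ->
  \int[mu n \x mu n]_z (phi z.2 * truncated_kernel th z)%:E =
  weighted_mass * ((sphere_area n)%:E * out_mass n s p kap U th).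
Proof.
move=> /andP[th0 th1]; have mT := measurable_truncated_kernel th.
have mf : measurable_fun setT (fun z : 'rV[R]_n * 'rV[R]_n => (phi z.2 * truncated_kernel th z)%:E).
  apply: measurable_funEFin; apply: measurable_funM => //.
  exact: (measurableT_comp mphi measurable_snd).
rewrite fubini_tonelli2//; last by move=> z; rewrite lee_fin mulr_ge0// truncated_kernel_ge0.
rewrite /fubini_G -ge0_integralZr//; last 2 first.
- by move=> x _; rewrite lee_fin.
-  by rewrite mule_ge0 ?out_mass_ge0// lee_fin ltW// sphere_area_gt0.
apply: eq_integral => y _ /=.
have [->|yn0] := eqVneq y 0%R.
  rewrite phi00 mul0r mul0e integral0_eq// => x _; by rewrite mul0r.
have mk : measurable_fun setT (fun x => (truncated_kernel th (x, y))%:E).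
  by apply: measurable_funEFin; exact: (measurableT_comp mT (measurable_pair2 y)).
have k0 x : setT x -> 0 <= (truncated_kernel th (x, y))%:E.
  by move=> _; rewrite lee_fin truncated_kernel_ge0.
apply: etrans (ge0_integralZl (mu n) measurableT mk k0 (phi0' y)) _.
rewrite (integral_outer n s p kap U n0 s0 p0 mU hU th y th0 th1 yn0).
exact: mule_shuffle.
Qed.

Lemma weighted_mass_lty : weighted_mass < +oo.
Proof.
have [B B0 hB] := annular_le _ _ _ _ Hphi.
set q := (kap - s * p)%R.
have mb := measurable_ball_ind n b.
have T0 : (0 <= B * (a `^ q + b `^ q))%R by rewrite mulr_ge0// addr_ge0// powR_ge0.
apply: (@le_lt_trans _ _ (\int[mu n]_x ((B * (a `^ q + b `^ q))%:E * ((eucl_norm x <= b)%R%:R)%:E))).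
  apply: ge0_le_integral => //.
  - by move=> x _; rewrite lee_fin.
  - by apply: emeasurable_funM => //; apply: measurable_funEFin.
  - move=> x _; rewrite -EFinM lee_fin.
    have [xS|xS] := boolP (a <= eucl_norm x <= b)%R; last first.
      by rewrite phi_supp// mul0r mulr_ge0.
    have /andP[ax xb] := xS; rewrite xb mulr1; apply: ler_pM => //; first exact: powR_ge0.
      by apply: le_trans (hB x); exact: ler_norm.
    exact: powR_le_ends.
rewrite ge0_integralZl//; last by exact: measurable_funEFin.
by rewrite lte_mul_pinfty// ball_lty.
Qed.

(** Nonnegative coefficients make the profile nondecreasing on (0, 1), so its value at [th] serves
    as the bound. *)
Lemma kernel_profile_le th : (0 < th < 1)%R -> exists2 K : R, (0 <= K)%R &
  forall r, (0 < r <= th)%R -> (kernel_profile n s p r <= K)%R.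
Proof.
move=> /andP[th0 th1].
have l0 : (0 < (n%:R + s * p) / 2)%R by rewrite divr_gt0// ltr_wpDl// ?ler0n// mulr_gt0.
have l1 : (0 < (n%:R + s * p) / 2 + 1 - n%:R / 2)%R.
  by have := mulr_gt0 s0 p0; move=> sp; lra.
have l2 : (0 < n%:R / 2 :> R)%R by rewrite divr_gt0// ltr0n.
exists (kernel_profile n s p th); first exact: kernel_profile_ge0.
move=> r /andP[r0 rt]; have r1 := le_lt_trans rt th1.
rewrite /kernel_profile !gtr0_norm// r1 th1.
have cv (t : R) : (0 < t)%R -> (t < 1)%R ->
    cvgn (pseries (hyp_coef ((n%:R + s * p) / 2) ((n%:R + s * p) / 2 + 1 - n%:R / 2) (n%:R / 2)) (t ^+ 2)).
  move=> t0 t1; apply: (cvg_on_hyp _ _ _ l0 l1 l2).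
  by rewrite normrX gtr0_norm// expr_lt1// ltW.
apply: ler_lim; [exact: cv|exact: cv|].
apply: nearW => k; apply: ler_sum => i _.
have := ltW (hyp_coef_gt0 _ _ _ i l0 l1 l2); rewrite /=; move: (hyp_coef _ _ _ _) => h h0.
have r0' := ltW r0; have th0' := ltW th0.
by rewrite ler_wpM2l//; apply: lerXn2r; rewrite ?nnegrE ?sqr_ge0//; apply: lerXn2r.
Qed.

Lemma integral_itv01_lty (f : R -> R) (C d : R) : (0 < d)%R -> measurable_fun setT f ->
  (forall r, 0 < r -> r < 1 -> 0 <= f r <= C * r `^ (d - 1))%R ->
  \int[leb]_(r in `]0%R, 1%R[) (f r)%:E < +oo.
Proof.
move=> d0 mf hf; have C0 : (0 <= C)%R.
  have h2 : (0 < 2^-1 :> R)%R by rewrite invr_gt0.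
  have /andP[f0 fC] := hf 2^-1%R h2 ltac:(lra).
  by rewrite -(pmulr_lge0 _ (powR_gt0 (d - 1) h2)); exact: le_trans f0 fC.
have mp : measurable_fun setT (fun r : R => (r `^ (d - 1))%:E).
  by apply: measurable_funEFin; exact: measurable_powR.
apply: (@le_lt_trans _ _ (\int[leb]_(r in `]0%R, 1%R[) (C%:E * (r `^ (d - 1))%:E))).
  apply: ge0_le_integral.
  - exact: measurable_itv.
  - by move=> r /=; rewrite in_itv/= => /andP[r0 r1]; rewrite lee_fin; have /andP[] := hf r r0 r1.
  - by apply: measurable_funTS; exact: measurable_funEFin.
  - by apply: measurable_funTS; exact: emeasurable_funM.
  - by move=> r /=; rewrite in_itv/= => /andP[r0 r1]; rewrite -EFinM lee_fin; have /andP[] := hf r r0 r1.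
rewrite ge0_integralZl//; last 2 first.
- exact: measurable_funTS.
- by move=> r _; rewrite lee_fin powR_ge0.
by rewrite integral_powR0// -EFinM ltry.
Qed.

(** The first bound is the growth of U at 0. The second is its growth at infinity, brought to 0 by
    osc(1, r) = r^kap osc(1, 1/r). They make [in_mass] and [out_mass] finite, respectively. *)
Lemma osc1_le : exists g1 g2 C : R, [/\ (g1 < n%:R)%R, (g2 < s * p)%R, (0 <= C)%R,
  (forall r, 0 < r -> r < 1 -> osc p U 1 r <= C * r `^ (- g1))%R &
  (forall r, 0 < r -> r < 1 -> osc p U 1 r <= C * r `^ (kap - g2))%R].
Proof.
have [g1 [g2 [C [g10 g1n g20 g2e [C0 gr]]]]] := profile_growth _ _ _ _ _ _ HU.
pose P := (2 `^ (p - 1) * (C * (2 + 1 `^ (- g1) + 1 `^ g2)))%R.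
have P0 : (0 <= P)%R by rewrite mulr_ge0 ?powR_ge0// mulr_ge0// !addr_ge0 ?powR_ge0.
have h q : (0 <= q)%R -> (osc p U 1 q <= P * (1 + q `^ (- g1) + q `^ g2))%R.
  move=> q0; have h1 : (1 <= (1 : R) <= 1)%R by rewrite lexx.
  exact: (osc_growth p U p1 g1 g2 C g10 g20 C0 gr 1 1 ltr01 1 q h1 q0).
exists g1, g2, (P * 3)%R; split => //.
- by rewrite mulr_ge0.
- move=> r r0 r1; apply: (le_trans (h r (ltW r0))); rewrite -mulrA ler_wpM2l//.
  have q1 : (1 <= r `^ (- g1))%R.
    by rewrite -(powRr0 r) ger_powR ?oppr_le0// r0 ltW.
  have q2 : (r `^ g2 <= 1)%R by rewrite -(powRr0 r) ger_powR// r0 ltW.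
  by move: (r `^ _)%R (r `^ _)%R q1 q2 => u v q1 q2; lra.
- move=> r r0 r1; have ri : (0 < r^-1)%R by rewrite invr_gt0.
  have -> : (osc p U 1 r = r `^ kap * osc p U 1 r^-1)%R.
    by rewrite [in RHS]oscC -hU// divff ?gt_eqF// mulr1.
  have -> : (P * 3 * r `^ (kap - g2) = r `^ kap * (P * (3 * r `^ (- g2))))%R.
    by rewrite -(powRD_gt0 _ kap)//; ring.
  rewrite ler_wpM2l ?powR_ge0//; apply: (le_trans (h _ (ltW ri))); rewrite ler_wpM2l//.
  have vE (t : R) : (r^-1 `^ t = r `^ (- t))%R.
    by rewrite -powR_inv1 ?(ltW r0)// -powRrM mulN1r.
  rewrite !vE opprK.
  have q1 : (1 <= r `^ (- g2))%R.
    by rewrite -(powRr0 r) ger_powR ?oppr_le0// r0 ltW.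
  have q2 : (r `^ g1 <= 1)%R by rewrite -(powRr0 r) ger_powR// r0 ltW.
  by move: (r `^ _)%R (r `^ _)%R q1 q2 => u v q1 q2; lra.
Qed.

Lemma trunc_le_osc th r : (0 <= r)%R -> (trunc p U th 1 r <= osc p U 1 r)%R.
Proof. by move=> r0; rewrite /trunc; case: ifP => // _; exact: powR_ge0. Qed.

Let mass_aux th (C c d : R) (f : R -> R) : (0 < th < 1)%R -> (0 < d + c + 1)%R -> (0 <= C)%R ->
  measurable_fun setT f ->
  (forall r, 0 < r -> r < 1 -> osc p U 1 r <= C * r `^ d)%R ->
  (forall r, 0 < r -> f r = r `^ c)%R ->
  \int[leb]_(r in `]0%R, 1%R[) (trunc p U th 1 r * (f r * kernel_profile n s p r))%:E < +oo.
Proof.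
move=> th01 cd C0 mf hC fE; have [K K0 hK] := kernel_profile_le th th01.
have /andP[th0 th1] := th01.
apply: (integral_itv01_lty _ (C * K) (d + c + 1) cd).
  apply: measurable_funM; first exact: measurable_trunc_r.
  by apply: measurable_funM => //; exact: measurable_kernel_profile.
move=> r r0 r1; have k0 := kernel_profile_ge0 n s p n0 s0 p0 r.
apply/andP; split; first by rewrite mulr_ge0 ?trunc_ge0// fE// mulr_ge0// powR_ge0.
have [rt|rt] := leP r th; last first.
  by rewrite /trunc mulr1 [(r <= th)%R]leNgt rt andbF mul0r mulr_ge0 ?powR_ge0// mulr_ge0.
rewrite fE//; have h1 := le_trans (trunc_le_osc th r (ltW r0)) (hC r r0 r1).
have h2 : (kernel_profile n s p r <= K)%R by apply: hK; rewrite r0.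
rewrite (_ : d + c + 1 - 1 = d + c)%R; last by ring.
rewrite -powRD_gt0// (_ : C * K * (r `^ d * r `^ c) = C * r `^ d * (r `^ c * K))%R; last by ring.
apply: ler_pM => //; first exact: trunc_ge0.
  by rewrite mulr_ge0// powR_ge0.
by rewrite ler_wpM2l// powR_ge0.
Qed.

Lemma in_mass_lty th : (0 < th < 1)%R -> in_mass n s p U th < +oo.
Proof.
move=> th01; have [g1 [g2 [C [g1n g2e C0 h1 h2]]]] := osc1_le.
apply: (mass_aux th C n.-1%:R (- g1) (fun r => r ^+ n.-1)%R th01) => //.
- rewrite -addrA natr1 prednK//; lra.
- by move=> r r0; rewrite powR_mulrn// ltW.
Qed.

Lemma out_mass_lty th : (0 < th < 1)%R -> out_mass n s p kap U th < +oo.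
Proof.
move=> th01; have [g1 [g2 [C [g1n g2e C0 h1 h2]]]] := osc1_le.
apply: (mass_aux th C (s * p - kap - 1) (kap - g2) (fun r => r `^ (s * p - kap - 1))%R th01) => //.
- rewrite (_ : _ + 1 = s * p - g2)%R ?subr_gt0//; ring.
Qed.

Lemma sgPsi (t : R) : (0 <= sg * t)%R -> Psi p t = (sg * `|t| `^ (p - 1))%R.
Proof.
move=> st; have sg2 := profile_sign _ _ _ _ _ _ HU.
have h : (0 <= sg * Psi p t)%R by rewrite /Psi mulrCA mulr_ge0// powR_ge0.
by rewrite -normr_Psi// -(mulr_sqr1 sg)// mulrA -expr2 sg2 mul1r.
Qed.

Lemma weak_ratio_trunc th x y : (0 < th < 1)%R ->
  (0 < eucl_norm y)%R -> (eucl_norm y <= th * eucl_norm x)%R ->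
  weak_ratio n s p U phi (x, y) =
  (sg * (phi x * truncated_kernel th (x, y) - phi y * truncated_kernel th (x, y)))%R.
Proof.
move=> /andP[th0 th1] y0 yx.
have x0 : (0 < eucl_norm x)%R by rewrite -(pmulr_rgt0 _ th0); exact: lt_le_trans yx.
have yx1 : (eucl_norm y <= eucl_norm x)%R by apply: (le_trans yx); rewrite ger_pMl// ltW.
rewrite /weak_ratio/= /truncated_kernel/= /trunc y0 yx/= powRN.
rewrite (sgPsi _ (profile_monotone _ _ _ _ _ _ HU _ _ y0 yx1)) /osc /radial.
by ring.
Qed.

Variable tau : R.
Hypothesis tau2 : (tau ^+ 2 = 1)%R.

(** For kap = beta (p - 1) this is the bracket in the integrand of C(beta); [tau] is its sign on (0,
    1). *)
Definition bracket (r : R) : R := (r ^+ n.-1 - r `^ (s * p - kap - 1))%R.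

Hypothesis tau_bracket : forall r, (0 < r)%R -> (r < 1)%R -> (0 <= tau * bracket r)%R.

(** The integral in the constant up to its sign and the Beta factor, as an extended real because its
    finiteness comes only later. *)
Definition profile_mass : \bar R := \int[leb]_(r in `]0%R, 1%R[)
  (osc p U 1 r * (`|bracket r| * kernel_profile n s p r))%:E.

Definition trunc_mass (th : R) : \bar R := \int[leb]_(r in `]0%R, 1%R[)
  (trunc p U th 1 r * (`|bracket r| * kernel_profile n s p r))%:E.

Lemma measurable_bracket : measurable_fun setT bracket.
Proof. by apply: measurable_funB; [exact: measurable_funX|exact: measurable_powR]. Qed.

Lemma measurable_norm_bracket : measurable_fun setT (fun r => `|bracket r|)%R.
Proof. exact: (measurableT_comp (@normr_measurable R setT) measurable_bracket). Qed.

Let mprofile := measurable_kernel_profile n s p n0 s0 p0.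

(** For th < 1 both masses are finite and may be subtracted. The constant sign of the bracket turns
    the difference into [tau] times a quantity monotone in [th], fit for the limit. *)
Lemma mass_diff th : (0 < th < 1)%R ->
  in_mass n s p U th - out_mass n s p kap U th = tau%:E * trunc_mass th.
Proof.
move=> th01; have mD : measurable (`]0%R, 1%R[%classic : set R) by exact: measurable_itv.
have mt := measurable_trunc_r p U mU th 1.
pose f1 (r : R) := (trunc p U th 1 r * (r ^+ n.-1 * kernel_profile n s p r))%R.
pose f2 (r : R) := (trunc p U th 1 r * (r `^ (s * p - kap - 1) * kernel_profile n s p r))%R.
have mf1 : measurable_fun setT f1.
  by apply: measurable_funM => //; apply: measurable_funM => //; exact: measurable_funX.
have mf2 : measurable_fun setT f2.
  by apply: measurable_funM => //; apply: measurable_funM => //; exact: measurable_powR.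
have if1 : leb.-integrable `]0%R, 1%R[ (EFin \o f1).
  apply/integrableP; split; first by apply: measurable_funTS; exact: measurable_funEFin.
  have := in_mass_lty th th01; congr (_ < _); apply: eq_integral => r.
  rewrite inE/= in_itv/= => /andP[r0 _]; rewrite ger0_norm//.
  by rewrite mulr_ge0 ?trunc_ge0// mulr_ge0 ?kernel_profile_ge0// exprn_ge0// ltW.
have if2 : leb.-integrable `]0%R, 1%R[ (EFin \o f2).
  apply/integrableP; split; first by apply: measurable_funTS; exact: measurable_funEFin.
  have := out_mass_lty th th01; congr (_ < _); apply: eq_integral => r _ /=.
  rewrite ger0_norm//.
  by rewrite mulr_ge0 ?trunc_ge0// mulr_ge0 ?kernel_profile_ge0// powR_ge0.
have -> : in_mass n s p U th - out_mass n s p kap U th =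
    \int[leb]_(r in `]0%R, 1%R[) ((f1 r)%:E - (f2 r)%:E).
  by rewrite integralB_EFin.
have i12 : leb.-integrable `]0%R, 1%R[ (fun r => (f1 r)%:E - (f2 r)%:E).
  by apply: integrableB; [exact: mD|exact: if1|exact: if2].
have -> : trunc_mass th = tau%:E * \int[leb]_(r in `]0%R, 1%R[) ((f1 r)%:E - (f2 r)%:E).
  rewrite -integralZl//; apply: eq_integral => r; rewrite inE/= in_itv/= => /andP[r0 r1].
  rewrite -EFinB -EFinM; congr EFin.
  rewrite -(mulr_sqr1 tau) ?tau_bracket//.
  by rewrite /f1 /f2 /bracket; ring.
by rewrite muleA -EFinM -expr2 tau2 mul1e.
Qed.

Lemma weighted_mass_ge0 : 0 <= weighted_mass.
Proof. by apply: integral_ge0 => x _; rewrite lee_fin. Qed.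

Lemma in_mass_fin th : (0 < th < 1)%R -> exists r : R, in_mass n s p U th = r%:E.
Proof.
move=> th01; have := in_mass_lty _ th01; have := in_mass_ge0 th.
by case: in_mass => // r _ _; exists r.
Qed.

Lemma out_mass_fin th : (0 < th < 1)%R -> exists r : R, out_mass n s p kap U th = r%:E.
Proof.
move=> th01; have := out_mass_lty _ th01; have := out_mass_ge0 th.
by case: out_mass => // r _ _; exists r.
Qed.

Lemma weighted_mass_fin : exists r : R, weighted_mass = r%:E.
Proof.
have := weighted_mass_lty; have := weighted_mass_ge0.
by case: weighted_mass => // r _ _; exists r.
Qed.

Definition weak_trunc th (z : 'rV[R]_n * 'rV[R]_n) : R :=
  if ((0 < eucl_norm z.2) && (eucl_norm z.2 <= th * eucl_norm z.1))%R
  then weak_ratio n s p U phi z else 0%R.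

Lemma weak_truncE th z : (0 < th < 1)%R -> weak_trunc th z =
  (sg * (phi z.1 * truncated_kernel th z - phi z.2 * truncated_kernel th z))%R.
Proof.
case: z => x y th01; rewrite /weak_trunc/=; case: ifPn => [/andP[y0 yx]|h].
  exact: weak_ratio_trunc.
by rewrite /truncated_kernel /trunc/= (negbTE h) mul0r !mulr0 subrr mulr0.
Qed.

Lemma integral_weak_trunc th : (0 < th < 1)%R ->
  (mu n \x mu n).-integrable setT (fun z => (weak_trunc th z)%:E) /\
  \int[mu n \x mu n]_z (weak_trunc th z)%:E =
  (sg * tau * sphere_area n)%:E * (weighted_mass * trunc_mass th).
Proof.
move=> th01; have mT := measurable_truncated_kernel th.
pose f1 (z : 'rV[R]_n * 'rV[R]_n) := (phi z.1 * truncated_kernel th z)%R.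
pose f2 (z : 'rV[R]_n * 'rV[R]_n) := (phi z.2 * truncated_kernel th z)%R.
have mf1 : measurable_fun setT f1.
  by apply: measurable_funM => //; exact: (measurableT_comp mphi measurable_fst).
have mf2 : measurable_fun setT f2.
  by apply: measurable_funM => //; exact: (measurableT_comp mphi measurable_snd).
have [i iE] := in_mass_fin _ th01; have [q qE] := out_mass_fin _ th01.
have [M ME] := weighted_mass_fin.
have I1 := integral_trunc_in _ th01; have I2 := integral_trunc_out _ th01.
have f10 z : (0 <= f1 z)%R by rewrite mulr_ge0// truncated_kernel_ge0.
have f20 z : (0 <= f2 z)%R by rewrite mulr_ge0// truncated_kernel_ge0.
have if1 : (mu n \x mu n).-integrable setT (EFin \o f1).
  apply/integrableP; split; first exact: measurable_funEFin.
  rewrite (@eq_integral _ _ _ _ setT (EFin \o f1)); last by move=> z _ /=; rewrite ger0_norm.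
  by rewrite I1 iE ME -!EFinM ltry.
have if2 : (mu n \x mu n).-integrable setT (EFin \o f2).
  apply/integrableP; split; first exact: measurable_funEFin.
  rewrite (@eq_integral _ _ _ _ setT (EFin \o f2)); last by move=> z _ /=; rewrite ger0_norm.
  by rewrite I2 qE ME -!EFinM ltry.
have i12 : (mu n \x mu n).-integrable setT (fun z => (f1 z)%:E - (f2 z)%:E).
  exact: (integrableB measurableT if1 if2).
have E : (fun z => (weak_trunc th z)%:E) = (fun z => sg%:E * ((f1 z)%:E - (f2 z)%:E)).
  by apply/funext => z; rewrite weak_truncE// -EFinB -EFinM.
rewrite E; split; first exact: (integrableZl measurableT _ i12).
rewrite integralZl// integralB_EFin// I1 I2.
have := mass_diff _ th01; rewrite iE qE ME -!EFinM -EFinB => d.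
have -> : (sg * tau * sphere_area n)%:E * (M%:E * trunc_mass th) =
   (sg * sphere_area n * M)%:E * (tau%:E * trunc_mass th).
  by rewrite !muleA -!EFinM; congr (_%:E * _); ring.
by rewrite -d -!EFinM; congr EFin; ring.
Qed.

(** The shift by 2 makes the sequence start at 1/2, so every term lies strictly between 0 and 1. *)
Definition theta (k : nat) : R := (1 - k.+2%:R^-1)%R.

Lemma theta_itv k : (0 < theta k < 1)%R.
Proof.
have k0 : (0 < k.+2%:R^-1 :> R)%R by rewrite invr_gt0 ltr0n.
have k1 : (k.+2%:R^-1 < 1 :> R)%R by rewrite invf_lt1 ?ltr0n// ltr1n.
by rewrite /theta subr_gt0 k1 gtrDl oppr_lt0.
Qed.

Lemma theta_nd k l : (k <= l)%N -> (theta k <= theta l)%R.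
Proof.
by move=> kl; rewrite /theta lerD2l lerN2 lef_pV2 ?posrE ?ltr0n// ler_nat.
Qed.

Lemma theta_near r : (r < 1)%R -> \forall k \near \oo, (r <= theta k)%R.
Proof.
move=> r1; have r0 : (0 < 1 - r)%R by rewrite subr_gt0.
have [N _ HN] := near_infty_natSinv_lt (PosNum r0).
exists N => // k /= Nk; have := HN k Nk => /= h.
have h2 : (k.+2%:R^-1 <= k.+1%:R^-1 :> R)%R by rewrite lef_pV2 ?posrE ?ltr0n// ler_nat.
by rewrite /theta lerBrDr -lerBrDl; apply: (le_trans h2); exact: ltW.
Qed.

Lemma trunc_mass_cvg : (trunc_mass (theta k) @[k --> \oo] --> profile_mass)%classic.
Proof.
pose g k (r : R) := (trunc p U (theta k) 1 r * (`|bracket r| * kernel_profile n s p r))%:E.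
have mD : measurable (`]0%R, 1%R[%classic : set R) by exact: measurable_itv.
have w0 r : (0 <= `|bracket r| * kernel_profile n s p r)%R.
  by rewrite mulr_ge0// kernel_profile_ge0.
have mg k : measurable_fun (`]0%R, 1%R[%classic : set R) (g k).
  apply: measurable_funTS; apply: measurable_funEFin; apply: measurable_funM.
    exact: measurable_trunc_r.
  by apply: measurable_funM; [exact: measurable_norm_bracket|].
have g0 k (r : R) : `]0%R, 1%R[%classic r -> 0 <= g k r.
  by move=> _; rewrite lee_fin mulr_ge0// trunc_ge0.
have nd (r : R) : `]0%R, 1%R[%classic r -> {homo g ^~ r : k l / (k <= l)%N >-> k <= l}.
  move=> _ k l kl; rewrite lee_fin ler_wpM2r// /trunc !mulr1.
  case: ifPn => [/andP[r0 h]|_]; last by case: ifP => // _; exact: powR_ge0.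
  by rewrite r0 (le_trans h (theta_nd _ _ kl)).
have cv : (\int[leb]_(r in `]0%R, 1%R[) g k r @[k --> \oo] -->
    \int[leb]_(r in `]0%R, 1%R[) limn (g ^~ r))%classic.
  by apply: cvg_monotone_convergence; [exact: mD|exact: mg|exact: g0|exact: nd].
suff <- : \int[leb]_(r in `]0%R, 1%R[) limn (g ^~ r) = profile_mass by exact: cv.
apply: eq_integral => r.
rewrite inE/= in_itv/= => /andP[r0 r1]; apply/cvg_lim => //.
apply: cvg_near_cst; near=> k.
rewrite /g /trunc mulr1 r0/= ifT//; near: k; exact: theta_near.
Unshelve. all: by end_near. Qed.

Let null0 : mu n [set 0%R] = 0 := lebesgue_rV_set0 n n0.

Let mset0 : measurable ([set 0%R] : set 'rV[R]_n).
Proof.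
rewrite (_ : [set 0%R] = setT `&` eucl_norm @^-1` [set 0%R]); last first.
  apply/seteqP; split => x /=; first by move=> ->; rewrite eucl_norm0.
  by move=> [_ /eqP]; rewrite eucl_norm_eq0 => /eqP.
by apply: (measurable_eucl_norm) => //; exact: measurable_set1.
Qed.

Let ae_neq0 : {ae (mu n \x mu n), forall z, z.1 != 0%R /\ z.2 != 0%R}.
Proof.
have a1 : {ae (mu n \x mu n), forall z, z.1 != 0%R}.
  exists ([set 0%R] `*` setT); split; first exact: measurableX.
    transitivity (0 * mu n setT); last exact: mul0e.
    by rewrite product_measure1E//; congr (_ * _); exact: null0.
  by move=> [x y] /= /negP; rewrite negbK => /eqP ->.
have a2 : {ae (mu n \x mu n), forall z, z.2 != 0%R}.
  exists (setT `*` [set 0%R]); split; first exact: measurableX.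
    transitivity (mu n setT * 0); last exact: mule0.
    by rewrite product_measure1E//; congr (_ * _); exact: null0.
  by move=> [x y] /= /negP; rewrite negbK => /eqP ->.
by apply: filterS2 a1 a2 => z.
Qed.

(** Off the origin, the regions |y| <= th |x| and |x| <= th |y| are disjoint and exchanged by
    swapping the variables; their equal contributions give the factor 2. *)
Definition weak_sym k (z : 'rV[R]_n * 'rV[R]_n) : R :=
  (weak_trunc (theta k) z + weak_trunc (theta k) (z.2, z.1))%R.

Let regionN k (x y : 'rV[R]_n) : (0 < eucl_norm y)%R ->
  (eucl_norm y <= theta k * eucl_norm x)%R -> (eucl_norm x <= theta k * eucl_norm y)%R = false.
Proof.
move=> y0 yx; have /andP[t0 t1] := theta_itv k; apply/negbTE; rewrite -ltNge.
have x0 : (0 < eucl_norm x)%R by rewrite -(pmulr_rgt0 _ t0); exact: lt_le_trans yx.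
apply: (@lt_le_trans _ _ (eucl_norm y)); first by rewrite gtr_pMl.
by apply: (le_trans yx); rewrite ger_pMl// ltW.
Qed.

Lemma weak_sym_le k z : (`|weak_sym k z| <= `|weak_ratio n s p U phi z|)%R.
Proof.
case: z => x y; rewrite /weak_sym /weak_trunc/= (weak_ratioC n s p U phi y x).
move: (weak_ratio _ _ _ _ _ _) => w.
have [/andP[y0 yx]|_] := boolP (0 < eucl_norm y <= theta k * eucl_norm x)%R.
  by rewrite (regionN _ _ _ y0 yx) andbF addr0.
by rewrite add0r; case: ifP => // _; rewrite normr0.
Qed.

Lemma weak_sym_cvg z : z.1 != 0%R -> z.2 != 0%R ->
  ((weak_sym k z)%:E @[k --> \oo] --> (weak_ratio n s p U phi z)%:E)%classic.
Proof.
case: z => x y /= xn0 yn0; have x0 : (0 < eucl_norm x)%R by rewrite eucl_norm_gt0.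
have y0 : (0 < eucl_norm y)%R by rewrite eucl_norm_gt0.
apply: cvg_near_cst; have [xy|xy|xy] := ltgtP (eucl_norm x) (eucl_norm y).
- near=> k; have h : (eucl_norm x <= theta k * eucl_norm y)%R.
    rewrite -ler_pdivrMr//; near: k; apply: theta_near.
    by rewrite ltr_pdivrMr// mul1r.
  rewrite /weak_sym /weak_trunc/= (weak_ratioC n s p U phi y x).
  by rewrite x0 h/= (regionN _ _ _ x0 h) andbF add0r.
- near=> k; have h : (eucl_norm y <= theta k * eucl_norm x)%R.
    rewrite -ler_pdivrMr//; near: k; apply: theta_near.
    by rewrite ltr_pdivrMr// mul1r.
  by rewrite /weak_sym /weak_trunc/= y0 h/= (regionN _ _ _ y0 h) andbF addr0.
(* For |x| = |y| the increment of the radial function is 0, and so is the integrand: this set needs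
   no argument about its measure. *)
- have w0 (u v : 'rV[R]_n) : eucl_norm u = eucl_norm v -> weak_ratio n s p U phi (u, v) = 0%R.
    by move=> uv; rewrite /weak_ratio /radial/= uv subrr /Psi mulr0 !mul0r.
  apply: nearW => k; rewrite /weak_sym /weak_trunc/= !w0//.
  by rewrite !if_same addr0.
Unshelve. all: by end_near. Qed.

Lemma integral_weak_ratio :
  \int[mu n \x mu n]_z (weak_ratio n s p U phi z)%:E =
  (2 * sg * tau * sphere_area n)%:E * (weighted_mass * profile_mass).
Proof.
have iw := integrable_weak_ratio_annular.
have mw := measurable_weak_ratio n s p U mU phi mphi.
have iT k := (integral_weak_trunc _ (theta_itv k)).1.
have sE k : \int[mu n \x mu n]_z (weak_sym k z)%:E =
    (2 * sg * tau * sphere_area n)%:E * (weighted_mass * trunc_mass (theta k)).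
  have iS := integrable_swap _ _ _ _ _ (iT k).
  transitivity (\int[mu n \x mu n]_z (weak_trunc (theta k) z)%:E +
      \int[mu n \x mu n]_z (weak_trunc (theta k) (z.2, z.1))%:E).
    by rewrite -(integralD_EFin measurableT (iT k) iS).
  have e1 := (integral_weak_trunc _ (theta_itv k)).2.
  have e2 := integral_swap _ _ _ _ _ (iT k).
  apply: etrans (congr2 (fun u v => u + v) e1 (etrans e2 e1)) _.
  have [M ME] := weighted_mass_fin; rewrite ME.
  rewrite mule_double; congr (_%:E * _); ring.
have cv : ((\int[mu n \x mu n]_z (weak_sym k z)%:E) @[k --> \oo] -->
    \int[mu n \x mu n]_z (weak_ratio n s p U phi z)%:E)%classic.
  have mS k : measurable_fun setT (fun z => (weak_sym k z)%:E).
    have m1 := measurable_int _ (iT k).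
    have m2 := measurable_int _ (integrable_swap _ _ _ _ _ (iT k)).
    exact: emeasurable_funD m1 m2.
  have mE : measurable_fun setT (fun z => (weak_ratio n s p U phi z)%:E).
    exact: measurable_funEFin.
  (* The integrand is its own majorant, since truncation only restricts it. *)
  have [] := @dominated_convergence _ _ _ (mu n \x mu n) setT measurableT
    (fun k z => (weak_sym k z)%:E) (fun z => (weak_ratio n s p U phi z)%:E)
    (fun z => `|(weak_ratio n s p U phi z)%:E|) mS mE _ _ _ => //.
  - apply: filterS ae_neq0 => z [z1 z2] _; exact: weak_sym_cvg.
  - exact: integrable_abse.
  - by apply: aeW => z k _; exact: weak_sym_le.
have cT : ((2 * sg * tau * sphere_area n)%:E * (weighted_mass * trunc_mass (theta k)) @[k --> \oo] -->
   (2 * sg * tau * sphere_area n)%:E * (weighted_mass * profile_mass))%classic.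
  have [M ME] := weighted_mass_fin; rewrite ME.
  by apply: cvgeZl => //; apply: cvgeZl => //; exact: trunc_mass_cvg.
move: cv; under eq_fun do rewrite sE; move=> cv.
exact: (cvg_unique _ cv cT).
Qed.

End radial_solution.

(** * Test functions on the punctured space are Lipschitz and supported in an annulus *)

Section test_functions.
Context {R : realType} {n : nat}.
Implicit Types (x y z : 'rV[R]_n) (K : set 'rV[R]_n) (f phi : 'rV[R]_n -> R).

Lemma norm_le_eucl_norm x : `|x| <= eucl_norm x.
Proof.
rewrite [leLHS](mx_normrE x); apply/bigmax_leP; split; first exact: eucl_norm_ge0.
by move=> [i j] _ /=; rewrite ord1; exact: coord_le_eucl_norm.
Qed.

Lemma coord_le_norm x i : `|x ord0 i| <= `|x|.
Proof.
rewrite [leRHS](mx_normrE x).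
exact: (le_bigmax 0 (fun ij : 'I_1 * 'I_n => `|x ij.1 ij.2|) (ord0, i)).
Qed.

Lemma eucl_norm_le_norm x : eucl_norm x <= n%:R * `|x|.
Proof.
have h0 : 0 <= n%:R * `|x| by rewrite mulr_ge0.
rewrite -(ger0_norm h0) -sqrtr_sqr ler_wsqrtr//.
apply: (@le_trans _ _ (\sum_(i < n) `|x| ^+ 2)).
  by apply: ler_sum => i _; rewrite -real_normK ?num_real// lerXn2r ?nnegrE// coord_le_norm.
rewrite sumr_const card_ord -[leLHS]mulr_natl [leRHS]exprMn ler_wpM2r ?sqr_ge0//.
by rewrite expr2 -natrM ler_nat; case: (n) => // k; rewrite leq_pmulr.
Qed.

Lemma compact_annulus K : compact K -> ~ K 0 ->
  exists a b : R, [/\ 0 < a, a <= b & forall x, K x -> a <= eucl_norm x <= b].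
Proof.
move=> cK K0; have clK : closed K by apply: compact_closed => //; exact: norm_hausdorff.
have [M [Mr MK]] := compact_bounded cK.
have oK : open (~` K) by exact: closed_openC.
have /nbhs_normP[e /= e0 eK] : nbhs (0 : 'rV[R]_n) (~` K) by apply: open_nbhs_nbhs.
pose B := n%:R * (`|M| + 1).
(* Comparing with 1 on both sides ensures a <= b even when [K] is empty. *)
exists (Num.min e 1), (Num.max B 1); split.
- by rewrite lt_min e0 ltr01.
- by rewrite ge_min; apply/orP; right; rewrite le_max lexx orbT.
- move=> x Kx; apply/andP; split.
    rewrite ge_min; apply/orP; left; apply: le_trans (norm_le_eucl_norm x).
    rewrite leNgt; apply/negP => xe; apply: (eK x) => //=.
    by rewrite sub0r normrN.
  rewrite le_max; apply/orP; left; apply: (le_trans (eucl_norm_le_norm x)).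
  rewrite ler_wpM2l//; apply: MK => //.
  by rewrite ltr_pwDr// ler_norm.
Qed.

Lemma continuous_compact_bounded f K : continuous f -> compact K ->
  (forall x, ~ K x -> f x = 0) -> exists2 B : R, 0 <= B & forall x, `|f x| <= B.
Proof.
move=> cf cK fK.
have cfK : compact (f @` K).
  by apply: continuous_compact => //; exact: continuous_subspaceT.
have [M [Mr MK]] := compact_bounded cfK.
have M0 : 0 <= `|M| + 1 by rewrite addr_ge0.
exists (`|M| + 1) => // x; have [Kx|Kx] := pselect (K x).
  by apply: MK; [rewrite ltr_pwDr// ler_norm|exists x].
by rewrite fK// normr0.
Qed.

Lemma derive_eq0 f x v : (\forall y \near x, f y = 0) -> 'D_v f x = 0.
Proof.
move=> fx; rewrite /derive; apply/cvg_lim => //.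
apply: cvg_near_cst.
have fx0 : f x = 0 by exact: nbhs_singleton fx.
have cv : (fun h : R => h *: v + x) @ (0 : R) --> x.
  rewrite -[X in _ --> X]add0r -[X in _ --> X + _](scale0r v).
  by apply: cvgD; [apply: cvgZr_tmp; exact: cvg_id|exact: cvg_cst].
have fN : \forall h \near (0 : R), f (h *: v + x) = 0 by exact: cv fx.
apply: nbhs_dnbhs; near=> h; rewrite fx0 subr0 /= (_ : f _ = 0) ?scaler0//.
by near: h.
Unshelve. all: by end_near. Qed.

Lemma derive_along f x v (t : R) : derivable f (t *: v + x) v ->
  is_derive t 1 (fun h : R => f (h *: v + x)) ('D_v f (t *: v + x)).
Proof.
move=> df.
have E : (fun h : R => h^-1 *: (((fun h : R => f (h *: v + x)) \o shift t) (h *: 1) - f (t *: v + x))) =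
   (fun h : R => h^-1 *: ((f \o shift (t *: v + x)) (h *: v) - f (t *: v + x))).
  apply/funext => h /=; have -> : h *: (1 : R) = h by rewrite -[LHS]/(h * 1) mulr1.
  by rewrite scalerDl addrA.
by split; [rewrite /derivable E|rewrite /derive E].
Qed.

Lemma ler_derive_along f v (B : R) : (forall x, derivable f x v) ->
  (forall x, `|'D_v f x| <= B) -> forall x (t : R), `|f (t *: v + x) - f x| <= B * `|t|.
Proof.
move=> df dB; suff H x (t : R) : 0 <= t -> `|f (t *: v + x) - f x| <= B * `|t|.
  move=> x t; have [t0|t0] := leP 0 t; first exact: H.
  have := H (t *: v + x) (- t); rewrite addrA -scalerDl addNr scale0r add0r normrN distrC.
  by apply; rewrite oppr_ge0 ltW.
move=> t0; have D (h : R) : is_derive h 1 (fun h : R => f (h *: v + x)) ('D_v f (h *: v + x)).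
  exact: derive_along.
have [c _] := MVT_segment t0 (fun h _ => D h)
  (continuous_subspaceT (fun h => is_derive_continuous _ _ _ (D h))).
by rewrite scale0r add0r subr0 => ->; rewrite normrM ler_wpM2r.
Qed.

Lemma ler_derive_coord f (B : R) :
  (forall i : 'I_n, forall x, derivable f x (delta_mx ord0 i)) ->
  (forall i : 'I_n, forall x, `|'D_(delta_mx ord0 i) f x| <= B) ->
  forall x y, `|f x - f y| <= n%:R * B * eucl_norm (x - y).
Proof.
move=> df dB x y.
have B0 : (0 < n)%N -> 0 <= B.
  by move=> n0; apply: le_trans (dB (Ordinal n0) 0).
(* [z k] has the first k coordinates of x and the remaining ones of y; consecutive points differ in
   one coordinate, where the mean value theorem applies. *)
pose z k := y + \sum_(i < n | (i < k)%N) (x - y) ord0 i *: delta_mx ord0 i.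
have zn : z n = x.
  rewrite /z (eq_bigl xpredT); last by move=> i; rewrite ltn_ord.
  by rewrite -row_sum_delta addrC subrK.
have z0 : z 0%N = y by rewrite /z big1 ?addr0.
have H k : (k <= n)%N -> `|f (z k) - f y| <= k%:R * (B * eucl_norm (x - y)).
  elim: k => [|k IH] kn; first by rewrite z0 subrr normr0 mul0r.
  have zS : z k.+1 = (x - y) ord0 (Ordinal kn) *: delta_mx ord0 (Ordinal kn) + z k.
    rewrite /z (bigD1 (Ordinal kn))//= addrCA; congr (_ + (_ + _)).
    apply: eq_bigl => i; rewrite ltnS leq_eqVlt -val_eqE/=.
    by case: ltngtP.
  have -> : f (z k.+1) - f y = (f (z k.+1) - f (z k)) + (f (z k) - f y) by ring.
  apply: (le_trans (ler_normD _ _)); rewrite -natr1 mulrDl mul1r addrC.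
  apply: lerD; first exact: IH (ltnW kn).
  rewrite zS; apply: (le_trans (ler_derive_along _ _ B (df _) (dB _) _ _)).
  by rewrite ler_wpM2l ?coord_le_eucl_norm// B0// (leq_ltn_trans _ kn).
by have := H n (leqnn n); rewrite zn mulrA.
Qed.

(** The compact support avoids 0, so it lies in an annulus; the partial derivatives are continuous
    and vanish off this compact set, hence are bounded. *)
Lemma test_function_annular (U : set 'rV[R]_n) phi :
  U `<=` [set x | x != 0] -> test_function U phi ->
  exists a b : R, [/\ 0 < a, a <= b & annular_lipschitz n a b phi].
Proof.
move=> U0 [Cphi cphi sphi]; set K := closure _ in cphi sphi.
have K0 : ~ K 0 by move=> /sphi/U0/=; rewrite eqxx.
have [a [b [a0 ab Kab]]] := compact_annulus _ cphi K0.
have [cont /= dphi] := Cphi 1%N.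
have phiK x : ~ K x -> phi x = 0.
  move=> Kx; apply/eqP; apply: contrapT => /negP h; apply: Kx.
  by apply: subset_closure.
have clK : closed K by exact: closed_closure.
exists a, b; split=> //; split.
- exact: continuous_measurable_rV.
- have hB (i : 'I_n) : exists2 B : R, 0 <= B & forall x, `|'D_(delta_mx ord0 i) phi x| <= B.
    apply: (continuous_compact_bounded _ K) => //; first exact: (dphi i).2.1.
    move=> x Kx; apply: derive_eq0.
    have : nbhs x (~` K) by apply: open_nbhs_nbhs; split => //; exact: closed_openC.
    by apply: filterS => y; exact: phiK.
  have [B B0 hB'] : exists2 B : R, 0 <= B & forall i x, `|'D_(delta_mx ord0 i) phi x| <= B.
    have /choice[g gB] : forall i : 'I_n, exists B : R, 0 <= B /\ forall x, `|'D_(delta_mx ord0 i) phi x| <= B.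
      by move=> i; have [B ? ?] := hB i; exists B.
    exists (\sum_i g i); first by apply: sumr_ge0 => i _; have [] := gB i.
    move=> i x; apply: (le_trans ((gB i).2 x)); rewrite (bigD1 i)//= lerDl.
    by apply: sumr_ge0 => j _; have [] := gB j.
  exists (n%:R * B); first by rewrite mulr_ge0.
  by apply: ler_derive_coord => // i x; exact: (dphi i).1.
- exact: (continuous_compact_bounded _ K).
- by move=> x xab; apply: phiK => Kx; move: xab; rewrite Kab.
Qed.

End test_functions.

(** * Radial profiles lie in the required function spaces *)

Section radial_spaces.
Context {R : realType}.
Local Notation mu n := (@lebesgue_rV R n).
Variables (n : nat) (s p kap sg : R) (U : R -> R).
Hypotheses (n0 : (0 < n)%N) (s0 : 0 < s) (s1 : s < 1) (p1 : 1 < p).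
Hypothesis HU : radial_profile n s p kap sg U.
Local Open Scope ereal_scope.

Let p0 : (0 < p)%R. Proof. exact: lt_trans p1. Qed.
Let sp0 : (0 < s * p)%R. Proof. exact: mulr_gt0. Qed.
Let u : 'rV[R]_n -> R := radial n U.
Let mu_ : measurable_fun setT u.
Proof. exact: (measurable_radial n U (profile_measurable _ _ _ _ _ _ HU)). Qed.

Let mup (q : R) : measurable_fun setT (fun x => (`|u x| `^ q)%:E).
Proof.
apply: measurable_funEFin; apply: (measurableT_comp (measurable_powR _)).
exact: (measurableT_comp (@normr_measurable R setT) mu_).
Qed.

Lemma compact_measurable_rV (K : set 'rV[R]_n) : compact K -> measurable K.
Proof.
move=> cK; have clK : closed K by apply: compact_closed => //; exact: norm_hausdorff.
rewrite -(setCK K); apply: measurableC; apply: open_measurable_rV; exact: closed_openC.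
Qed.

(** [tail_weight] dominates the tail integrand. On a compact set the factor (1 + |x|)^(n + s p) is
    bounded, so the same majorant gives local integrability. *)
Lemma radial_tail_space : tail_space s p u.
Proof.
have [g1 [g2 [C [g10 g1n g20 g2e [C0 gr]]]]] := profile_growth _ _ _ _ _ _ HU.
have twl := tail_weight_lty (s * p)%R n g1 g2 n0 g10 g1n g20 g2e.
have mtw : measurable_fun setT (fun x : 'rV[R]_n => (tail_weight (s * p)%R n g1 g2 (eucl_norm x))%:E).
  apply: measurable_funEFin.
  exact: (measurableT_comp (measurable_tail_weight _ _ _ _) measurable_eucl_norm).
have tw0 (x : 'rV[R]_n) : 0 <= (tail_weight (s * p)%R n g1 g2 (eucl_norm x))%:E.
  by rewrite lee_fin tail_weight_ge0.
have Ctw (D : R) : (0 <= D)%R ->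
    \int[mu n]_x (D%:E * (tail_weight (s * p)%R n g1 g2 (eucl_norm x))%:E) < +oo.
  by move=> D0; rewrite ge0_integralZl// lte_mul_pinfty.
have x1 (x : 'rV[R]_n) : (0 < 1 + eucl_norm x)%R by rewrite ltr_pwDl// eucl_norm_ge0.
have ut x : (`|u x| `^ (p - 1) / (1 + eucl_norm x) `^ (n%:R + s * p) <=
    C * tail_weight (s * p)%R n g1 g2 (eucl_norm x))%R.
  rewrite /tail_weight (ger0_norm (eucl_norm_ge0 x)) mulrA ler_wpM2r ?invr_ge0 ?powR_ge0//.
  by apply: gr; exact: eucl_norm_ge0.
split; [exact: mu_| |].
- move=> K cK; have mK := compact_measurable_rV _ cK.
  have [M [Mr MK]] := compact_bounded cK.
  pose b : R := (n%:R * (`|M| + 1))%R.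
  have Kb x : K x -> (eucl_norm x <= b)%R.
    move=> Kx; apply: (le_trans (eucl_norm_le_norm x)); rewrite ler_wpM2l//.
    by apply: MK => //; rewrite ltr_pwDr// ler_norm.
  have b0 : (0 <= b)%R by rewrite mulr_ge0// addr_ge0.
  have D0 : (0 <= C * (1 + b) `^ (n%:R + s * p))%R by rewrite mulr_ge0// powR_ge0.
  apply: le_lt_trans (Ctw _ D0).
  apply: (@le_trans _ _ (\int[mu n]_(x in K)
      ((C * (1 + b) `^ (n%:R + s * p))%:E * (tail_weight (s * p)%R n g1 g2 (eucl_norm x))%:E))).
    apply: ge0_le_integral => //.
    + exact: measurable_funTS.
    + by apply: measurable_funTS; apply: emeasurable_funM.
    + move=> x Kx; rewrite -EFinM lee_fin.
      have h1 := ut x; rewrite ler_pdivrMr ?powR_gt0// in h1.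
      apply: (le_trans h1); rewrite mulrAC; apply: ler_wpM2r; first exact: tail_weight_ge0.
      rewrite ler_wpM2l//; apply: powR_le; rewrite ?addr_ge0 ?ler0n ?(ltW sp0) ?eucl_norm_ge0//.
      by rewrite lerD2l Kb.
  apply: ge0_subset_integral => //; first exact: emeasurable_funM.
  by move=> x _; rewrite mule_ge0// lee_fin.
- apply: le_lt_trans (Ctw C C0); apply: ge0_le_integral => //.
  + by move=> x _; rewrite lee_fin divr_ge0// powR_ge0.
  + apply: measurable_funEFin; apply: measurable_funM.
      apply: (measurableT_comp (measurable_powR _)).
      exact: (measurableT_comp (@normr_measurable R setT) mu_).
    apply: (measurableT_comp measurable_invr); apply: (measurableT_comp (measurable_powR _)).
    by apply: measurable_funD => //; exact: measurable_eucl_norm.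
  + exact: emeasurable_funM.
  + by move=> x _; rewrite -EFinM lee_fin.
Qed.

(** The closure of V is compact and avoids 0, so V lies in an annulus, where U is bounded and
    Lipschitz; the double integrand is then at most a multiple of |x - y|^(p - s p - n). *)
Lemma radial_Wsp_loc (O : set 'rV[R]_n) : O `<=` [set x | x != 0%R] -> Wsp_loc s p O u.
Proof.
move=> O0 V oV cV VO; have mV := open_measurable_rV _ _ oV.
have V0 : ~ closure V 0%R by move=> /VO/O0/=; rewrite eqxx.
have [a [b [a0 ab Vab]]] := compact_annulus _ cV V0.
have {}Vab x : V x -> (a <= eucl_norm x <= b)%R by move=> Vx; apply: Vab; exact: subset_closure.
have [L L0 lipU] := profile_lipschitz _ _ _ _ _ _ HU a b a0.
have lipu x y : V x -> V y -> (`|u x - u y| <= L * eucl_norm (x - y))%R.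
  move=> Vx Vy; apply: (le_trans (lipU _ _ (Vab _ Vx) (Vab _ Vy))).
  by rewrite ler_wpM2l// ler_eucl_dist.
have muV : mu n V < +oo.
  rewrite -(setIT V) -integral_indic//.
  apply: le_lt_trans (ball_lty b _ n0); apply: ge0_le_integral => //.
  - by apply: measurable_funEFin.
  - by apply: measurable_funEFin; exact: measurable_ball_ind.
  - move=> x _; rewrite lee_fin indicE; have [Vx|Vx] := boolP (x \in V) => //.
    by move: Vx; rewrite inE => /Vab/andP[_ ->].
split; first split.
- exact: measurable_funTS.
- pose B := ((`|U a| + L * (b - a)) `^ p)%R.
  have uB x : V x -> (`|u x| `^ p <= B)%R.
    move=> Vx; have /andP[ax xb] := Vab _ Vx.
    apply: powR_le; [exact: ltW p0|exact: normr_ge0|].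
    rewrite -(subrK (U a) (u x)) addrC; apply: (le_trans (ler_normD _ _)).
    rewrite lerD2l; apply: (le_trans (lipU _ _ (Vab _ Vx) _)); first by rewrite lexx ab.
    by rewrite ler_wpM2l// ger0_norm ?subr_ge0// lerD2r.
  apply: (@le_lt_trans _ _ (\int[mu n]_(x in V) B%:E)).
    apply: ge0_le_integral => //.
    + exact: measurable_funTS.
  by rewrite integral_cst// lte_mul_pinfty ?lee_fin// powR_ge0.
- have d0 : (0 < p - s * p)%R by rewrite subr_gt0 gtr_pMl.
  pose nk (x y : 'rV[R]_n) := near_kernel (3 * b)%R (p - s * p)%R n (eucl_norm (x - y)).
  have [K K0 KE] := near_kernel_fin (3 * b)%R _ n n0 d0.
  have mnk : measurable_fun setT (fun z : 'rV[R]_n * 'rV[R]_n => nk z.1 z.2).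
    exact: (measurableT_comp (measurable_near_kernel _ _ _) (measurable_eucl_normB n)).
  pose f (z : 'rV[R]_n * 'rV[R]_n) : R := (`|u z.1 - u z.2| `^ p / eucl_norm (z.1 - z.2) `^ (n%:R + s * p))%R.
  have f0 z : (0 <= f z)%R by rewrite divr_ge0// powR_ge0.
  have mf : measurable_fun setT f.
    apply: measurable_funM.
      apply: (measurableT_comp (measurable_powR _)); apply: (measurableT_comp (@normr_measurable R setT)).
      apply: measurable_funB.
        exact: (measurableT_comp mu_ measurable_fst).
      exact: (measurableT_comp mu_ measurable_snd).
    apply: (measurableT_comp measurable_invr); apply: (measurableT_comp (measurable_powR _)).
    exact: measurable_eucl_normB.
  have fle x y : V x -> V y -> (f (x, y) <= L `^ p * nk x y)%R.
    move=> Vx Vy; have [->|xy] := eqVneq x y.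
      rewrite /f/= subrr normr0 powR0 ?gt_eqF// mul0r mulr_ge0 ?powR_ge0//.
      exact: near_kernel_ge0.
    have dxy : (0 < eucl_norm (x - y))%R by rewrite eucl_norm_gt0 subr_eq0.
    have /andP[_ xb] := Vab _ Vx; have /andP[_ yb] := Vab _ Vy.
    have -> : nk x y = (eucl_norm (x - y) `^ (p - s * p - n%:R))%R.
      rewrite /nk /near_kernel ifT//; apply: (@le_trans _ _ (eucl_norm x + eucl_norm y)%R).
        by rewrite -(@eucl_normN _ _ y); exact: ler_eucl_normD.
      rewrite (_ : 3 * b = b + b + b)%R; last by ring.
      by rewrite -[leLHS]addr0 lerD ?lerD// (le_trans _ ab)// ltW.
    have -> : (eucl_norm (x - y) `^ (p - s * p - n%:R) =
        eucl_norm (x - y) `^ p / eucl_norm (x - y) `^ (n%:R + s * p))%R.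
      by rewrite -powRN powRD_gt0//; congr powR; ring.
    rewrite /f/= mulrA ler_wpM2r ?invr_ge0 ?powR_ge0// -powRM ?(ltW dxy)//.
    by apply: powR_le; [exact: ltW p0|exact: normr_ge0|exact: lipu].
  have mg : measurable_fun setT (fun z => (f z)%:E * (\1_V z.2)%:E).
    apply: emeasurable_funM; apply: measurable_funEFin => //.
    exact: (measurableT_comp (measurable_indic mV) measurable_snd).
  apply: (@le_lt_trans _ _ (\int[mu n]_(x in V) ((L `^ p * K)%R)%:E)).
    have IE x : \int[mu n]_(y in V) (f (x, y))%:E = \int[mu n]_y ((f (x, y))%:E * (\1_V y)%:E).
      rewrite integral_mkcond; apply: eq_integral => y _; rewrite patchE indicE.
      by case: (y \in V); rewrite ?mule1 ?mule0.
    apply: ge0_le_integral => //.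
    + by move=> x _; apply: integral_ge0 => y _; rewrite lee_fin; exact: (f0 (x, y)).
    + rewrite [X in measurable_fun _ X](_ : _ = fun x => \int[mu n]_y ((f (x, y))%:E * (\1_V y)%:E)); last first.
        by apply/funext => x; exact: IE.
      apply: measurable_funTS.
      apply: (measurable_fun_fubini_tonelli_F (fun z => (f z)%:E * (\1_V z.2)%:E) mg).
      by move=> z; rewrite mule_ge0// lee_fin.
    + move=> x Vx; have mnx : measurable_fun setT (fun y => (nk x y)%:E).
        by apply: measurable_funEFin; exact: (measurableT_comp mnk (measurable_pair1 x)).
      apply: (@le_trans _ _ (\int[mu n]_(y in V) ((L `^ p)%:E * (nk x y)%:E))).
        apply: ge0_le_integral => //.
        * by move=> y _; rewrite lee_fin; exact: (f0 (x, y)).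
        * by apply: measurable_funTS; apply: measurable_funEFin; exact: (measurableT_comp mf (measurable_pair1 x)).
        * by apply: measurable_funTS; apply: emeasurable_funM.
        * by move=> y Vy; rewrite -EFinM lee_fin; exact: fle.
      apply: (@le_trans _ _ (\int[mu n]_y ((L `^ p)%:E * (nk x y)%:E))).
        apply: ge0_subset_integral => //; first exact: emeasurable_funM.
        by move=> y _; rewrite mule_ge0// lee_fin ?powR_ge0// near_kernel_ge0.
      rewrite ge0_integralZl//; last 2 first.
      * by move=> y _; rewrite lee_fin near_kernel_ge0.
      * by rewrite lee_fin powR_ge0.
      by rewrite KE.
  rewrite integral_cst//.
  by rewrite lte_mul_pinfty// lee_fin mulr_ge0// powR_ge0.
Qed.

End radial_spaces.

(** * An explicit Lipschitz test function *)

Section bump.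
Context {R : realType}.
Local Notation leb := (@lebesgue_measure R).
Local Notation mu n := (@lebesgue_rV R n).

(** A tent over [1, 3]: as a function of |x| it is [annular_lipschitz], and its weighted mass is
    visibly positive. *)
Definition bump (r : R) : R := Num.max 0 (1 - `|r - 2|).

Lemma bump_ge0 r : 0 <= bump r.
Proof. by rewrite /bump le_max lexx. Qed.

Lemma bump_le1 r : bump r <= 1.
Proof. by rewrite /bump ge_max ler01/= gerBl. Qed.

Lemma bump_lip r q : `|bump r - bump q| <= `|r - q|.
Proof.
have h : `|(1 - `|r - 2|) - (1 - `|q - 2|)| <= `|r - q|.
  rewrite (_ : _ - _ = `|q - 2| - `|r - 2|); last by ring.
  by apply: (le_trans (ler_dist_dist _ _)); rewrite distrC (_ : _ - _ = r - q)//; ring.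
apply: le_trans h; rewrite /bump; move: (1 - _) (1 - _) => v u.
have a := ler_norm (u - v); have b := ler_norm (v - u); rewrite distrC in b.
rewrite ler_norml; move: (`|u - v|) a b => w a b.
by case: (leP 0 u) => hu; case: (leP 0 v) => hv; apply/andP; split; lra.
Qed.

Lemma bump_out r : ~~ (1 <= r <= 3) -> bump r = 0.
Proof.
rewrite negb_and -!ltNge => h; rewrite /bump max_l// subr_le0 ler_normr.
by apply/orP; case/orP: h => h; [right|left]; lra.
Qed.

Lemma bump_mid r : 3 / 2 <= r <= 5 / 2 -> 1 / 2 <= bump r.
Proof.
move=> /andP[h1 h2]; rewrite /bump le_max; apply/orP; right.
by rewrite lerBrDr -lerBrDl ler_norml; apply/andP; split; lra.
Qed.

Lemma measurable_bump : measurable_fun setT bump.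
Proof.
apply: measurable_maxr => //; apply: measurable_funB => //.
by apply: (measurableT_comp (@normr_measurable R setT)); exact: measurable_funB.
Qed.

Lemma bump_annular n : annular_lipschitz n 1 3 (fun x : 'rV[R]_n => bump (eucl_norm x)).
Proof.
split.
- exact: (measurableT_comp measurable_bump measurable_eucl_norm).
- exists 1 => // x y; rewrite mul1r; apply: (le_trans (bump_lip _ _)).
  exact: ler_eucl_dist.
- by exists 1 => // x; rewrite ger0_norm ?bump_ge0// bump_le1.
- by move=> x h; exact: bump_out.
Qed.

Lemma bump_weighted_mass_gt0 n (s p kap : R) : (0 < n)%N ->
  (0 < weighted_mass n s p kap (fun x : 'rV[R]_n => bump (eucl_norm x)))%E.
Proof.
move=> n0; rewrite /weighted_mass.
pose g (r : R) := (bump r * r `^ (kap - s * p))%:E.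
have mb := measurable_bump.
have mg : measurable_fun setT g.
  by apply: measurable_funEFin; apply: measurable_funM => //; exact: measurable_powR.
have g0 r : (0 <= g r)%E by rewrite lee_fin mulr_ge0 ?bump_ge0// powR_ge0.
rewrite -[X in (_ < X)%E]/(\int[mu n]_x g (eucl_norm x))%E (integral_radial n g n0 mg g0).
rewrite mule_gt0// ?lte_fin ?sphere_area_gt0//.
(* On [3/2, 5/2] the bump is at least 1/2, and r^e >= r^(-|e|) >= 3^(-|e|) whatever the sign of
   e. *)
pose e := kap - s * p + n.-1%:R; pose c := 1 / 2 * 3 `^ (- `|e|).
have c0 : 0 < c by rewrite mulr_gt0 ?powR_gt0//; lra.
apply: (@lt_le_trans _ _ (\int[leb]_(r in `[(3 / 2)%R, (5 / 2)%R]) c%:E)%E).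
  rewrite integral_cst; last exact: measurable_itv.
  rewrite mule_gt0 ?lte_fin//.
  rewrite [X in (_ < X)%E](_ : _ = 1%:E) ?lte_fin//.
  apply: etrans (lebesgue_measure_itv _) _; rewrite /= lte_fin ifT; last by lra.
  by rewrite -EFinB; congr EFin; lra.
have mgr : measurable_fun setT (fun r => (g r * (r ^+ n.-1)%:E)%E).
  by apply: emeasurable_funM => //; apply: measurable_funEFin; exact: measurable_funX.
apply: (@le_trans _ _ (\int[leb]_(r in `[(3 / 2)%R, (5 / 2)%R]) (g r * (r ^+ n.-1)%:E))%E).
  apply: ge0_le_integral.
  - exact: measurable_itv.
  - by move=> r _; rewrite lee_fin ltW.
  - exact: measurable_cst.
  - exact: measurable_funTS.
  - move=> r /=; rewrite in_itv/= => r35; have /andP[r1 r2] := r35.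
    have r0 : 0 < r by lra.
    rewrite -EFinM lee_fin -mulrA; apply: ler_pM.
    + by lra.
    + exact: powR_ge0.
    + exact: bump_mid.
    rewrite -powR_mulrn ?(ltW r0)// powRD_gt0// -/e.
    apply: (@le_trans _ _ (r `^ (- `|e|))).
      by apply: powR_anti; rewrite ?oppr_le0//; lra.
    by rewrite ler_powR; [|lra|rewrite lerNl -normrN; exact: ler_norm].
apply: ge0_subset_integral.
- exact: measurable_itv.
- exact: measurable_itv.
- exact: measurable_funTS.
- by move=> r /=; rewrite in_itv/= andbT => r0; rewrite mule_ge0// lee_fin exprn_ge0// ltW.
- by move=> r /=; rewrite !in_itv/= andbT => /andP[h _]; lra.
Qed.

End bump.

(** * Radial profiles are weak solutions *)

Section weak_solutions.
Context {R : realType}.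
Local Notation leb := (@lebesgue_measure R).
Local Notation mu n := (@lebesgue_rV R n).
Variables (n : nat) (s p kap sg : R) (U : R -> R).
Hypotheses (n0 : (0 < n)%N) (s0 : 0 < s) (s1 : s < 1) (p1 : 1 < p).
Hypothesis HU : radial_profile n s p kap sg U.
Variable tau : R.
Hypothesis tau2 : tau ^+ 2 = 1.
Hypothesis tau_bracket : forall r : R, 0 < r -> r < 1 -> 0 <= tau * bracket n s p kap r.

Let p0 : 0 < p. Proof. exact: lt_trans p1. Qed.
Let unit_neq0 (x : R) : x ^+ 2 = 1 -> x != 0.
Proof. by move=> x2; apply/eqP => x0; move: x2; rewrite x0 expr0n/= => /eqP; rewrite eq_sym oner_eq0. Qed.

Lemma profile_mass_ge0 : (0 <= profile_mass n s p kap U)%E.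
Proof.
apply: integral_ge0 => r _; rewrite lee_fin mulr_ge0 ?powR_ge0// mulr_ge0//.
exact: kernel_profile_ge0.
Qed.

(* The double integral defining the weak form is finite for every Lipschitz
   test function, so testing against one bump shows that the constant is. *)
Lemma profile_mass_fin : exists I : R, profile_mass n s p kap U = I%:E.
Proof.
have Hb := @bump_annular R n.
have b0 (x : 'rV[R]_n) : 0 <= bump (eucl_norm x) by exact: bump_ge0.
have ab : (1 : R) <= 3 by lra.
have iw := integrable_weak_ratio_annular n s p kap sg U n0 s0 s1 p1 HU 1 3 _ ltr01 ab Hb.
have E := integral_weak_ratio n s p kap sg U n0 s0 s1 p1 HU 1 3 _ ltr01 ab Hb b0 tau tau2 tau_bracket.
have [M ME] := weighted_mass_fin n s p kap n0 1 3 _ ltr01 Hb b0.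
have M0 : 0 < M by rewrite -lte_fin -ME bump_weighted_mass_gt0.
have := integrable_fin_num measurableT iw; rewrite E ME.
have c0 : 2 * sg * tau * sphere_area n != 0.
  apply: mulf_neq0; last by rewrite gt_eqF// sphere_area_gt0.
  apply: mulf_neq0; last exact: unit_neq0.
  apply: mulf_neq0; first by rewrite pnatr_eq0.
  by apply: unit_neq0; exact: (profile_sign _ _ _ _ _ _ HU).
have := profile_mass_ge0; case: profile_mass => [I| |] // _; first by exists I.
rewrite gt0_muley ?lte_fin//; case: (ltgtP (2 * sg * tau * sphere_area n) 0) => c.
- by rewrite lt0_muley ?lte_fin.
- by rewrite gt0_muley ?lte_fin.
- by rewrite c eqxx in c0.
Qed.

Definition radial_constant : R := 2 * sg * tau * sphere_area n * fine (profile_mass n s p kap U).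

(** The two integrals are equal, so every reflexive relation holds between them; super-solutions and
    sub-solutions are two instances. *)
Lemma radial_weak_formulation (rel : \bar R -> \bar R -> bool) : (forall x, rel x x) ->
  weak_formulation rel s p [set x : 'rV[R]_n | x != 0]
    (fun x _ => radial_constant * eucl_norm x `^ (kap - s * p)) (radial n U).
Proof.
move=> relxx; split; first exact: (radial_tail_space n s p kap sg U n0 s0 p1 HU).
move=> O oO bO O0; split; first exact: (radial_Wsp_loc n s p kap sg U n0 s1 p1 HU O O0).
move=> phi tphi phi0.
have [a [b [a0 ab Hphi]]] := test_function_annular _ _ O0 tphi.
have iw := integrable_weak_ratio_annular n s p kap sg U n0 s0 s1 p1 HU a b phi a0 ab Hphi.
have E := integral_weak_ratio n s p kap sg U n0 s0 s1 p1 HU a b phi a0 ab Hphi phi0 tau tau2 tau_bracket.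
have [M ME] := weighted_mass_fin n s p kap n0 a b phi a0 Hphi phi0.
have [I IE] := profile_mass_fin.
have mphi := annular_measurable _ _ _ _ Hphi.
have wE x : ((radial_constant * eucl_norm x `^ (kap - s * p) * phi x)%:E =
    radial_constant%:E * (phi x * eucl_norm x `^ (kap - s * p))%:E)%E.
  by rewrite -EFinM; congr EFin; ring.
have iphi : (mu n).-integrable setT (fun x => (phi x * eucl_norm x `^ (kap - s * p))%:E).
  apply/integrableP; split.
    apply: measurable_funEFin; apply: measurable_funM => //.
    exact: (measurableT_comp (measurable_powR _) measurable_eucl_norm).
  rewrite (@eq_integral _ _ _ _ setT (fun x => (phi x * eucl_norm x `^ (kap - s * p))%:E)).
    by rewrite -[X in (X < _)%E]/(weighted_mass n s p kap phi) ME ltry.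
  by move=> x _; rewrite gee0_abs// lee_fin mulr_ge0// powR_ge0.
split; first exact: iw.
- under [X in integrable _ _ X]eq_fun do rewrite wE.
  exact: integrableZl.
rewrite [X in rel _ X](_ : _ = (radial_constant%:E * M%:E)%E); last first.
  by under eq_integral do rewrite wE; rewrite integralZl// -ME.
rewrite [X in rel X _](_ : _ = (radial_constant%:E * M%:E)%E)//.
apply: (etrans E); rewrite ME IE /radial_constant IE /= -!EFinM; congr EFin; ring.
Qed.

Lemma radial_weak_solution :
  weak_solution s p [set x : 'rV[R]_n | x != 0]
    (fun x _ => radial_constant * eucl_norm x `^ (kap - s * p)) (radial n U).
Proof. by split; apply: radial_weak_formulation => x /=; exact: lexx. Qed.

End weak_solutions.

(** * Powers and the logarithm as radial profiles *)

Section profiles.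
Context {R : realType}.
Implicit Types a b r q s p beta : R.

Lemma lipschitz_derive (f df : R -> R) a b (L : R) :
  (forall x, a <= x <= b -> is_derive x 1 f (df x)) ->
  (forall x, a <= x <= b -> `|df x| <= L) ->
  forall r q, a <= r <= b -> a <= q <= b -> `|f r - f q| <= L * `|r - q|.
Proof.
move=> df_ dfL; suff H r q : a <= q -> q <= r -> r <= b -> `|f r - f q| <= L * `|r - q|.
  move=> r q /andP[ar rb] /andP[aq qb]; have [qr|/ltW rq] := leP q r; first exact: H.
  by rewrite distrC [X in _ * X]distrC; exact: H.
move=> aq qr rb; have D x : x \in `]q, r[ -> is_derive x 1 f (df x).
  rewrite in_itv/= => /andP[qx xr]; apply: df_; apply/andP; split.
    exact: le_trans aq (ltW qx).
  exact: le_trans (ltW xr) rb.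
have [|c] := MVT_segment qr D.
  apply: continuous_in_subspaceT => x; rewrite inE/= in_itv/= => /andP[qx xr].
  apply: is_derive_continuous; apply: df_; apply/andP; split.
    exact: le_trans aq qx.
  exact: le_trans xr rb.
rewrite in_itv/= => /andP[qc cr] ->; rewrite normrM ler_wpM2r//; apply: dfL.
by apply/andP; split; [exact: le_trans aq qc|exact: le_trans cr rb].
Qed.

(** The value 1 at 0 makes the square always 1, as [radial_profile] asks. *)
Definition sign_of (x : R) : R := if 0 <= x then 1 else -1.

Lemma sign_of_sqr x : sign_of x ^+ 2 = 1.
Proof. by rewrite /sign_of; case: ifP; rewrite ?sqrrN expr1n. Qed.

(** Here |U|^(p-1) = r^(beta (p-1)), a growth at infinity if beta >= 0 and at 0 otherwise. The two
    ends of the range of beta say exactly g2 < s p and g1 < n. *)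
Lemma power_profile n s p beta : (0 < n)%N -> 0 < s -> 1 < p ->
  - (n%:R / (p - 1)) < beta -> beta < p * s / (p - 1) ->
  radial_profile n s p (beta * (p - 1)) (sign_of beta) (fun r => r `^ beta).
Proof.
move=> n0 s0 p1 b1 b2; have p10 : 0 < p - 1 by rewrite subr_gt0.
have bn : - n%:R < beta * (p - 1) by rewrite -ltr_pdivrMr// mulNr.
have bs : beta * (p - 1) < s * p by rewrite -ltr_pdivlMr// [s * p]mulrC.
have nn0 : 0 < n%:R :> R by rewrite ltr0n.
have sp0 : 0 < s * p by rewrite mulr_gt0// (lt_trans ltr01).
split.
- exact: measurable_powR.
- have gE r : `|r `^ beta| `^ (p - 1) = r `^ (beta * (p - 1)).
    by rewrite (ger0_norm (powR_ge0 _ _)) powRrM.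
  have [be0|be0] := leP 0 beta.
    exists 0, (beta * (p - 1)), 1; split => //; first by rewrite mulr_ge0// ltW.
    by split => // r r0; rewrite gE mul1r lerDr addr_ge0// powR_ge0.
  exists (- (beta * (p - 1))), 0, 1; split => //.
  + by rewrite oppr_ge0 mulr_le0_ge0 ?ltW.
  + by rewrite ltrNl.
  split => // r r0; rewrite gE mul1r opprK -[leLHS]add0r -[leLHS]addr0.
  by rewrite !lerD ?powR_ge0.
- move=> a b a0; pose L := `|beta| * (a `^ (beta - 1) + b `^ (beta - 1)).
  exists L; first by rewrite mulr_ge0// addr_ge0 ?powR_ge0.
  apply: (lipschitz_derive _ (fun x => beta * x `^ (beta - 1))).
    move=> x /andP[ax _]; apply: is_derive1_powR; exact: lt_le_trans ax.
  move=> x xab; rewrite normrM ler_wpM2l// ger0_norm ?powR_ge0//.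
  exact: powR_le_ends.
- move=> t r q t0 r0 q0; rewrite /osc !powRM ?ltW// -mulrBr normrM.
  by rewrite (ger0_norm (powR_ge0 _ _)) powRM ?powR_ge0// powRrM.
- exact: sign_of_sqr.
- move=> r q q0 qr; have r0 := lt_le_trans q0 qr; rewrite /sign_of.
  have [be0|be0] := leP 0 beta.
    by rewrite mul1r subr_ge0; apply: powR_le => //; exact: ltW.
  rewrite mulN1r opprB subr_ge0.
  by apply: powR_anti => //; exact: ltW.
Qed.

(** From ln(1 + t) <= t with t = r^d - 1. *)
Lemma ln_le_powR r (d : R) : 0 < r -> 0 < d -> ln r <= d^-1 * r `^ d.
Proof.
move=> r0 d0; rewrite ler_pdivlMl//; have := @le_ln1Dx R (r `^ d - 1).
rewrite addrCA subrr addr0 ln_powR => h; apply: (@le_trans _ _ (r `^ d - 1)).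
  by apply: h; rewrite -subr_gt0 opprK subrK powR_gt0.
by rewrite gerBl.
Qed.

Lemma log_profile n s p : (0 < n)%N -> 0 < s -> 1 < p -> s * p <= n%:R ->
  radial_profile n s p 0 1 (@ln R).
Proof.
move=> n0 s0 p1 spn; have p10 : 0 < p - 1 by rewrite subr_gt0.
have sp0 : 0 < s * p by rewrite mulr_gt0// (lt_trans ltr01).
split.
- exact: measurable_ln.
(* |ln r| is at most a multiple of r^d + r^(-d), so its power p - 1 is controlled by r^e and r^(-e),
   with 0 < e < s p <= n. *)
- pose e := s * p / 2; pose d := e / (p - 1).
  have e0 : 0 < e by rewrite divr_gt0.
  have d0 : 0 < d by rewrite divr_gt0.
  have esp : e < s * p by rewrite /e ltr_pdivrMr//; lra.
  exists e, e, (2 `^ (p - 1) * d^-1 `^ (p - 1)); split => //; rewrite ?(ltW e0)//.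
    exact: lt_le_trans spn.
  split; first by rewrite mulr_ge0 ?powR_ge0.
  move=> r; rewrite le_eqVlt => /predU1P[<-|r0].
    by rewrite ln0// normr0 powR0 ?gt_eqF// mulr_ge0 ?mulr_ge0 ?addr_ge0 ?powR_ge0.
  have h : `|ln r| <= d^-1 * (r `^ d + r `^ (- d)).
    have ri : 0 < r^-1 by rewrite invr_gt0.
    have rE : r^-1 `^ d = r `^ (- d) by rewrite -powR_inv1 ?(ltW r0)// -powRrM mulN1r.
    have h1 := ln_le_powR r d r0 d0; have := ln_le_powR r^-1 d ri d0.
    rewrite lnV ?posrE// rE => h2; rewrite mulrDr ler_norml.
    have k1 : 0 <= d^-1 * r `^ d by rewrite mulr_ge0 ?powR_ge0// invr_ge0 ltW.
    have k2 : 0 <= d^-1 * r `^ (- d) by rewrite mulr_ge0 ?powR_ge0// invr_ge0 ltW.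
    by apply/andP; split; lra.
  apply: (le_trans (powR_le _ _ _ (ltW p10) (normr_ge0 _) h)).
  rewrite powRM ?invr_ge0 ?(ltW d0) ?addr_ge0 ?powR_ge0// [2 `^ _ * _]mulrC -mulrA.
  rewrite ler_wpM2l ?powR_ge0//.
  apply: (le_trans (powR_addr_le _ _ _ (ltW p10) (powR_ge0 _ _) (powR_ge0 _ _))).
  rewrite ler_wpM2l ?powR_ge0// -!powRrM mulNr divfK ?gt_eqF// addrC.
  by rewrite lerD2r lerDr.
- move=> a b a0; exists a^-1; first by rewrite invr_ge0 ltW.
  apply: (lipschitz_derive _ (fun x => x^-1)).
    move=> x /andP[ax _]; apply: is_derive1_ln; exact: lt_le_trans ax.
  move=> x /andP[ax _]; have x0 := lt_le_trans a0 ax.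
  by rewrite ger0_norm ?invr_ge0 ?(ltW x0)// lef_pV2.
- move=> t r q t0 r0 q0; rewrite /osc powRr0 mul1r !lnM ?posrE//.
  by congr (`| _ | `^ _); ring.
- exact: expr1n.
- move=> r q q0 qr; rewrite mul1r subr_ge0 ler_ln ?posrE//.
  exact: lt_le_trans qr.
Qed.

End profiles.

(** * Normalization and positivity of the constant *)

Section constants.
Context {R : realType}.
Local Notation leb := (@lebesgue_measure R).

(** B((N-1)/2, 1/2) = Gamma((N-1)/2) sqrt(pi) / Gamma(N/2), and the numerator cancels the Gamma in
    [alpha_N]. N >= 2 makes the argument (N-1)/2 positive. *)
Lemma sphere_constant (N : nat) : (2 <= N)%N ->
  4 * pi * @alpha_N R N * Beta_fun ((N%:R - 1) / 2) (1 / 2) = 2 * sphere_area N.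
Proof.
move=> N2; have N1 : (0 < N.-1)%N by case: N N2 => [|[|]].
have N0 : (0 < N)%N by exact: ltnW.
have nE : N%:R = N.-1%:R + 1 :> R by rewrite natr1 prednK.
have [g g0 gE] := @eGamma_half_nat R _ N1; have [G G0 GE] := @eGamma_half_nat R _ N0.
have q : (N%:R - 1 = N.-1%:R :> R) by rewrite nE addrK.
have sp0 : 0 < Num.sqrt pi :> R by rewrite sqrtr_gt0 pi_gt0.
have bE : fine (eBeta (N.-1%:R / 2) (1 / 2 : R)) = g * Num.sqrt pi / G.
  have := @eBetaM R (N.-1%:R / 2) (1 / 2); rewrite -mulrDl -nE GE gE eGamma_half.
  have := @eBeta_ge0 R (N.-1%:R / 2) (1 / 2); case: eBeta => [b| |] //= _.
    by rewrite -!EFinM => -[<-]; rewrite mulfK// gt_eqF.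
  by rewrite gt0_mulye ?lte_fin.
rewrite /alpha_N Gamma_funE Beta_funE q gE bE /sphere_area GE /=.
have -> : pi `^ ((N%:R - 3) / 2) = Num.sqrt pi ^+ N.-1 / pi :> R.
  have p0 : 0 < pi :> R := pi_gt0 _.
  rewrite -powR12_sqrt ?(ltW p0)// -powR_mulrn ?powR_ge0// -powRrM.
  rewrite -(powR_inv1 (ltW p0)) powRD_gt0//; congr powR.
  by rewrite nE; field.
rewrite -[in RHS](prednK N0) exprS.
move: (Num.sqrt (pi : R)) (pi : R) (pi_gt0 R) => S P P0; field.
by rewrite !gt_eqF.
Qed.

Lemma kernel_series_ge1 n (s p t : R) : (0 < n)%N -> 0 < s -> 0 < p -> 0 <= t < 1 ->
  1 <= kernel_series n ((n%:R + s * p) / 2) t.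
Proof.
move=> n0 s0 p0 /andP[t0 t1]; have sp0 : 0 < s * p by exact: mulr_gt0.
have l0 : 0 < (n%:R + s * p) / 2 by rewrite divr_gt0// ltr_wpDl// ler0n.
have l1 : 0 < (n%:R + s * p) / 2 + 1 - n%:R / 2 by lra.
have l2 : 0 < n%:R / 2 :> R by rewrite divr_gt0// ltr0n.
apply: limr_ge; first by apply: (cvg_on_hyp _ _ _ l0 l1 l2); rewrite ger0_norm.
exists 1%N => // k /= k1; rewrite /pseries /series/=.
case: k k1 => // k _; rewrite big_nat_recl// expr0 mulr1 hyp_coef0 lerDl.
apply: sumr_ge0 => i _; have := ltW (hyp_coef_gt0 _ _ _ i.+1 l0 l1 l2).
by move: (hyp_coef _ _ _ _) => h h0; rewrite mulr_ge0// exprn_ge0.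
Qed.

Lemma profile_mass_gt0 n (s p kap sg : R) (U : R -> R) : (0 < n)%N -> 0 < s -> 1 < p ->
  radial_profile n s p kap sg U ->
  (forall r, 0 < r -> r < 1 -> U 1 != U r) ->
  (forall r, 0 < r -> r < 1 -> bracket n s p kap r != 0) ->
  (0 < profile_mass n s p kap U)%E.
Proof.
move=> n0 s0 p1 HU U1 br; have p0 := lt_trans ltr01 p1.
have mU := profile_measurable _ _ _ _ _ _ HU.
pose f (r : R) := (osc p U 1 r * (`|bracket n s p kap r| * kernel_profile n s p r))%:E.
have mf : measurable_fun setT f.
  apply: measurable_funEFin; apply: measurable_funM.
    apply: (measurableT_comp (measurable_powR _)); apply: (measurableT_comp (@normr_measurable R setT)).
    exact: measurable_funB.
  apply: measurable_funM; first exact: measurable_norm_bracket.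
  exact: measurable_kernel_profile.
have f0 r : 0 < r -> r < 1 -> (0 < f r)%E.
  move=> r0 r1; rewrite lte_fin; apply: mulr_gt0.
    by rewrite powR_gt0// normr_gt0 subr_eq0 U1.
  apply: mulr_gt0; first by rewrite normr_gt0 br.
  rewrite /kernel_profile gtr0_norm// r1.
  apply: lt_le_trans (kernel_series_ge1 _ _ _ _ n0 s0 p0 _); first exact: ltr01.
  by rewrite sqr_ge0 expr_lt1// ltW.
have m1 : (0 <= profile_mass n s p kap U)%E by exact: profile_mass_ge0.
rewrite lt_neqAle m1 andbT.
(* Zero mass would enclose all of ]0, 1[, where [f] is positive, in a null set. *)
apply/eqP => m0.
have mD : measurable (`]0%R, 1%R[%classic : set R) by exact: measurable_itv.
have : (\int[leb]_(r in `]0%R, 1%R[) `|f r| = 0)%E.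
  rewrite m0; apply: eq_integral => r; rewrite inE/= in_itv/= => /andP[r0 r1].
  by have := ltW (f0 r r0 r1); rewrite lee_fin => h; rewrite ger0_norm.
move/(ae_eq_integral_abs leb mD (measurable_funTS mf)) => -[A [mA A0 hA]].
have : (leb `]0%R, 1%R[%classic <= leb A)%E.
  apply: le_measure; rewrite ?inE// => r /= r01; apply: hA => /= h.
  have := f0 r; move: r01 (h r01); rewrite in_itv/= => /andP[r0 r1] -> /(_ r0 r1).
  by rewrite ltxx.
rewrite A0 (_ : leb _ = 1%:E) ?lee_fin ?ler10//.
by apply: etrans (lebesgue_measure_itv _) _; rewrite /= lte_fin ltr01 -EFinB subr0.
Qed.

End constants.

(** * The constant C(beta) and its sign *)

Section power_functions.
Context {R : realType}.
Local Notation leb := (@lebesgue_measure R).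
Variables (N : nat) (s p beta : R).
Hypotheses (N2 : (2 <= N)%N) (s0 : 0 < s) (s1 : s < 1) (p1 : 1 < p).
Hypotheses (b1 : - (N%:R / (p - 1)) < beta) (b2 : beta < p * s / (p - 1)).

Let N0 : (0 < N)%N. Proof. exact: ltnW. Qed.
Let p0 : 0 < p. Proof. exact: lt_trans p1. Qed.
Let p10 : 0 < p - 1. Proof. by rewrite subr_gt0. Qed.
Let kap := beta * (p - 1).
Let U (r : R) := r `^ beta.
Let beta0 := (p * s - N%:R) / (p - 1).
Let tau := sign_of (beta0 - beta).
Let HU := power_profile N s p beta N0 s0 p1 b1 b2.
Let tau2 : tau ^+ 2 = 1 := sign_of_sqr (beta0 - beta).

Let NE : N%:R = N.-1%:R + 1 :> R. Proof. by rewrite natr1 prednK. Qed.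

Let bracketE r : 0 < r -> bracket N s p kap r = r `^ N.-1%:R - r `^ (s * p - kap - 1).
Proof. by move=> r0; rewrite /bracket powR_mulrn// ltW. Qed.

(** The two exponents of the bracket compare as beta and [beta0] do, so the bracket changes sign
    with beta at [beta0]. *)
Let exponents : (N.-1%:R <= s * p - kap - 1) = (beta <= beta0).
Proof.
rewrite /beta0 ler_pdivlMr// -/kap [p * s]mulrC NE.
by apply/idP/idP => h; lra.
Qed.

Let tau_bracket r : 0 < r -> r < 1 -> 0 <= tau * bracket N s p kap r.
Proof.
move=> r0 r1; have r01 : 0 < r <= 1 by rewrite r0 ltW.
rewrite bracketE// /tau /sign_of subr_ge0 -exponents; case: ifPn => h.
  by rewrite mul1r subr_ge0 ger_powR.
by rewrite mulN1r opprB subr_ge0 ger_powR// ltW// ltNge.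
Qed.

(** Pointwise on (0, 1), the factor with rho^beta is [sign_of beta] times [osc], the bracket is
    [tau] times its absolute value, and [G_hyp] is the Beta factor times [kernel_profile]. The
    finite mass lets these constants leave the integral, and [sphere_constant] matches the
    prefactors. *)
Lemma Cbeta_radial : Cbeta N s p beta = radial_constant N s p kap (sign_of beta) U tau.
Proof.
have [I IE] := profile_mass_fin N s p kap (sign_of beta) U N0 s0 s1 p1 HU tau tau2 tau_bracket.
rewrite /radial_constant IE /= /Cbeta /Rintegral.
pose h r := osc p U 1 r * (`|bracket N s p kap r| * kernel_profile N s p r).
pose B : R := Beta_fun ((N%:R - 1) / 2) (1 / 2).
have mU := profile_measurable _ _ _ _ _ _ HU.
have mh : measurable_fun setT h.
  apply: measurable_funM.
    apply: (measurableT_comp (measurable_powR _)); apply: (measurableT_comp (@normr_measurable R setT)).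
    exact: measurable_funB.
  apply: measurable_funM; first exact: measurable_norm_bracket.
  exact: measurable_kernel_profile.
have h0 r : 0 <= h r by rewrite mulr_ge0 ?powR_ge0// mulr_ge0// kernel_profile_ge0.
have ih : leb.-integrable `]0%R, 1%R[%classic (EFin \o h).
  apply/integrableP; split; first by apply: measurable_funTS; exact: measurable_funEFin.
  rewrite (@eq_integral _ _ _ leb _ (EFin \o h)); last by move=> r _ /=; rewrite ger0_norm.
  by rewrite -[X in (X < _)%E]/(profile_mass N s p kap U) IE ltry.
rewrite (@eq_integral _ _ _ leb _ (fun r => (sign_of beta * tau * B)%:E * (EFin \o h) r)%E); last first.
  move=> r; rewrite inE/= in_itv/= => /andP[r0 r1]; rewrite -EFinM; congr EFin.
  have e1 : `|1 - r `^ beta| `^ (p - 2) * (1 - r `^ beta) = sign_of beta * osc p U 1 r.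
    have st := profile_monotone _ _ _ _ _ _ HU 1 r r0 (ltW r1).
    have := sgPsi N s p kap (sign_of beta) U p1 HU _ st.
    by rewrite /Psi /osc /U powR1.
  have e2 : r `^ (N%:R - 1) - r `^ (p * s - beta * (p - 1) - 1) =
      tau * `|bracket N s p kap r|.
    rewrite -(mulr_sqr1 tau) ?tau_bracket//.
    by rewrite mulrA -expr2 tau2 mul1r bracketE// NE addrK [p * s]mulrC.
  have e3 : G_hyp N s p (r ^+ 2) = B * kernel_profile N s p r.
    rewrite /G_hyp hypergeom2F1E /kernel_profile gtr0_norm// r1 /kernel_series.
    have -> : (p * s + 2) / 2 = (N%:R + s * p) / 2 + 1 - N%:R / 2 :> R by field.
    by rewrite [p * s]mulrC.
  rewrite e1 e2 e3 /h /=; move: (osc _ _ _ _) (`|_|) (kernel_profile _ _ _ _) => x y z.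
  by ring.
rewrite integralZl//.
rewrite -[X in (_ * X)%E]/(profile_mass N s p kap U) IE -EFinM /=.
have := sphere_constant N N2; rewrite -/B => BE.
transitivity (4 * pi * alpha_N N * B * (sign_of beta * tau * I)); first by ring.
by rewrite BE; ring.
Qed.

Lemma power_weak_solution : weak_solution s p [set x : 'rV[R]_N | x != 0]
  (fun x _ => Cbeta N s p beta * eucl_norm x `^ (beta * (p - 1) - s * p))
  (fun x => eucl_norm x `^ beta).
Proof.
rewrite Cbeta_radial.
exact: (radial_weak_solution N s p kap (sign_of beta) U N0 s0 s1 p1 HU tau tau2 tau_bracket).
Qed.

Lemma Cbeta_eq0 : beta = 0 \/ beta = beta0 -> Cbeta N s p beta = 0.
Proof.
move=> hb; rewrite Cbeta_radial /radial_constant /profile_mass integral0_eq ?mulr0// => r.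
rewrite /= in_itv/= => /andP[r0 r1]; congr EFin; case: hb => hb.
  by rewrite /osc /U hb !powRr0 subrr normr0 powR0 ?mul0r// gt_eqF.
have -> : bracket N s p kap r = 0; last by rewrite normr0 mul0r mulr0.
rewrite bracketE// (_ : s * p - kap - 1 = N.-1%:R) ?subrr//.
by rewrite /kap hb /beta0 divfK ?gt_eqF// NE; ring.
Qed.

(** Taking logarithms, 1 = r^beta forces beta = 0, and a zero bracket forces beta = [beta0].
    Otherwise the mass is positive and only the two signs remain. *)
Lemma Cbeta_sign : beta <> 0 -> beta <> beta0 ->
  exists2 c : R, 0 < c & Cbeta N s p beta = sign_of beta * tau * c.
Proof.
move=> bn0 bnb; have [I IE] := profile_mass_fin N s p kap (sign_of beta) U N0 s0 s1 p1 HU tau tau2 tau_bracket.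
exists (2 * sphere_area N * I); last by rewrite Cbeta_radial /radial_constant IE /=; ring.
apply: mulr_gt0; first by apply: mulr_gt0 => //; exact: sphere_area_gt0.
rewrite -lte_fin -IE; apply: (profile_mass_gt0 _ _ _ _ (sign_of beta)) => //.
- move=> r r0 r1; rewrite /U powR1 eq_sym; apply/eqP => h; apply: bn0.
  have := congr1 (@ln R) h; rewrite ln_powR ln1 => /eqP; rewrite mulf_eq0 => /orP[/eqP//|].
  by rewrite lt_eqF// ln_lt0// r0.
- move=> r r0 r1; rewrite bracketE// subr_eq0; apply/eqP => h; apply: bnb.
  have := congr1 (@ln R) h; rewrite !ln_powR => /eqP; rewrite -subr_eq0 -mulrBl mulf_eq0.
  rewrite (lt_eqF (ln_lt0 _)) ?r0// orbF subr_eq0 => /eqP e.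
  have e0 : beta0 * (p - 1) = p * s - N%:R by rewrite /beta0 divfK// gt_eqF.
  apply: (mulIf (lt0r_neq0 p10)); rewrite e0 NE e /kap; ring.
Qed.

(** Strictly between 0 and [beta0], the numbers beta and [beta0 - beta] have the same sign. *)
Lemma Cbeta_gt0 : Num.min beta0 0 < beta -> beta < Num.max beta0 0 -> 0 < Cbeta N s p beta.
Proof.
rewrite gt_min lt_max => h1 h2.
have bn0 : beta <> 0 by move=> b; move: h1 h2; rewrite b ltxx !orbF => h /(lt_trans h); rewrite ltxx.
have bnb : beta <> beta0 by move=> b; move: h1 h2; rewrite b ltxx /= => h /(lt_trans h); rewrite ltxx.
have [c c0 ->] := Cbeta_sign bn0 bnb; rewrite pmulr_lgt0// /tau /sign_of subr_ge0.
have [b|b] := leP 0 beta.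
  have bb : beta <= beta0.
    by case/orP: h2 => [/ltW//|b']; move: (le_lt_trans b b'); rewrite ltxx.
  by rewrite bb mulr1.
have bb : beta0 < beta by case/orP: h1 => // b'; move: (lt_trans b b'); rewrite ltxx.
by rewrite leNgt bb/= mulrNN mulr1.
Qed.

Lemma Cbeta_lt0 : ~ (beta = 0 \/ beta = beta0) ->
  ~ (Num.min beta0 0 < beta /\ beta < Num.max beta0 0) -> Cbeta N s p beta < 0.
Proof.
move=> h1 h2; have bn0 : beta <> 0 by move=> b; apply: h1; left.
have bnb : beta <> beta0 by move=> b; apply: h1; right.
have [c c0 ->] := Cbeta_sign bn0 bnb; rewrite pmulr_llt0// /tau /sign_of subr_ge0.
have [b|b] := leP 0 beta; have [b'|b'] := leP beta beta0.
- exfalso; apply: h2; rewrite gt_min lt_max !lt_neqAle b b' !andbT.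
  by split; apply/orP; [right|left]; apply/eqP => // e; apply: bn0.
- by rewrite mulrN mulr1 oppr_lt0.
- by rewrite mulNr mulr1 oppr_lt0.
- by exfalso; apply: h2; rewrite gt_min lt_max b' b orbT.
Qed.

End power_functions.

Theorem theorem1p1 (R : realType) (N : nat) (s p : R)
    (hN : (2 <= N)%N) (hs0 : 0 < s) (hs1 : s < 1) (hp : 1 < p) :
  (p * s <> N%:R ->
   forall beta : R,
     - (N%:R / (p - 1)) < beta -> beta < p * s / (p - 1) ->
     let beta0 := (p * s - N%:R) / (p - 1) in
     [/\ weak_solution s p [set x : 'rV[R]_N | x != 0]
           (fun x _ => Cbeta N s p beta
                       * eucl_norm x `^ (beta * (p - 1) - s * p))
           (fun x => eucl_norm x `^ beta),
         (beta = 0 \/ beta = beta0 -> Cbeta N s p beta = 0),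
         (Num.min beta0 0 < beta /\ beta < Num.max beta0 0 ->
            0 < Cbeta N s p beta)
       & (~ (beta = 0 \/ beta = beta0) ->
          ~ (Num.min beta0 0 < beta /\ beta < Num.max beta0 0) ->
            Cbeta N s p beta < 0)])
  /\
  (p * s = N%:R ->
   weak_solution s p [set x : 'rV[R]_N | x != 0]
     (fun _ _ => 0)
     (fun x => ln (eucl_norm x))).
Proof.
have N0 : (0 < N)%N by exact: ltnW.
split=> [_ beta b1 b2 beta0|ps].
  split.
  - exact: power_weak_solution.
  - exact: Cbeta_eq0.
  - by move=> [h1 h2]; exact: Cbeta_gt0.
  - exact: Cbeta_lt0.
(* With ps = N and kap = 0 the two exponents of the bracket coincide. The constant is therefore 0,
   and [tau = 1] is an admissible sign. *)
have br0 r : 0 < r -> bracket N s p 0 r = 0.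
  move=> r0; rewrite /bracket subr0 [s * p]mulrC ps (_ : N%:R - 1 = N.-1%:R); last by rewrite -{1}(prednK N0) -natr1 addrK.
  by rewrite powR_mulrn ?subrr// ltW.
have HU : radial_profile N s p 0 1 (@ln R).
  by apply: log_profile => //; rewrite mulrC ps.
have t0 r : 0 < r -> r < 1 -> 0 <= 1 * bracket N s p 0 r.
  by move=> r0 _; rewrite br0// mulr0.
have := radial_weak_solution N s p 0 1 (@ln R) N0 hs0 hs1 hp HU 1 (expr1n _ _) t0.
rewrite (_ : radial_constant _ _ _ _ _ _ _ = 0); last first.
  rewrite /radial_constant /profile_mass integral0_eq ?mulr0// => r.
  by rewrite /= in_itv/= => /andP[r0 _]; rewrite br0// normr0 mul0r mulr0.
suff -> : (fun (x : 'rV[R]_N) (_ : R) => 0 * eucl_norm x `^ (0 - s * p)) = (fun _ _ => 0) by [].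
by apply/funext => x; apply/funext => t; rewrite mul0r.
Qed.
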